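(* Let $r\in\{0,\dots,d-1\}$, $\alpha\in(0,1)$, $1\ge\beta_b\ge\beta_\Sigma>0$, $L_b\ge0$, $L_\Sigma>0$, $C>0$. There is a constant $C_{d,r+1}>1$ depending only on $d$ and $r+1$ such that the following holds. Let $(h_n)$ be block sizes with $h_n\to0$ as $n\to\infty$ and $nh_n\ge2(r+1)C_{d,r+1}$, chosen in one of the following two ways, and consider the test $\varphi_{\alpha,n}=\mathbf 1(T_{n,h_n}>\kappa^{0}_{\alpha,n})$ with the corresponding critical value $\kappa^0_{\alpha,n}$. (i) (No minimal spectral gap assumed.) $\kappa^0_{\alpha,n}=h_n^{\beta_\Sigma}(c_1L_\Sigma+c_2L_b^2n^{-1}h_n^{\beta_b})\alpha^{-1}$; if $L_b>0$, $$h_n\sim(L_\Sigma n)^{-1/(\beta_\Sigma+2)}\vee\bigl(L_b^{-1}L_\Sigma n^{1/2}\bigr)^{-1/(\beta_\Sigma-\beta_b+1/2)},$$ and if $L_b=0$, $h_n\sim(L_\Sigma n)^{-1/(\beta_\Sigma+2)}$. (ii) (Minimal spectral gap $\underline\lambda_{r,n}>0$, which may vary arbitrarily with $n$.) $\kappa^0_{\alpha,n}=h_n^{2\beta_\Sigma}(c_1\underline\lambda_{r,n}^{-1}L_\Sigma^2+c_2L_b^2n^{-1})\alpha^{-1}$; if $L_b>0$, $$h_n\sim\bigl(\underline\lambda_{r,n}^{-1}L_\Sigma^2n\bigr)^{-1/(2\beta_\Sigma+2)}\vee\bigl(\underline\lambda_{r,n}^{-1}L_b^{-1}L_\Sigma^2n^{1/2}\bigr)^{-1/(2\beta_\Sigma-\beta_b+1/2)},$$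 and if $L_b=0$, $h_n\sim(\underline\lambda_{r,n}^{-1}L_\Sigma^2n)^{-1/(2\beta_\Sigma+2)}$. Let $(c_n)$ be a sequence with $c_n\to\infty$, put $\kappa_{\alpha,n}=c_n\bigl(n^{-1}h_n^{-2}+L_bn^{-1/2}h_n^{\beta_b-1/2}\bigr)$, and let $(\hbar_n)\subset(0,1)$ with $\hbar_n/h_n\to\infty$. Then $\varphi_{\alpha,n}$ is asymptotically consistent over the local alternatives $\mathcal H_1(r,\beta_b,L_b,\hbar_n,v_n,C)$ when $v_n$ is larger than a constant multiple of $\kappa_{\alpha,n}$: there exists $c'>0$ such that $$\lim_{n\to\infty}\ \inf\Bigl\{\mathbb P_{(\Sigma,b)}(\varphi_{\alpha,n}=1)\ \Big|\ (\Sigma,b)\in\mathcal H_1(r,\beta_b,L_b,\hbar_n,c'\kappa_{\alpha,n},C)\Bigr\}=1 .$$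
   Context: Model. On a filtered probability space $(\Omega,\mathcal F,(\mathcal F_t)_{t\ge0},\mathbb P)$ let $dX(t)=b(t)\,dt+\sigma(t)\,dW(t)$, $t\in[0,1]$, be $\mathbb R^d$-valued, where $W$ is an $m$-dimensional standard Brownian motion (with respect to the filtration), $b$ is an adapted $\mathbb R^d$-valued process (measurable, so that the integrals make sense) with $\mathbb E[\int_0^1\|b(t)\|dt]<\infty$, and $\sigma(t)\in\mathbb R^{d\times m}$ is deterministic with $\int_0^1\mathrm{tr}(\sigma(t)\sigma(t)^\top)dt<\infty$. The spot covariance is $\Sigma(t)=\sigma(t)\sigma(t)^\top$. $\mathbb P_{(\Sigma,b)}$ denotes probability under the model with spot covariance $\Sigma$ and drift $b$. Observations $X(i/n)$, $i=0,\dots,n$. Block length $h\in(0,1]$ (here $h=h_n$) with $nh,h^{-1}\in\mathbb N$; blocks $I_k=[kh,(k+1)h]$, $k=0,\dots,h^{-1}-1$. $\Delta X_{ik}=X(kh+i/n)-X(kh+(i-1)/n)$, $i=1,\dots,nh$. With $v^{\otimes2}=vv^\top$, the re-centred estimator is $$\hat\Sigma^{kh}=h^{-1}\sum_{i=1}^{nh}\Bigl(\Delta X_{ik}-(nh)^{-1}\sum_{j=1}^{nh}\Delta X_{jk}\Bigr)^{\otimes2}.$$ $\lambda_1(A)\ge\dots\ge\lambda_d(A)$ are the ordered eigenvalues of a symmetric matrix $A$. The test statistic is $T_{n,h}=\sum_{k=0}^{h^{-1}-1}h\,\lambda_{r+1}(\hat\Sigma^{kh})$. Classes. $\mathbb R^{d\times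 d}_{\mathrm{spd}}$ is the set of symmetric positive semi-definite matrices; $\|\cdot\|$ is the Euclidean/spectral norm. $\mathcal H^{\beta_b}(L_b)$ is the class of adapted $\mathbb R^d$-valued processes $b$ on $[0,1]$ with $\mathbb E[\int_0^1\|b(t)\|dt]<\infty$ and $\mathbb E[\|b(s)-b(t)\|^4]^{1/4}\le L_b|s-t|^{\beta_b}$ for all $0\le t\le s\le1$. For $\hbar\in(0,1)$, $v,C>0$, $\mathcal H_1(r,\beta_b,L_b,\hbar,v,C)$ is the set of $(\Sigma,b)\in C([0,1];\mathbb R^{d\times d}_{\mathrm{spd}})\times\mathcal H^{\beta_b}(L_b)$ such that $$\sup_{I\subseteq[0,1],\,|I|\ge\hbar}|I|\min_{t\in I}\lambda_{r+1}(\Sigma(t))\ge v\quad\text{and}\quad\mathrm{tr}\Bigl(\int_0^1\Sigma(t)\,dt\Bigr)\le C,$$ the supremum being over intervals $I$ of length $|I|$. Constants. $c_1,c_2>0$ are fixed constants (depending only on $d$) for which $\varphi_{\alpha,n}$ with critical value $\kappa^0_{\alpha,n}$ has level $\alpha$ uniformly over the null hypothesis, i.e. over all $(\Sigma,b)\in C([0,1];\mathbb R^{d\times d}_{\mathrm{spd}})\times\mathcal H^{\beta_b}(L_b)$ with $\sup_t\mathrm{rank}(\Sigma(t))\le r$, $\|\Sigma(t)-\Sigma(s)\|\le L_\Sigma|t-s|^{\beta_\Sigma}$ for all $s,t$ and, in case (ii), additionally $\inf_t\lambda_r(\Sigma(t))\ge\underline\lambda_{r,n}$. $a\vee b=\max\{a,b\}$;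 $a_n\sim b_n$ means that $a_n\le Kb_n$ and $b_n\le Ka_n$ for all $n$ with a constant $K>0$ independent of $n$. An infimum of probabilities over an empty class is read as $1$. *)

(* Defs.v *)
From HB Require Import structures.
From mathcomp Require Import all_boot all_order all_algebra.
From mathcomp Require Import all_classical all_reals all_analysis.
Set Implicit Arguments.
Unset Strict Implicit.
Unset Printing Implicit Defensive.
Import Order.TTheory GRing.Theory Num.Theory.
Import numFieldNormedType.Exports.
Local Open Scope classical_set_scope.
Local Open Scope ring_scope.

(* The norm [`|_|] of MathComp-Analysis on matrices is the entrywise maximum,
   hence the two definitions below. *)
Definition eucl (R : realType) (d : nat) (v : 'cV[R]_d) : R :=
  Num.sqrt (\sum_(i < d) v i 0 ^+ 2).

Definition opnorm (R : realType) (d : nat) (A : 'M[R]_d) : R :=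
  sup [set eucl (A *m v) | v in [set v : 'cV[R]_d | eucl v = 1]].

(* The nonincreasing list of the eigenvalues of A, repeated according to their
   algebraic multiplicity; it exists (and is unique) for symmetric A. *)
Definition spectrum (R : realType) (d : nat) (A : 'M[R]_d) : seq R :=
  xget [::] [set s : seq R | sorted (fun x y => y <= x) s
                           /\ char_poly A = \prod_(x <- s) ('X - x%:P)].

(* Numbered from 1: [eigval 1 A] is the largest eigenvalue. *)
Definition eigval (R : realType) (d : nat) (k : nat) (A : 'M[R]_d) : R :=
  nth 0 (spectrum A) k.-1.

Definition spd (R : realType) (d : nat) (A : 'M[R]_d) : Prop :=
  A^T = A /\ forall v : 'cV[R]_d, 0 <= (v^T *m A *m v) 0 0.

Definition outer (R : realType) (d : nat) (v : 'cV[R]_d) : 'M[R]_d := v *m v^T.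

Definition int_mx (R : realType) (p q : nat) (f : R -> 'M[R]_(p, q)) (a b : R) :
    'M[R]_(p, q) :=
  \matrix_(i, j) \int[@lebesgue_measure R]_(t in `[a, b]) (f t i j).

Definition filtration (R : realType) (disp : measure_display)
    (Omega : measurableType disp) (F : R -> set (set Omega)) : Prop :=
  (forall t, 0 <= t -> sigma_algebra setT (F t) /\ F t `<=` measurable) /\
  (forall s t, 0 <= s -> s <= t -> F s `<=` F t).

Definition adapted_at (R : realType) (disp : measure_display)
    (Omega : measurableType disp) (F : R -> set (set Omega)) (p : nat)
    (Z : R -> Omega -> 'cV[R]_p) (t : R) : Prop :=
  forall (i : 'I_p) (B : set R), measurable B -> F t [set w | B (Z t w i 0)].

(* The product formula says at once that W t - W s has law N(0, (t - s) I_m)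
   and is independent of F s. *)
Definition brownian_motion (R : realType) (disp : measure_display)
    (Omega : measurableType disp) (P : probability Omega R)
    (F : R -> set (set Omega)) (m : nat) (W : R -> Omega -> 'cV[R]_m) : Prop :=
  [/\ forall t, 0 <= t -> adapted_at F W t,
      {ae P, forall w, W 0 w = 0},
      forall (s t : R) (E : set Omega) (B : 'I_m -> set R),
        0 <= s -> s < t -> F s E -> (forall j, measurable (B j)) ->
        P (E `&` [set w | forall j, B j (W t w j 0 - W s w j 0)]) =
        (P E * \prod_(j < m) normal_prob 0 (Num.sqrt (t - s)) (B j))%E
    & {ae P, forall w, {within `[0, +oo[, continuous (W^~ w)}}].

(* [:: ((s1, t1), a1); ((s2, t2), a2); ...] encodes the step function
   a1 1_(s1, t1] + a2 1_(s2, t2] + ... *)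
Definition step_fun (R : realType) (g : seq (R * R * R)) (x : R) : R :=
  \sum_(q <- g) q.2 * \1_(`]q.1.1, q.1.2]%classic) x.

Definition step_int (R : realType) (Omega : Type) (B : R -> Omega -> R)
    (g : seq (R * R * R)) (w : Omega) : R :=
  \sum_(q <- g) q.2 * (B q.1.2 w - B q.1.1 w).

(* Y is (a version of) the stochastic integral over [0, t] of the deterministic
   square integrable f against the real Brownian motion B: the L^2(P)-limit of
   the elementary integrals of step functions converging to f in L^2([0, t]). *)
Definition is_wiener_int (R : realType) (disp : measure_display)
    (Omega : measurableType disp) (P : probability Omega R)
    (B : R -> Omega -> R) (f : R -> R) (t : R) (Y : Omega -> R) : Prop :=
  measurable_fun setT Y /\
  exists g : nat -> seq (R * R * R),
    [/\ forall k q, q \in g k -> [/\ 0 <= q.1.1, q.1.1 <= q.1.2 & q.1.2 <= t],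
        (\int[@lebesgue_measure R]_(x in `[0%R, t])
           ((step_fun (g k) x - f x) ^+ 2)%:E)%E @[k --> \oo] --> 0%E
      & (\int[P]_w ((step_int B (g k) w - Y w) ^+ 2)%:E)%E @[k --> \oo] --> 0%E].

Definition drift (R : realType) (disp : measure_display)
    (Omega : measurableType disp) (P : probability Omega R)
    (F : R -> set (set Omega)) (d : nat) (b : R -> Omega -> 'cV[R]_d) : Prop :=
  [/\ forall t, 0 <= t <= 1 -> adapted_at F b t,
      forall i : 'I_d,
        measurable_fun
          (`[0%R, 1%R]%classic `*` setT : set (measurableTypeR R * Omega))
          (fun q : measurableTypeR R * Omega => b q.1 q.2 i 0)
    & (\int[P]_w \int[@lebesgue_measure R]_(t in `[0%R, 1%R])
         (eucl (b t w))%:E < +oo)%E].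

Definition drift_class (R : realType) (disp : measure_display)
    (Omega : measurableType disp) (P : probability Omega R)
    (F : R -> set (set Omega)) (d : nat) (betab Lb : R)
    (b : R -> Omega -> 'cV[R]_d) : Prop :=
  drift P F b /\
  forall s t : R, 0 <= t -> t <= s -> s <= 1 ->
    (poweR (\int[P]_w (eucl (b s w - b t w) ^+ 4)%:E) 4^-1
       <= (Lb * `|s - t| `^ betab)%:E)%E.

(* X is an Ito process dX = b dt + sigma dW on [0, 1] for some deterministic
   square root sigma of the spot covariance Sigma. *)
Definition ito_model (R : realType) (disp : measure_display)
    (Omega : measurableType disp) (P : probability Omega R)
    (F : R -> set (set Omega)) (m : nat) (W : R -> Omega -> 'cV[R]_m) (d : nat)
    (Sigma : R -> 'M[R]_d) (b X : R -> Omega -> 'cV[R]_d) : Prop :=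
  drift P F b /\
  (forall t i, 0 <= t <= 1 -> measurable_fun setT (fun w => X t w i 0)) /\
  exists sigma : R -> 'M[R]_(d, m),
    [/\ forall i j, measurable_fun (`[0%R, 1%R]%classic : set (measurableTypeR R))
                      (fun t => sigma t i j),
        (\int[@lebesgue_measure R]_(t in `[0%R, 1%R])
           (\tr (sigma t *m (sigma t)^T))%:E < +oo)%E,
        forall t, 0 <= t <= 1 -> Sigma t = sigma t *m (sigma t)^T
      & forall t, 0 <= t <= 1 ->
          exists Y : 'I_d -> 'I_m -> Omega -> R,
            (forall i j,
               is_wiener_int P (fun s w => W s w j 0) (fun s => sigma s i j) t
                 (Y i j)) /\
            {ae P, forall w, X t w = X 0 w + int_mx (b^~ w) 0 t
                                     + \col_i \sum_(j < m) Y i j w}].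

(* In the next four definitions x is a path of X.  For admissible block lengths
   h both h^-1 and n h are integers, and [Num.truncn] merely turns them into
   elements of nat. *)
Definition increment (R : realType) (d n : nat) (h : R) (x : R -> 'cV[R]_d)
    (k i : nat) : 'cV[R]_d :=
  x (k%:R * h + i%:R / n%:R) - x (k%:R * h + (i%:R - 1) / n%:R).

Definition Sigma_hat (R : realType) (d n : nat) (h : R) (x : R -> 'cV[R]_d)
    (k : nat) : 'M[R]_d :=
  let N := Num.truncn (n%:R * h) in
  h^-1 *: \sum_(1 <= i < N.+1)
    outer (increment n h x k i
           - (n%:R * h)^-1 *: \sum_(1 <= j < N.+1) increment n h x k j).

Definition T_stat (R : realType) (d r n : nat) (h : R) (x : R -> 'cV[R]_d) : R :=
  \sum_(0 <= k < Num.truncn h^-1) h * eigval r.+1 (Sigma_hat n h x k).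

Definition phi (R : realType) (d r n : nat) (h kappa : R) (x : R -> 'cV[R]_d) :
    bool :=
  kappa < T_stat r n h x.

Definition admissible_block (R : realType) (n : nat) (h : R) : Prop :=
  [/\ 0 < h, h <= 1, n%:R * h \is a Num.nat & h^-1 \is a Num.nat].

Definition Cspd (R : realType) (d : nat) (Sigma : R -> 'M[R]_d) : Prop :=
  {within `[0%R, 1%R], continuous Sigma} /\
  forall t, 0 <= t <= 1 -> spd (Sigma t).

Definition null_cov (R : realType) (d r : nat) (betaS LS : R)
    (Sigma : R -> 'M[R]_d) : Prop :=
  [/\ Cspd Sigma,
      forall t, 0 <= t <= 1 -> (\rank (Sigma t) <= r)%N
    & forall s t, 0 <= s <= 1 -> 0 <= t <= 1 ->
        opnorm (Sigma t - Sigma s) <= LS * `|t - s| `^ betaS].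

(* For r = 0 there is no r-th eigenvalue (lambda_0 = +oo): no restriction. *)
Definition null_cov_gap (R : realType) (d r : nat) (betaS LS lam : R)
    (Sigma : R -> 'M[R]_d) : Prop :=
  null_cov r betaS LS Sigma /\
  ((0 < r)%N -> forall t, 0 <= t <= 1 -> lam <= eigval r (Sigma t)).

Definition alt_cov (R : realType) (d r : nat) (hbar v C : R)
    (Sigma : R -> 'M[R]_d) : Prop :=
  [/\ Cspd Sigma,
      (v%:E <= ereal_sup
         [set x : \bar R | exists a c : R,
            [/\ 0 <= a, c <= 1, hbar <= c - a
              & x = ((c - a)
                     * inf [set eigval r.+1 (Sigma t) | t in `[a, c]])%:E]]%R)%E
    & \tr (int_mx Sigma 0 1) <= C].

Definition has_level (R : realType) (disp : measure_display)
    (Omega : measurableType disp) (P : probability Omega R)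
    (F : R -> set (set Omega)) (m : nat) (W : R -> Omega -> 'cV[R]_m)
    (d r n : nat) (h kappa betab Lb alpha : R)
    (null : (R -> 'M[R]_d) -> Prop) : Prop :=
  forall (Sigma : R -> 'M[R]_d) (b X : R -> Omega -> 'cV[R]_d),
    null Sigma -> drift_class P F betab Lb b -> ito_model P F W Sigma b X ->
    (P [set w | phi r n h kappa (X^~ w)] <= alpha%:E)%E.

(* As probabilities are at most 1, adjoining the value 1 only matters when the
   class is empty, where it gives the infimum 1. *)
Definition min_power (R : realType) (disp : measure_display)
    (Omega : measurableType disp) (P : probability Omega R)
    (F : R -> set (set Omega)) (m : nat) (W : R -> Omega -> 'cV[R]_m)
    (d r n : nat) (h kappa betab Lb hbar v C : R) : \bar R :=
  ereal_inf ([set x | exists (Sigma : R -> 'M[R]_d)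
                             (b X : R -> Omega -> 'cV[R]_d),
                [/\ alt_cov r hbar v C Sigma,
                    drift_class P F betab Lb b,
                    ito_model P F W Sigma b X
                  & x = P [set w | phi r n h kappa (X^~ w)]]]
             `|` [set 1%E]).

Definition crit_nogap (R : realType) (c1 c2 alpha betab betaS Lb LS : R)
    (n : nat) (h : R) : R :=
  h `^ betaS * (c1 * LS + c2 * Lb ^+ 2 * n%:R^-1 * h `^ betab) * alpha^-1.

Definition rate_nogap (R : realType) (betab betaS Lb LS : R) (n : nat) : R :=
  let r1 := (LS * n%:R) `^ (- (betaS + 2)^-1) in
  if Lb == 0 then r1 else
  Num.max r1
    ((Lb^-1 * LS * n%:R `^ 2^-1) `^ (- (betaS - betab + 2^-1)^-1)).

Definition crit_gap (R : realType) (c1 c2 alpha betaS Lb LS lam : R)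
    (n : nat) (h : R) : R :=
  h `^ (2 * betaS) * (c1 * lam^-1 * LS ^+ 2 + c2 * Lb ^+ 2 * n%:R^-1)
  * alpha^-1.

Definition rate_gap (R : realType) (betab betaS Lb LS lam : R) (n : nat) : R :=
  let r1 := (lam^-1 * LS ^+ 2 * n%:R) `^ (- (2 * betaS + 2)^-1) in
  if Lb == 0 then r1 else
  Num.max r1
    ((lam^-1 * Lb^-1 * LS ^+ 2 * n%:R `^ 2^-1)
       `^ (- (2 * betaS - betab + 2^-1)^-1)).

Definition kappa_alt (R : realType) (betab Lb : R) (n : nat) (h c : R) : R :=
  c * (n%:R^-1 * h ^- 2 + Lb * n%:R `^ (- 2^-1) * h `^ (betab - 2^-1)).

Definition same_order (R : realType) (A : set nat) (u v : nat -> R) : Prop :=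
  exists2 K : R, 0 < K & forall n, A n -> u n <= K * v n /\ v n <= K * u n.

(* Main.v *)
Require Import Defs.
From HB Require Import structures.
From mathcomp Require Import all_boot all_order all_algebra.
From mathcomp Require Import perm.
From mathcomp Require Import -(notations) complex.
From mathcomp Require Import all_classical all_reals all_analysis.
From mathcomp Require Import measurable_realfun.
From mathcomp Require Import ring lra zify.
Set Implicit Arguments.
Unset Strict Implicit.
Unset Printing Implicit Defensive.
Import Order.TTheory GRing.Theory Num.Theory.
Import numFieldNormedType.Exports.
Local Open Scope classical_set_scope.
Local Open Scope ring_scope.

(* Differences of neighbouring increments inside a block cancel the block mean,
   so lambda_{r+1}(Sigma_hat) is, up to constants, at least (1 / h) eta^2 times
   the number of groups of r + 1 such differences that are eta-separated: every
   subspace of codimension at most r then sees one of the r + 1 vectors.  A group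
   fails to be separated with small probability whenever lambda_{r+1}(Sigma) >= lam
   there.  Indeed, conditionally on the other differences, the component of each
   difference along a direction orthogonal to them and of energy at least lam / n is
   Gaussian (an anti-concentration bound), and the drift part of a second difference
   involves only b(t) - b(s), which is of order L_b + 1 in L^1.  Taking
   eta^2 = c_n^{-1/2} lam / n, the proportion of failing groups tends to 0 by
   Markov's inequality, without any independence between groups, and
   T_{n,h} is at least a multiple of c_n^{1/2} (n^{-1} h^{-2} + ...), which
   dominates kappa^0 since the choice of h balances bias and noise. *)

(** The integrand [sigma] is merely measurable and the stochastic integral is only an L^2 limit, so
    integrands are replaced by step functions at the price of exceptional events of small
    probability. No conditional law is formed either: conditioning on the other differences is
    replaced by a countable partition of the sample space into cells on which these are almost
    constant. The direction must be the same throughout a time interval, while the eigenvectors of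
    Sigma(t) may move freely with t; it is therefore found from the trace of a compression of
    Sigma(t), which can be integrated over time, at the cost of a factor of order d. The alternative
    gives lam >= c_n / (2 n), because intervals have length at most 1 and kappa_{alpha,n} >= c_n /
    n. With the stated eta, the Gaussian error and the drift error are then both of order
    c_n^{-1/4}, and the excess c_n^{1/2} of the statistic absorbs every constant. *)

Local Notation steps R := (seq (R * R * R)).

Lemma le_of_eq (disp : Order.disp_t) (T : porderType disp) (x y : T) : x = y -> (x <= y)%O.
Proof. by move=> ->. Qed.

(** * Spectra of symmetric matrices *)

(** Over the complex numbers an eigenvalue z with eigenvector v exists. Both v v^* and v A v^* = z v
    v^* are real, the latter by symmetry of A, hence z is real and is a root of the real
    characteristic polynomial. *)
Lemma symmetric_eigenvalue (R : realType) (n : nat) (A : 'M[R]_n.+1) :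
  A^T = A -> exists a : R, eigenvalue A a.
Proof.
move=> symA.
pose f : {rmorphism R -> complex R} := real_complex R.
have fJ x : ((f x)^* = f x)%R by rewrite /f /=; apply: conj_Creal; rewrite complex_real.
have [z] := eigenvalue_closed (map_mx f A) (ltn0Sn n).
move=> ez; have [v vA v0] := eigenvalueP ez.
pose vc := map_mx Num.conj v^T.
pose q : complex R := (v *m vc) 0 0.
have q0 : q != 0.
  rewrite /q mxE; apply: contraNneq v0 => /eqP.
  rewrite psumr_eq0 => [/allP h|i _]; last by rewrite !mxE mul_conjC_ge0.
  apply/eqP/rowP => i; rewrite mxE.
  have := h i (mem_index_enum _); rewrite /= !mxE.
  by rewrite mul_conjC_eq0 => /eqP.
have qr : q^* = q.
  rewrite /q mxE rmorph_sum; apply: eq_bigr => i _.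
  by rewrite !mxE rmorphM /= conjCK mulrC.
have zq : (v *m map_mx f A *m vc) 0 0 = z * q by rewrite vA -scalemxAl mxE.
have zr : z^* = z.
  apply: (mulIf q0); rewrite -[in LHS]qr -rmorphM -zq.
  rewrite !mxE rmorph_sum.
  transitivity (\sum_i \sum_j v 0 i * f (A i j) * (v 0 j)^*).
    apply: eq_bigr => i _; rewrite !mxE rmorphM /= conjCK rmorph_sum mulr_suml.
    apply: eq_bigr => j _; rewrite !mxE rmorphM /= fJ mulrC -mulrA.
    by congr (_ * _); rewrite mulrC -[in LHS]symA mxE.
  rewrite exchange_big; apply: eq_bigr => i _; rewrite !mxE mulr_suml.
  by apply: eq_bigr => j _; rewrite !mxE.
have [a za] : exists a, z = f a.
  case: z zr {ez vA zq} => x y [] /eqP.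
  by rewrite -subr_eq0 -opprD oppr_eq0 -mulr2n mulrn_eq0/= => /eqP ->; exists x.
exists a; move: ez; rewrite !eigenvalue_root_char za.
by rewrite -map_char_poly fmorph_root.
Qed.

(** The reflection in the hyperplane orthogonal to v - e exchanges the unit vectors e and v; it
    degenerates for v = e, where the identity serves. *)
Lemma householder (R : realFieldType) (n : nat) (v : 'cV[R]_n.+1) :
  v^T *m v = 1%:M -> exists H : 'M[R]_n.+1,
  [/\ H^T = H, H *m H = 1%:M & H *m delta_mx 0 0 = v].
Proof.
move=> vv; pose e : 'cV[R]_n.+1 := delta_mx 0 0; pose w := v - e.
have [w0|wn0] := eqVneq w 0.
  exists 1%:M; rewrite trmx1 mul1mx mul1mx; split=> //.
  by apply/esym/eqP; rewrite -subr_eq0; apply/eqP.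
have ee : e^T *m e = 1%:M.
  by rewrite trmx_delta mul_delta_mx; apply/matrixP=> i j; rewrite !ord1 !mxE.
pose s : R := (v^T *m e) 0 0.
have ve : v^T *m e = s%:M by rewrite [LHS]mx11_scalar.
have ev : e^T *m v = s%:M by rewrite -[LHS]trmxK trmx_mul trmxK ve tr_scalar_mx.
have wT : w^T = v^T - e^T by rewrite /w linearB.
have ww : w^T *m w = (2 - 2 * s)%:M.
  rewrite wT /w mulmxBl !mulmxBr vv ee ve ev -!raddfB /=.
  by congr (_%:M); ring.
have s1 : 2 - 2 * s != 0.
  apply: contraNneq wn0 => s1; move: ww; rewrite s1 => /matrixP/(_ 0 0).
  rewrite !mxE mul0rn => /eqP; rewrite psumr_eq0 => [/allP h|i _]; last first.
    by rewrite mxE -expr2 sqr_ge0.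
  apply/eqP/colP => i; have := h i (mem_index_enum _).
  by rewrite /= mxE -expr2 sqrf_eq0 => /eqP; rewrite mxE => ->; rewrite mxE.
exists (1%:M - (2 / (2 - 2 * s)) *: (w *m w^T)); split.
- by rewrite linearB linearZ /= trmx_mul trmxK trmx1.
- rewrite mulmxBl mul1mx mulmxBr mulmx1 -scalemxAl -scalemxAr mulmxA.
  rewrite -[w *m _ *m w]mulmxA ww mul_mx_scalar -scalemxAl !scalerA.
  set W := w *m w^T; set c := 2 / (2 - 2 * s).
  have -> : c * (c * (2 - 2 * s)) = c + c by rewrite /c; field.
  by rewrite scalerDl opprB addrK subrK.
- rewrite mulmxBl mul1mx -scalemxAl -mulmxA wT [(v^T - _) *m _]mulmxBl ve ee.
  rewrite -raddfB /= mul_mx_scalar scalerA.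
  suff -> : 2 / (2 - 2 * s) * (s - 1) = -1 by rewrite scaleN1r opprK /w addrC subrK.
  by field.
Qed.

(** Induction on the dimension: a reflection carries the first basis vector to a unit eigenvector,
    and symmetry makes the conjugated matrix block diagonal, with a smaller symmetric block left. *)
Theorem symmetric_spectral (R : realType) (n : nat) (A : 'M[R]_n) :
  A^T = A -> exists (Q : 'M[R]_n) (l : 'rV[R]_n),
  Q *m Q^T = 1%:M /\ A = Q^T *m diag_mx l *m Q.
Proof.
elim: n A => [|n IH] A symA.
  by exists 1%:M, 0; split; apply/matrixP => -[].
have [a /eigenvalueP[u uA u0]] := symmetric_eigenvalue symA.
pose q := (u *m u^T) 0 0.
have q0 : 0 < q.
  rewrite lt0r; apply/andP; split.
    rewrite /q mxE; apply: contraNneq u0 => /eqP.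
    rewrite psumr_eq0 => [/allP h|i _]; last by rewrite mxE -expr2 sqr_ge0.
    apply/eqP/rowP => i; have := h i (mem_index_enum _).
    by rewrite /= mxE -expr2 sqrf_eq0 => /eqP ->; rewrite mxE.
  by rewrite /q mxE; apply: sumr_ge0 => i _; rewrite mxE -expr2 sqr_ge0.
pose v := (Num.sqrt q)^-1 *: u^T.
have vv : v^T *m v = 1%:M.
  have -> : v^T = (Num.sqrt q)^-1 *: u by rewrite /v linearZ /= trmxK.
  rewrite /v -scalemxAl -scalemxAr scalerA [_ *m _]mx11_scalar -/q.
  by rewrite scale_scalar_mx -invfM -expr2 sqr_sqrtr ?ltW// mulVf ?gt_eqF.
have Av : A *m v = a *: v.
  by rewrite /v -scalemxAr -[A]symA -trmx_mul uA linearZ /= !scalerA mulrC.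
have [H [HT HH He]] := householder vv.
pose B : 'M[R]_(1 + n) := H *m A *m H.
have BT : B^T = B by rewrite /B !trmx_mul HT symA mulmxA.
have Be : B *m delta_mx 0 0 = a *: delta_mx 0 0 :> 'cV_n.+1.
  by rewrite /B -!mulmxA He Av -scalemxAr -He mulmxA HH mul1mx.
have AB : A = H *m B *m H by rewrite /B !mulmxA HH mul1mx -mulmxA HH mulmx1.
clearbody B.
have Bul : ulsubmx B = a%:M.
  apply/matrixP => i j; rewrite !ord1 !mxE /=.
  have /matrixP/(_ 0 0) := Be; rewrite -colE !mxE /= !mulr1 => <-.
  by congr (B _ _); apply/val_inj.
have Bdl : dlsubmx B = 0.
  apply/matrixP => i j; rewrite !ord1 !mxE /=.
  have /matrixP/(_ (rshift 1 i) 0) := Be; rewrite -colE !mxE /= !mulr0 => <-.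
  by congr (B _ _); apply/val_inj.
have Bur : ursubmx B = 0 by rewrite -[B]BT -trmx_dlsub Bdl trmx0.
have symB : (drsubmx B)^T = drsubmx B by rewrite trmx_drsub BT.
have [Q [l [QQ dB]]] := IH _ symB.
pose K : 'M[R]_(1 + n) := block_mx 1%:M 0 0 Q.
have KT : K^T = block_mx 1%:M 0 0 Q^T by rewrite /K tr_block_mx trmx1 !trmx0.
have KK : K *m K^T = 1%:M.
  rewrite KT mulmx_block !mulmx0 !mul0mx !addr0 add0r mulmx1 QQ.
  by rewrite -scalar_mx_block.
have BK : B = K^T *m diag_mx (row_mx a%:M l) *m K.
  rewrite -[LHS]submxK Bul Bdl Bur dB diag_mx_row KT !mulmx_block.
  rewrite !(mulmx0, mul0mx, addr0, add0r, mulmx1, mul1mx).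
  by congr block_mx; apply/matrixP => i j; rewrite !ord1 !mxE.
exists (K *m H), (row_mx a%:M l : 'rV[R]_(1 + n)); split.
  by rewrite trmx_mul HT mulmxA -[K *m H *m H]mulmxA HH mulmx1.
by rewrite [LHS]AB [in LHS]BK trmx_mul HT !mulmxA.
Qed.

Lemma char_poly_orthogonal (R : comNzRingType) (n : nat) (Q A : 'M[R]_n) :
  Q *m Q^T = 1%:M -> char_poly (Q^T *m A *m Q) = char_poly A.
Proof.
move=> QQ; have QQ' : Q^T *m Q = 1%:M by apply: mulmx1C.
have QP : map_mx polyC Q^T *m map_mx polyC Q = 1%:M.
  by rewrite -map_mxM QQ' map_mx1.
rewrite /char_poly; have -> : char_poly_mx (Q^T *m A *m Q) =
    map_mx polyC Q^T *m char_poly_mx A *m map_mx polyC Q.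
  rewrite /char_poly_mx mulmxBr mulmxBl !map_mxM /= mul_mx_scalar -scalemxAl.
  by rewrite QP scalemx1.
by rewrite !det_mulmx mulrAC -det_mulmx QP det1 mul1r.
Qed.

(** Since [spectrum] is a choice, a suitable list has to be exhibited first: the sorted diagonal of
    the spectral theorem. Unique factorisation of the characteristic polynomial then makes the
    chosen list a permutation of that diagonal, and the rows of Q are permuted accordingly. *)
Lemma spectrum_spectral (R : realType) (d : nat) (A : 'M[R]_d) : A^T = A ->
  exists Q : 'M[R]_d,
  [/\ Q *m Q^T = 1%:M, size (spectrum A) = d,
      sorted (fun x y => y <= x) (spectrum A)
    & A = Q^T *m diag_mx (\row_i (spectrum A)`_i) *m Q].
Proof.
move=> symA; have [Q [l [QQ Al]]] := symmetric_spectral symA.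
pose t := [tuple l 0 i | i < d].
have cA : char_poly A = \prod_(x <- t) ('X - x%:P).
  rewrite Al char_poly_orthogonal // char_poly_trig ?diag_mx_is_trig//.
  rewrite big_tuple; apply: eq_bigr => i _.
  by rewrite tnth_mktuple !mxE eqxx mulr1n.
have [] : [set s : seq R | sorted (fun x y => y <= x) s
                /\ char_poly A = \prod_(x <- s) ('X - x%:P)] (spectrum A).
  apply: (@xgetPex _ [::]); exists (sort (fun x y => y <= x) t).
  split; first by apply: sort_sorted => x y; exact: le_total.
  by rewrite cA; apply: perm_big; rewrite perm_sym perm_sort.
set s := spectrum A => ss /esym; rewrite cA => /prod_XsubC_eq st.
have szs : size s = d by rewrite (perm_size st) size_tuple.
have /perm.tuple_permP[p sp] := st.
exists (rowsub p Q); split => //.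
- by rewrite trmx_mxsub -mxsub_mul QQ; apply/matrixP => i j; rewrite !mxE (inj_eq perm.perm_inj).
- rewrite Al trmx_mxsub; apply/matrixP => i j; rewrite !mxE.
  rewrite (reindex_inj (@perm.perm_inj _ p)); apply: eq_bigr => k _ /=.
  rewrite !mxE; congr (_ * _).
  rewrite (bigD1 (p k))//= [RHS](bigD1 k)//= !big1 ?addr0.
  - by rewrite !mxE !eqxx sp -tnth_nth !tnth_mktuple.
  - by move=> m mk; rewrite !mxE (negPf mk) mulr0n mulr0.
  - by move=> m mk; rewrite !mxE (negPf mk) mulr0n mulr0.
Qed.

Lemma mulmx_tr_sqr (R : pzRingType) (n : nat) (v : 'rV[R]_n) :
  (v *m v^T) 0 0 = \sum_i v 0 i ^+ 2.
Proof. by rewrite mxE; apply: eq_bigr => i _; rewrite mxE expr2. Qed.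

Lemma mulmx_tr_gt0 (R : realDomainType) (n : nat) (v : 'rV[R]_n) :
  v != 0 -> 0 < (v *m v^T) 0 0.
Proof.
move=> v0; rewrite mulmx_tr_sqr lt_neqAle sumr_ge0 ?andbT; last first.
  by move=> i _; exact: sqr_ge0.
apply: contraNneq v0 => /esym/eqP; rewrite psumr_eq0 => [/allP h|i _]; last first.
  exact: sqr_ge0.
apply/eqP/rowP => i; have := h i (mem_index_enum _).
by rewrite /= sqrf_eq0 => /eqP ->; rewrite mxE.
Qed.

Lemma diag_form (R : comPzRingType) (n : nat) (l y : 'rV[R]_n) :
  (y *m diag_mx l *m y^T) 0 0 = \sum_i l 0 i * y 0 i ^+ 2.
Proof.
rewrite mxE; apply: eq_bigr => i _; rewrite mul_mx_diag !mxE expr2.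
by rewrite mulrAC mulrC.
Qed.

Lemma conj_rowsub (R : pzRingType) (m n : nat) (f : 'I_m -> 'I_n) (Q A : 'M[R]_n) :
  rowsub f Q *m A *m (rowsub f Q)^T = mxsub f f (Q *m A *m Q^T).
Proof. by rewrite trmx_mxsub mul_rowsub_mx -mxsub_mul. Qed.

Lemma rowsub_orthonormal (R : pzRingType) (m n : nat) (f : 'I_m -> 'I_n) (Q : 'M[R]_n) :
  injective f -> Q *m Q^T = 1%:M -> rowsub f Q *m (rowsub f Q)^T = 1%:M.
Proof.
move=> fi QQ; rewrite trmx_mxsub -mxsub_mul QQ.
by apply/matrixP => i j; rewrite !mxE (inj_eq fi).
Qed.

(** The rows of B are the eigenvectors numbered r + 1 to d. With [eigval_top], which takes those
    numbered 1 to r + 1, this replaces the min-max formula. *)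
Lemma eigval_bottom (R : realType) (d r : nat) (A : 'M[R]_d) :
  A^T = A -> (r < d)%N -> exists (B : 'M[R]_(d - r, d)) (l : 'rV[R]_(d - r)),
  [/\ B *m B^T = 1%:M, B *m A *m B^T = diag_mx l
    & forall i, l 0 i <= eigval r.+1 A].
Proof.
move=> symA rd; have [Q [QQ sz so AQ]] := spectrum_spectral symA.
have lt (i : 'I_(d - r)) : (r + i < d)%N by rewrite -ltn_subRL.
pose f (i : 'I_(d - r)) := Ordinal (lt i).
exists (rowsub f Q), (\row_i (spectrum A)`_(f i)); split.
- by apply: rowsub_orthonormal => // i j /(congr1 val)/= /addnI/val_inj.
- rewrite conj_rowsub {1}AQ !mulmxA QQ mul1mx -mulmxA QQ mulmx1.
  apply/matrixP => i j; rewrite !mxE; congr (_ *+ nat_of_bool _).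
  by rewrite -!val_eqE /= eqn_add2l.
- move=> i; rewrite mxE /eigval /=.
  apply: (sorted_leq_nth _ _ 0 so); rewrite ?inE ?sz ?leq_addr//.
  by move=> x y z yx zy; exact: le_trans zy yx.
Qed.

Lemma eigval_top (R : realType) (d r : nat) (A : 'M[R]_d) :
  A^T = A -> (r < d)%N -> exists (B : 'M[R]_(r.+1, d)) (l : 'rV[R]_r.+1),
  [/\ B *m B^T = 1%:M, B *m A *m B^T = diag_mx l
    & forall i, eigval r.+1 A <= l 0 i].
Proof.
move=> symA rd; have [Q [QQ sz so AQ]] := spectrum_spectral symA.
pose f (i : 'I_r.+1) := widen_ord rd i.
exists (rowsub f Q), (\row_i (spectrum A)`_(f i)); split.
- by apply: rowsub_orthonormal => // i j /(congr1 val)/= /val_inj.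
- rewrite conj_rowsub {1}AQ !mulmxA QQ mul1mx -mulmxA QQ mulmx1.
  by apply/matrixP => i j; rewrite !mxE; congr (_ *+ nat_of_bool _).
- move=> i; rewrite mxE /eigval /=.
  apply: (sorted_leq_nth _ _ 0 so); rewrite ?inE ?sz//.
  + by move=> x y z yx zy; exact: le_trans zy yx.
  + exact: leq_trans (ltn_ord i) rd.
  + by rewrite -ltnS.
Qed.

(** More than d rows in dimension d are dependent. Orthonormality of each family forces both halves
    of the dependence to be nonzero. *)
Lemma rowspaces_meet (R : realFieldType) (m n d : nat) (B : 'M[R]_(m, d))
    (T : 'M[R]_(n, d)) : (d < m + n)%N ->
  B *m B^T = 1%:M -> T *m T^T = 1%:M ->
  exists (y : 'rV[R]_m) (z : 'rV[R]_n), y *m B = z *m T /\ y *m B != 0.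
Proof.
move=> dmn BB TT; pose M := col_mx B (- T).
have kM : kermx M != 0.
  rewrite -mxrank_eq0 mxrank_ker -lt0n subn_gt0.
  exact: leq_ltn_trans (rank_leq_col M) dmn.
have /rowV0Pn[w wM w0] := kM.
move: wM => /sub_kermxP; rewrite -[w]hsubmxK mul_row_col mulmxN => /eqP.
rewrite subr_eq0 => /eqP yz; exists (lsubmx w), (rsubmx w); split => //.
apply: contraNneq w0 => y0; rewrite -[w]hsubmxK.
have z0 : rsubmx w = 0 by rewrite -[LHS]mulmx1 -TT mulmxA -yz y0 mul0mx.
have -> : lsubmx w = 0 by rewrite -[LHS]mulmx1 -BB mulmxA y0 mul0mx.
by rewrite z0 row_mx0.
Qed.

Lemma orthonormal_norm (R : comPzRingType) (m d : nat) (B : 'M[R]_(m, d)) (y : 'rV[R]_m) :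
  B *m B^T = 1%:M -> (y *m B) *m (y *m B)^T = y *m y^T.
Proof. by move=> BB; rewrite trmx_mul mulmxA -[y *m B *m _]mulmxA BB mulmx1. Qed.

(** A subspace of dimension at least d - r meets the span of the top r + 1 eigenvectors, on which
    the form is at least the (r + 1)-st eigenvalue. *)
Lemma eigval_le_form (R : realType) (m d r : nat) (A : 'M[R]_d) (B : 'M[R]_(m, d)) :
  A^T = A -> (r < d)%N -> (d - r <= m)%N -> B *m B^T = 1%:M ->
  exists y : 'rV[R]_m, y *m B != 0 /\
    eigval r.+1 A * (y *m y^T) 0 0 <= (y *m (B *m A *m B^T) *m y^T) 0 0.
Proof.
move=> symA rd drm BB; have [T [l [TT TA lA]]] := eigval_top symA rd.
have dm : (d < m + r.+1)%N by lia.
have [y [z [yz y0]]] := rowspaces_meet dm BB TT.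
exists y; split => //.
rewrite -(orthonormal_norm y BB) yz (orthonormal_norm z TT).
have -> : y *m (B *m A *m B^T) *m y^T = z *m diag_mx l *m z^T.
  rewrite -TA !mulmxA -yz -!mulmxA; congr (_ *m (_ *m (_ *m _))).
  by rewrite -!trmx_mul yz.
rewrite diag_form mulmx_tr_sqr mulr_sumr; apply: ler_sum => i _.
by rewrite ler_wpM2r ?sqr_ge0.
Qed.

Lemma form_le_trace (R : realType) (n : nat) (M : 'M[R]_n) (y : 'rV[R]_n) :
  M^T = M -> (forall v : 'rV[R]_n, 0 <= (v *m M *m v^T) 0 0) ->
  (y *m M *m y^T) 0 0 <= \tr M * (y *m y^T) 0 0.
Proof.
move=> symM psd; have [Q [l [QQ MQ]]] := symmetric_spectral symM.
have QQ' : Q^T *m Q = 1%:M by apply: mulmx1C.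
have l0 i : 0 <= l 0 i.
  have := psd (delta_mx 0 i *m Q).
  rewrite {1}MQ trmx_mul !mulmxA -[_ *m Q *m Q^T]mulmxA QQ mulmx1.
  rewrite -[_ *m Q *m Q^T]mulmxA QQ mulmx1 diag_form (bigD1 i)//= big1 ?addr0.
    by rewrite !mxE !eqxx expr1n mulr1.
  by move=> j ji; rewrite !mxE (negPf ji) andbF expr0n mulr0.
have -> : \tr M = \sum_i l 0 i.
  by rewrite MQ mxtrace_mulC mulmxA QQ mul1mx mxtrace_diag.
have -> : y *m y^T = (y *m Q^T) *m (y *m Q^T)^T.
  by rewrite trmx_mul trmxK mulmxA -[_ *m _ *m Q]mulmxA QQ' mulmx1.
have -> : y *m M *m y^T = (y *m Q^T) *m diag_mx l *m (y *m Q^T)^T.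
  by rewrite MQ trmx_mul trmxK !mulmxA.
rewrite diag_form mulmx_tr_sqr mulr_suml; apply: ler_sum => i _.
rewrite ler_wpM2l // (bigD1 i)//= lerDl sumr_ge0 // => j _; exact: sqr_ge0.
Qed.

(** Together with [trace_le_eigval] this compares the (r + 1)-st eigenvalue with traces of
    compressions up to the factor d - r. Traces are linear in A, hence compatible with sums over
    increments and integrals over time. *)
Lemma eigval_le_trace (R : realType) (m d r : nat) (A : 'M[R]_d) (B : 'M[R]_(m, d)) :
  A^T = A -> (forall v : 'rV[R]_d, 0 <= (v *m A *m v^T) 0 0) ->
  (r < d)%N -> (d - r <= m)%N -> B *m B^T = 1%:M ->
  eigval r.+1 A <= \tr (B *m A *m B^T).
Proof.
move=> symA psd rd dr BB.
have [y [y0 hy]] := eigval_le_form symA rd dr BB.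
have yy : 0 < (y *m y^T) 0 0 by rewrite -(orthonormal_norm y BB) mulmx_tr_gt0.
rewrite -(ler_pM2r yy); apply: le_trans hy _; apply: form_le_trace.
  by rewrite !trmx_mul trmxK symA mulmxA.
by move=> v; have := psd (v *m B); rewrite trmx_mul !mulmxA.
Qed.

Lemma trace_le_eigval (R : realType) (d r : nat) (A : 'M[R]_d) :
  A^T = A -> (r < d)%N -> exists B : 'M[R]_(d - r, d),
  B *m B^T = 1%:M /\ \tr (B *m A *m B^T) <= (d - r)%:R * eigval r.+1 A.
Proof.
move=> symA rd; have [B [l [BB BA lA]]] := eigval_bottom symA rd.
exists B; split => //; rewrite BA mxtrace_diag.
apply: le_trans (ler_sum _ (fun i _ => lA i)) _.
by rewrite sumr_const card_ord [leRHS]mulr_natl.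
Qed.

(** Lagrange's identity: twice the defect is the sum of the squares (a_i b_j - a_j b_i)^2. *)
Lemma cauchy_schwarz_sum (R : realFieldType) (I : finType) (a b : I -> R) :
  (\sum_i a i * b i) ^+ 2 <= (\sum_i a i ^+ 2) * (\sum_i b i ^+ 2).
Proof.
have : 0 <= \sum_i \sum_j (a i * b j - a j * b i) ^+ 2.
  by apply: sumr_ge0 => i _; apply: sumr_ge0 => j _; exact: sqr_ge0.
have -> : \sum_i \sum_j (a i * b j - a j * b i) ^+ 2 =
    2 * ((\sum_i a i ^+ 2) * (\sum_i b i ^+ 2) - (\sum_i a i * b i) ^+ 2).
  under eq_bigr do under eq_bigr do rewrite sqrrB.
  under eq_bigr do rewrite big_split sumrB /=.
  rewrite big_split sumrB /= expr2 !mulr_suml.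
  have -> : \sum_i \sum_j (a j * b i) ^+ 2 = \sum_i \sum_j (a i * b j) ^+ 2.
    exact: exchange_big.
  have -> : \sum_i \sum_j (a i * b j) ^+ 2 = \sum_i a i ^+ 2 * (\sum_j b j ^+ 2).
    by apply: eq_bigr => i _; rewrite mulr_sumr; apply: eq_bigr => j _; rewrite exprMn.
  have -> : \sum_i \sum_j a i * b j * (a j * b i) *+ 2 =
      (\sum_i (a i * b i) * (\sum_j a j * b j)) *+ 2.
    rewrite -sumrMnl; apply: eq_bigr => i _; rewrite mulr_sumr -sumrMnl.
    by apply: eq_bigr => j _; congr (_ *+ 2); ring.
  by ring.
by rewrite pmulr_rge0 // subr_ge0.
Qed.

Lemma sqr_sum_le (R : realFieldType) (n : nat) (a : 'I_n -> R) :
  (\sum_i a i) ^+ 2 <= n%:R * \sum_i a i ^+ 2.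
Proof.
have := cauchy_schwarz_sum (fun=> 1) a.
under eq_bigr do rewrite mul1r.
by rewrite expr1n sumr_const card_ord.
Qed.

(** Weyl's inequality, with the operator norm bounded by d times the largest entry. Some vector in
    the span of the bottom eigenvectors of A' has A-form at least the eigenvalue of A, while its
    A'-form is at most that of A'. It serves to approximate by rational matrices. *)
Lemma eigval_lipschitz (R : realType) (d r : nat) (A A' : 'M[R]_d) (e : R) :
  A^T = A -> A'^T = A' -> (r < d)%N -> (forall i j, `|A i j - A' i j| <= e) ->
  eigval r.+1 A <= eigval r.+1 A' + d%:R * e.
Proof.
move=> symA symA' rd Ae; have [B [l [BB BA lA]]] := eigval_bottom symA' rd.
have [y [y0 hy]] := eigval_le_form symA rd (leqnn _) BB.
have yy : 0 < (y *m y^T) 0 0 by rewrite -(orthonormal_norm y BB) mulmx_tr_gt0.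
rewrite -(ler_pM2r yy); apply: le_trans hy _.
have -> : A = A' + (A - A') by rewrite addrC subrK.
rewrite mulmxDr mulmxDl mulmxDr mulmxDl mxE mulrDl; apply: lerD.
  rewrite BA diag_form mulmx_tr_sqr mulr_sumr; apply: ler_sum => i _.
  by rewrite ler_wpM2r // sqr_ge0.
rewrite -(orthonormal_norm y BB) mulmx_tr_sqr.
have -> : y *m (B *m (A - A') *m B^T) *m y^T = (y *m B) *m (A - A') *m (y *m B)^T.
  by rewrite trmx_mul !mulmxA.
set v := y *m B.
have e0 : 0 <= e.
  have i0 : 'I_d := Ordinal (leq_ltn_trans (leq0n r) rd).
  exact: le_trans (normr_ge0 _) (Ae i0 i0).
apply: le_trans (_ : e * (\sum_i `|v 0 i|) ^+ 2 <= _).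
  rewrite mxE (le_trans (ler_norm _))// (le_trans (ler_norm_sum _ _ _))//.
  rewrite expr2 mulrCA mulr_suml; apply: ler_sum => j _.
  rewrite normrM [(v^T) _ _]mxE [leRHS]mulrC ler_wpM2r// mxE.
  rewrite (le_trans (ler_norm_sum _ _ _))// mulr_sumr; apply: ler_sum => i _.
  by rewrite normrM mulrC ler_wpM2r// !mxE.
rewrite [d%:R * e]mulrC -mulrA ler_wpM2l// (le_trans (sqr_sum_le _))//.
by rewrite ler_wpM2l ?ler0n// ler_sum// => i _; rewrite real_normK ?num_real.
Qed.

(** The Gram matrix X^T X has rank at most r, so its (r + 1)-st eigenvalue is at most 0. The
    compression to the bottom eigenvectors therefore has trace at most 0, and this trace is the sum
    of the squared entries of B X^T. *)
Lemma orthonormal_complement (R : realType) (d r : nat) (X : 'M[R]_(r, d)) :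
  (r < d)%N -> exists B : 'M[R]_(d - r, d), B *m B^T = 1%:M /\ B *m X^T = 0.
Proof.
move=> rd; pose A := X^T *m X.
have symA : A^T = A by rewrite /A trmx_mul trmxK.
have [B [BB trB]] := trace_le_eigval symA rd.
exists B; split => //.
have lam0 : eigval r.+1 A <= 0.
  have [T [l [TT TA lA]]] := eigval_top symA rd.
  have kM : kermx (T *m X^T) != 0.
    rewrite -mxrank_eq0 mxrank_ker -lt0n subn_gt0.
    by rewrite ltnS rank_leq_col.
  have /rowV0Pn[w /sub_kermxP wM w0] := kM.
  rewrite -(pmulr_lle0 _ (mulmx_tr_gt0 w0)).
  suff <- : (w *m diag_mx l *m w^T) 0 0 = 0.
    rewrite diag_form mulmx_tr_sqr mulr_sumr; apply: ler_sum => i _.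
    by rewrite ler_wpM2r // sqr_ge0.
  by rewrite -TA /A !mulmxA -[w *m T *m _]mulmxA wM !mul0mx mxE.
have tr0 : \tr (B *m A *m B^T) <= 0.
  by apply: (le_trans trB); apply: mulr_ge0_le0; rewrite ?ler0n.
move: tr0; set Y := B *m X^T.
have -> : B *m A *m B^T = Y *m Y^T by rewrite /Y /A trmx_mul trmxK !mulmxA.
have -> : \tr (Y *m Y^T) = \sum_i \sum_j Y i j ^+ 2.
  apply: eq_bigr => i _; rewrite [LHS]mxE; apply: eq_bigr => j _; by rewrite [_^T _ _]mxE expr2.
move=> Y0; apply/matrixP => i j; rewrite [RHS]mxE.
have : Y i j ^+ 2 <= 0.
  apply: le_trans Y0; rewrite (bigD1 i)//= (bigD1 j)//= -addrA lerDl.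
  apply: addr_ge0; first by apply: sumr_ge0 => k _; exact: sqr_ge0.
  by apply: sumr_ge0 => k _; apply: sumr_ge0 => l _; exact: sqr_ge0.
by rewrite le_eqVlt ltNge sqr_ge0 orbF sqrf_eq0 => /eqP.
Qed.

(* Quantitative linear independence: dividing a nonzero combination by its largest
   coefficient shows that it only has to be tested on such c. *)
Definition sep (R : realType) (d p : nat) (eta : R) (x : 'I_p -> 'cV[R]_d) : Prop :=
  forall (c : 'I_p -> R) (i : 'I_p), c i = 1 -> (forall j, `|c j| <= 1) ->
  eta ^+ 2 <= \sum_a ((\sum_j c j *: x j) a 0) ^+ 2.

(** Projected to the orthogonal complement of the row space of B, which has dimension r, the r + 1
    vectors become dependent. The dependence, divided by its largest coefficient, is a combination
    admissible in [sep] that lies in the row space of B, so that B preserves its norm.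
    Cauchy-Schwarz with coefficients at most 1 gives the factor r + 1. *)
Lemma sep_compress (R : realType) (d r : nat) (eta : R) (x : 'I_r.+1 -> 'cV[R]_d)
    (B : 'M[R]_(d - r, d)) :
  (r < d)%N -> sep eta x -> B *m B^T = 1%:M ->
  eta ^+ 2 <= r.+1%:R * \sum_j \sum_i ((B *m x j) i 0) ^+ 2.
Proof.
move=> rd sx BB.
pose X : 'M[R]_(r.+1, d) := \matrix_(i, a) x i a 0.
pose M := X *m (1%:M - B^T *m B).
have kM : kermx M != 0.
  rewrite -mxrank_eq0 mxrank_ker -lt0n subn_gt0 ltnS.
  apply: leq_trans (mxrankM_maxr _ _) _.
  have BM : (B <= kermx (1%:M - B^T *m B))%MS.
    by apply/sub_kermxP; rewrite mulmxBr mulmx1 mulmxA BB mul1mx subrr.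
  have rB : \rank B = (d - r)%N.
    apply/eqP; rewrite eqn_leq rank_leq_row /= -[X in (X <= _)%N](mxrank1 R) -BB.
    exact: mxrankM_maxl.
  have := mxrankS BM; rewrite rB mxrank_ker; have := rank_leq_row (1%:M - B^T *m B).
  by set k := \rank _; lia.
have /rowV0Pn[w /sub_kermxP wM w0] := kM.
have [i0 wi0] : exists i0, forall j, `|w 0 j| <= `|w 0 i0|.
  by exists [arg max_(i > ord0) `|w 0 i|]%O;
    case: Order.TotalTheory.arg_maxP => // i _ hi j; apply: hi.
have wi00 : w 0 i0 != 0.
  apply: contraNneq w0 => h; apply/eqP/rowP => j; rewrite mxE.
  by apply/eqP; rewrite -normr_le0 (le_trans (wi0 j))// h normr0.
pose c j := w 0 j / w 0 i0.
have c1 j : `|c j| <= 1.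
  by rewrite /c normrM normfV ler_pdivrMr ?normr_gt0// mul1r.
have /le_trans := sx c i0 (divff wi00) c1; apply.
pose z : 'rV[R]_d := (\row_j c j) *m X.
have zE a : (\sum_j c j *: x j) a 0 = z 0 a.
  by rewrite summxE !mxE; apply: eq_bigr => j _; rewrite !mxE.
have zM : z *m (1%:M - B^T *m B) = 0.
  rewrite /z; have -> : \row_j c j = (w 0 i0)^-1 *: w by apply/rowP => j; rewrite !mxE mulrC.
  by rewrite -mulmxA -scalemxAl wM scaler0.
have zB : z = z *m B^T *m B.
  by apply/eqP; rewrite -mulmxA -subr_eq0 -{1}[z]mulmx1 -mulmxBr zM.
under eq_bigr do rewrite zE.
rewrite -mulmx_tr_sqr zB orthonormal_norm // mulmx_tr_sqr exchange_big mulr_sumr.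
apply: ler_sum => i _ /=.
have -> : (z *m B^T) 0 i = \sum_j c j * (B *m x j) i 0.
  rewrite /z -mulmxA mxE; apply: eq_bigr => j _; rewrite !mxE; congr (_ * _).
  by apply: eq_bigr => k _; rewrite !mxE mulrC.
apply: le_trans (cauchy_schwarz_sum _ _) _; rewrite ler_wpM2r ?sumr_ge0//.
  by move=> j _; exact: sqr_ge0.
rewrite -[leRHS](_ : \sum_(j < r.+1) 1 = _); last by rewrite sumr_const card_ord.
apply: ler_sum => j _; rewrite -real_normK ?num_real// -[leRHS](expr1n _ 2).
by rewrite lerXn2r ?nnegrE.
Qed.

(** A combination with coefficients at most 1 moves by at most eta / 2 in norm, by Cauchy-Schwarz;
    then |u|^2 <= 2 |v|^2 + 2 |v - u|^2 leaves eta^2 / 4 for |v|^2. *)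
Lemma sep_perturb (R : realType) (d p : nat) (eta : R) (x y : 'I_p -> 'cV[R]_d) :
  sep eta x -> 4 * p%:R * (\sum_j \sum_a ((y j - x j) a 0) ^+ 2) <= eta ^+ 2 ->
  sep (eta / 2) y.
Proof.
move=> sx small c i ci c1; have := sx c i ci c1.
set S := \sum_j _ in small => hx.
have hd : \sum_a ((\sum_j c j *: (y j - x j)) a 0) ^+ 2 <= p%:R * S.
  rewrite /S exchange_big mulr_sumr; apply: ler_sum => a _.
  rewrite summxE [X in X ^+ 2](_ : _ = \sum_j c j * (y j - x j) a 0); last first.
    by apply: eq_bigr => j _; rewrite mxE.
  apply: le_trans (cauchy_schwarz_sum _ _) _; rewrite ler_wpM2r ?sumr_ge0//.
    by move=> j _; exact: sqr_ge0.
  rewrite -[leRHS](_ : \sum_(j < p) 1 = _); last by rewrite sumr_const card_ord.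
  apply: ler_sum => j _; rewrite -real_normK ?num_real// -[leRHS](expr1n _ 2).
  by rewrite lerXn2r ?nnegrE.
have hs : \sum_a ((\sum_j c j *: x j) a 0) ^+ 2 <=
    2 * (\sum_a ((\sum_j c j *: y j) a 0) ^+ 2) +
    2 * (\sum_a ((\sum_j c j *: (y j - x j)) a 0) ^+ 2).
  rewrite -mulrDr -big_split mulr_sumr; apply: ler_sum => a _ /=.
  set u := (\sum_j c j *: x j) a 0; set v := (\sum_j c j *: y j) a 0.
  have -> : (\sum_j c j *: (y j - x j)) a 0 = v - u.
    by rewrite /u /v !summxE -sumrB; apply: eq_bigr => j _; rewrite !mxE mulrBr.
  rewrite -subr_ge0 (_ : _ - _ = (u - 2 * v) ^+ 2) ?sqr_ge0//; ring.
by rewrite expr_div_n; lra.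
Qed.

(** * Measurability of the eigenvalues and lower bounds for Sigma_hat *)

Lemma measurable_fun_gt (R : realType) disp (T : measurableType disp)
    (f : T -> R) : (forall a, measurable [set w | a < f w]) -> measurable_fun setT f.
Proof.
move=> h; apply: (measurability _ (@RGenOInfty.measurableE R)) => _ [_ [a ->] <-].
rewrite setTI; have -> : f @^-1` `]a, +oo[ = [set w | a < f w]; last exact: h.
by apply/seteqP; split => w /=; rewrite in_itv/= andbT.
Qed.

Lemma measurable_lt_set (R : realType) disp (T : measurableType disp)
    (f g : T -> R) : measurable_fun setT f -> measurable_fun setT g ->
  measurable [set w | f w < g w].
Proof.
move=> mf mg; have := measurable_fun_ltr mf mg.
by move=> /(_ measurableT [set true] I); rewrite setTI; congr measurable.
Qed.

Lemma measurable_le_set (R : realType) disp (T : measurableType disp)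
    (f g : T -> R) : measurable_fun setT f -> measurable_fun setT g ->
  measurable [set w | f w <= g w].
Proof.
move=> mf mg; have := measurable_fun_ler mf mg.
by move=> /(_ measurableT [set true] I); rewrite setTI; congr measurable.
Qed.

Lemma measurable_forall (disp : measure_display) (T : measurableType disp) (I : finType)
    (F : I -> set T) : (forall i, measurable (F i)) -> measurable [set w | forall i, F i w].
Proof.
move=> mF; have -> : [set w | forall i, F i w] = ~` \bigcup_i ~` F i.
  apply/seteqP; split => [w Fw [i _ /(_ (Fw i))//]|w nF i].
  by apply: contrapT => nFi; apply: nF; exists i.
apply: measurableC; apply: countable_bigcupT_measurable; first exact: countableP.
by move=> i; apply: measurableC.
Qed.

Lemma rat_between (R : realType) (x y : R) : x < y -> exists q : rat, x < ratr q < y.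
Proof. by move=> xy; have [q] := rat_in_itvoo xy; rewrite in_itv/= => qxy; exists q. Qed.

(** By the Lipschitz bound the superlevel set is a countable union, over rational matrices and
    rational radii, of boxes on which the eigenvalue is certified to exceed a. The rational matrix
    is symmetrised, as the Lipschitz bound is for symmetric matrices; this keeps the entrywise
    distance to the symmetric [M w]. *)
Lemma measurable_eigval (R : realType) disp (T : measurableType disp)
    (d r : nat) (M : T -> 'M[R]_d) :
  (forall i j, measurable_fun setT (fun w => M w i j)) ->
  (forall w, (M w)^T = M w) -> (r < d)%N ->
  measurable_fun setT (fun w => eigval r.+1 (M w)).
Proof.
move=> mM symM rd; apply: measurable_fun_gt => a.
pose S (B : 'M[rat]_d) : 'M[R]_d := 2^-1 *: (map_mx ratr B + (map_mx ratr B)^T).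
have symS B : (S B)^T = S B by rewrite /S linearZ linearD /= trmxK addrC.
have SM w (B : 'M[rat]_d) (e : R) : (forall i j, `|M w i j - ratr (B i j)| <= e) ->
    forall i j, `|M w i j - S B i j| <= e.
  move=> h i j; have hij := h i j; have := h j i.
  rewrite -[in M w j i](symM w) mxE !mxE => hji.
  have -> : M w i j - 2^-1 * (ratr (B i j) + ratr (B j i)) =
    2^-1 * (M w i j - ratr (B i j)) + 2^-1 * (M w i j - ratr (B j i)) by field.
  rewrite (le_trans (ler_normD _ _))// !normrM [`|2^-1|]ger0_norm//; lra.
pose F (k : 'M[rat]_d * rat) : set T := [set w |
  a + d%:R * ratr k.2 < eigval r.+1 (S k.1) /\
  forall ij : 'I_d * 'I_d, `|M w ij.1 ij.2 - ratr (k.1 ij.1 ij.2)| < ratr k.2].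
have -> : [set w | a < eigval r.+1 (M w)] = \bigcup_k F k.
  apply/seteqP; split => [w /= aw|w [[B q] _ /= [aS h]]]; last first.
    have := eigval_lipschitz (symS B) (symM w) rd (e := ratr q) _.
    move=> /(_ (fun i j => _)) => H.
    have /H : forall i j, `|S B i j - M w i j| <= ratr q.
      move=> i j; rewrite distrC; apply: SM => i' j'; exact: ltW (h (i', j')).
    by lra.
  have d0 : 0 < d%:R :> R by rewrite ltr0n (leq_ltn_trans _ rd).
  have [q /andP[q0 qa]] := @rat_between R 0 ((eigval r.+1 (M w) - a) / (2 * d%:R))
    ltac:(by rewrite divr_gt0 ?subr_gt0 ?mulr_gt0).
  have hB ij : exists b : rat, `|M w ij.1 ij.2 - ratr b| < ratr q.
    have [b /andP[b1 b2]] := @rat_between R (M w ij.1 ij.2) (M w ij.1 ij.2 + ratr q)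
      ltac:(by rewrite ltrDl).
    by exists b; rewrite ltr_norml; apply/andP; split; lra.
  have [b hb] := choice hB.
  exists (\matrix_(i, j) b (i, j), q) => //; split => [|[i j]] /=; last first.
    by rewrite mxE; exact: (hb (i, j)).
  have := eigval_lipschitz (symM w) (symS (\matrix_(i, j) b (i, j))) rd (e := ratr q) _.
  move=> H; have /H : forall i j, `|M w i j - S (\matrix_(i, j) b (i, j)) i j| <= ratr q.
    by apply: SM => i j; rewrite mxE; exact: ltW (hb (i, j)).
  move: qa; rewrite ltr_pdivlMr ?mulr_gt0// => qa.
  have : ratr q * (2 * d%:R) = 2 * (d%:R * ratr q) :> R by ring.
  by lra.
apply: countable_bigcupT_measurable => [|k]; first exact: countableP.
have [ak|nak] := boolP (a + d%:R * ratr k.2 < eigval r.+1 (S k.1)); last first.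
  rewrite [X in measurable X](_ : _ = set0)//.
  by apply/seteqP; split => // w [/= h]; rewrite h in nak.
rewrite [X in measurable X](_ : _ = [set w | forall ij : 'I_d * 'I_d,
    `|M w ij.1 ij.2 - ratr (k.1 ij.1 ij.2)| < ratr k.2]); last first.
  by apply/seteqP; split => w /=; [case|split].
apply: (@measurable_forall _ _ _
  (fun ij w => `|M w ij.1 ij.2 - ratr (k.1 ij.1 ij.2)| < ratr k.2)) => ij.
apply: measurable_lt_set => //; apply: measurableT_comp => //.
exact: measurable_funB.
Qed.

(** (x - m)^2 + (y - m)^2 >= (x - y)^2 / 2 for every centre m. Pairs start at index 1, like the
    increments of a block. *)
Lemma pairs_le_centered (R : realFieldType) (a : nat -> R) (m : R) (P N : nat) :
  (2 * P <= N)%N ->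
  2^-1 * (\sum_(l < P) (a (2 * l + 2)%N - a (2 * l + 1)%N) ^+ 2) <=
  \sum_(1 <= i < N.+1) (a i - m) ^+ 2.
Proof.
move=> PN; apply: le_trans (_ : \sum_(1 <= i < (2 * P).+1) (a i - m) ^+ 2 <= _); last first.
  rewrite [leRHS](@big_cat_nat _ _ _ (2 * P).+1)//= lerDl.
  by apply: sumr_ge0 => i _; exact: sqr_ge0.
elim: P {PN} => [|P IH]; first by rewrite big_ord0 mulr0 sumr_ge0// => i _; exact: sqr_ge0.
have -> : (2 * P.+1).+1 = (2 * P).+3 by lia.
rewrite big_ord_recr mulrDr 2?big_nat_recr//= -addrA; apply: lerD => //.
rewrite addn2 addn1; set x := a _; set y := a _.
rewrite -subr_ge0 (_ : _ - _ = 2^-1 * (x + y - 2 * m) ^+ 2); last by field.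
by rewrite mulr_ge0 ?sqr_ge0// invr_ge0.
Qed.

Lemma sum_blocks (R : nmodType) (f : nat -> R) (M p : nat) :
  \sum_(l < M * p) f l = \sum_(g < M) \sum_(j < p) f (g * p + j)%N.
Proof.
elim: M => [|M IH]; first by rewrite !big_ord0.
rewrite big_ord_recr /= -IH mulSn addnC.
rewrite -(big_mkord xpredT) (@big_cat_nat _ _ _ (M * p))//= ?leq_addr// big_mkord.
by congr (_ + _); rewrite -{1}[(M * p)%N]add0n big_addn addKn big_mkord;
  apply: eq_bigr => i _; rewrite addnC.
Qed.

Lemma Sigma_hat_sym (R : realType) (d n : nat) (h : R) (x : R -> 'cV[R]_d) (k : nat) :
  (Sigma_hat n h x k)^T = Sigma_hat n h x k.
Proof.
rewrite /Sigma_hat linearZ raddf_sum /=; congr (_ *: _); apply: eq_bigr => i _.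
by rewrite /outer trmx_mul trmxK.
Qed.

(** The vector c is the image of the block mean under B. Its value is left unspecified since
    [pairs_le_centered] holds for any centre. *)
Lemma trace_Sigma_hat (R : realType) (m d n : nat) (h : R) (x : R -> 'cV[R]_d)
    (k : nat) (B : 'M[R]_(m, d)) : exists c : 'cV[R]_m,
  \tr (B *m Sigma_hat n h x k *m B^T) =
  h^-1 * \sum_i \sum_(1 <= j < (Num.truncn (n%:R * h)).+1)
    ((B *m increment n h x k j) i 0 - c i 0) ^+ 2.
Proof.
rewrite /Sigma_hat; set mu := _ *: \sum_(_ <= _ < _) increment _ _ _ _ _.
exists (B *m mu).
rewrite -scalemxAr -scalemxAl mxtraceZ mulmx_sumr mulmx_suml raddf_sum /=.
rewrite exchange_big; congr (_ * _); apply: eq_bigr => j _.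
apply: eq_bigr => i _; rewrite /outer; set v := _ - _.
have -> : B *m (v *m v^T) *m B^T = (B *m v) *m (B *m v)^T by rewrite trmx_mul !mulmxA.
rewrite mxE big_ord1 [X in _ * X]mxE -expr2 /v mulmxBr; congr (_ ^+ 2).
by rewrite [LHS]mxE [X in _ + X]mxE.
Qed.

Lemma mulmx_sub_entry (R : pzRingType) (m d : nat) (B : 'M[R]_(m, d)) (u v : 'cV[R]_d) i :
  (B *m (u - v)) i 0 = (B *m u) i 0 - (B *m v) i 0.
Proof. by rewrite mulmxBr !mxE. Qed.

(** The trace of the compression of [Sigma_hat] to its bottom eigenvectors is a sum over pairs of
    increments. Each good group contributes at least eta^2 / (r + 1) to it by [sep_compress]; the
    other groups contribute nonnegative terms. *)
Lemma eigval_Sigma_hat_ge (R : realType) (d r n : nat) (h eta : R) (x : R -> 'cV[R]_d)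
    (k M : nat) (good : nat -> bool) :
  (r < d)%N -> 0 < h -> (2 * (M * r.+1) <= Num.truncn (n%:R * h))%N ->
  (forall g, (g < M)%N -> good g -> sep eta (fun j : 'I_r.+1 =>
     increment n h x k (2 * (g * r.+1 + j) + 2) - increment n h x k (2 * (g * r.+1 + j) + 1))) ->
  (2 * h)^-1 * eta ^+ 2 * \sum_(g < M) (good g)%:R <=
  r.+1%:R * (d - r)%:R * eigval r.+1 (Sigma_hat n h x k).
Proof.
move=> rd h0 MN hgood.
have [B [BB trB]] := trace_le_eigval (Sigma_hat_sym n h x k) rd.
rewrite -[leRHS]mulrA; apply: (le_trans _ (ler_wpM2l (ler0n _ _) trB)).
have [c ->] := trace_Sigma_hat n h x k B.
set Z := increment n h x k.
apply: le_trans (_ : r.+1%:R * (h^-1 * \sum_i 2^-1 * \sum_(l < M * r.+1)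
    ((B *m Z (2 * l + 2)%N) i 0 - (B *m Z (2 * l + 1)%N) i 0) ^+ 2) <= _); last first.
  rewrite ler_wpM2l ?ler0n// ler_wpM2l ?invr_ge0 ?(ltW h0)//; apply: ler_sum => i _.
  exact: (pairs_le_centered (fun j => (B *m Z j) i 0)).
have -> : \sum_i 2^-1 * (\sum_(l < M * r.+1)
    ((B *m Z (2 * l + 2)%N) i 0 - (B *m Z (2 * l + 1)%N) i 0) ^+ 2) =
    2^-1 * \sum_(g < M) \sum_(j < r.+1) \sum_i
      ((B *m (Z (2 * (g * r.+1 + j) + 2)%N - Z (2 * (g * r.+1 + j) + 1)%N)) i 0) ^+ 2.
  rewrite -mulr_sumr exchange_big /=; congr (_ * _).
  rewrite (sum_blocks (fun l => \sum_i
    ((B *m Z (2 * l + 2)%N) i 0 - (B *m Z (2 * l + 1)%N) i 0) ^+ 2)).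
  apply: eq_bigr => g _; apply: eq_bigr => j _; apply: eq_bigr => i _.
  by rewrite [in RHS]mulmx_sub_entry.
set S := (X in h^-1 * (2^-1 * X)).
rewrite (_ : r.+1%:R * (h^-1 * (2^-1 * S)) = (2 * h)^-1 * (r.+1%:R * S)); last first.
  by rewrite invfM; ring.
rewrite -mulrA ler_wpM2l ?invr_ge0 ?mulr_ge0 ?(ltW h0)// /S !mulr_sumr.
apply: ler_sum => g _.
have [gg|ng] := boolP (good g); last
  by rewrite mulr0 mulr_ge0 ?ler0n// !sumr_ge0// => j _; rewrite sumr_ge0// => i _; exact: sqr_ge0.
by rewrite mulr1; apply: (sep_compress rd (hgood g (ltn_ord g) gg) BB).
Qed.

(** * Independence and Gaussian small ball estimates *)

(** The events independent of E form a Dynkin system, so the pi-system G suffices. *)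
Lemma indep_sigma_algebra (R : realType) (disp : measure_display)
    (T : measurableType disp) (P : probability T R) (G : set (set T)) (E : set T) :
  measurable E -> G `<=` measurable -> setI_closed G ->
  (forall A, G A -> P (E `&` A) = (P E * P A)%E) ->
  forall A, <<s G >> A -> P (E `&` A) = (P E * P A)%E.
Proof.
move=> mE Gm GI Gind A sA.
have sGm B : <<s G >> B -> measurable B.
  by apply: smallest_sub => //; exact: sigma_algebra_measurable.
have PEf : P E \is a fin_num by exact: fin_num_measure.
apply: (@dynkin_induction _ (g_sigma_algebraType G) G
  (fun B => P (E `&` B) = (P E * P B)%E)) sA => //.
- by rewrite setIT probability_setT mule1.
- move=> B /sGm mB h'; have h : P (E `&` B) = (P E * P B)%E := h'.
  have -> : E `&` ~` B = E `\` (E `&` B) by rewrite setDE setCI setIUr setICr set0U.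
  have -> : P (E `\` (E `&` B)) = (P E - P (E `&` (E `&` B)))%E.
    by apply: measureD; [|exact: measurableI|rewrite ltey_eq PEf].
  rewrite setIA setIid h probability_setC//.
  have PBf : P B \is a fin_num by exact: fin_num_measure.
  by rewrite muleBr ?mule1// fin_num_adde_defr.
- move=> F mF tF h'; have h n : P (E `&` F n) = (P E * P (F n))%E := h' n.
  have mF' n : @measurable _ T (F n) by exact: (sGm _ (mF n)).
  rewrite setI_bigcupr.
  have -> : P (\bigcup_i (E `&` F i)) = (\sum_(0 <= i <oo) P (E `&` F i))%E.
    rewrite (measure_bigcup P setT)//; last 2 first.
      by move=> n _; exact: measurableI.
      by apply/trivIsetP => i j _ _ ij; rewrite setIACA setIid (trivIsetP.1 tF)// setI0.
    by apply: eq_eseriesl => i; rewrite in_setT.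
  have -> : P (\bigcup_i (F i)) = (\sum_(0 <= i <oo) P (F i))%E.
    rewrite (measure_bigcup P setT)//.
    by apply: eq_eseriesl => i; rewrite in_setT.
  under eq_eseriesr do rewrite h.
  by rewrite -(fineK PEf) nneseriesZl.
Qed.

(** The joint law agrees with the product of the law of X and mu on rectangles, hence everywhere,
    and Tonelli applies. *)
Lemma integral_indep_pair (R : realType) (disp : measure_display)
    (T : measurableType disp) (P : probability T R) (mu : probability (measurableTypeR R) R)
    (X Y : T -> measurableTypeR R) (f : measurableTypeR R * measurableTypeR R -> \bar R) :
  measurable_fun setT X -> measurable_fun setT Y ->
  (forall A B, measurable A -> measurable B ->
    P (X @^-1` A `&` Y @^-1` B) = (P (X @^-1` A) * mu B)%E) ->
  measurable_fun setT f -> (forall z, 0 <= f z)%E ->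
  (\int[P]_w f (X w, Y w) = \int[P]_w \int[mu]_y f (X w, y))%E.
Proof.
move=> mX mY indep mf f0.
pose XY w := (X w, Y w).
have mXY : measurable_fun setT XY by exact: measurable_fun_pair.
pose X' : {mfun T >-> measurableTypeR R} := mfun_Sub (mem_set mX).
pose XY' : {mfun T >-> (measurableTypeR R * measurableTypeR R)%type} := mfun_Sub (mem_set mXY).
have -> : (\int[P]_w f (X w, Y w) = \int[distribution P XY']_z f z)%E.
  by rewrite ge0_integral_distribution.
have mF : measurable_fun setT (fubini_F mu f) by exact: measurable_fun_fubini_tonelli_F.
have -> : (\int[P]_w \int[mu]_y f (X w, y) = \int[distribution P X']_x fubini_F mu f x)%E.
  by rewrite ge0_integral_distribution// => x; apply: integral_ge0.
rewrite -fubini_tonelli1//; apply: eq_measure_integral => A mA _.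
apply/esym; apply: product_measure_unique => // B C mB mC.
Qed.

Lemma integral_normal_prob (R : realType) (m s : R) (f : R -> \bar R) :
  measurable_fun setT f -> (\int[normal_prob m s]_x `|f x| < +oo)%E ->
  (\int[normal_prob m s]_x f x =
   \int[@lebesgue_measure R]_x (f x * (normal_pdf m s x)%:E))%E.
Proof.
move=> mf finf.
rewrite -(Radon_Nikodym_change_of_variables (normal_prob_dominates m s))//=; last first.
  by apply/integrableP; split.
apply: ae_eq_integral => //.
- apply: emeasurable_funM => //; apply: (measurable_int lebesgue_measure).
  by apply: Radon_Nikodym_integrable; exact: normal_prob_dominates.
- by apply: emeasurable_funM => //; apply/measurable_EFinP; exact: measurable_normal_pdf.
- apply: ae_eqe_mul2l => /=.
  rewrite Radon_NikodymE//=; first exact: normal_prob_dominates.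
  move=> dom; case: cid => /= h [h1 h2 h3].
  apply: integral_ae_eq => //=.
  + by apply/measurable_EFinP; exact: measurable_normal_pdf.
  + by move=> E _ mE; rewrite -h3.
Qed.

(** Left unnormalised, so that its values lie between 0 and 1 and its expectation bounds
    probabilities on both sides. *)
Definition gauss_kernel (R : realType) (tau x : R) : R := expR (- x ^+ 2 / (2 * tau)).

Lemma measurable_gauss_kernel (R : realType) (tau : R) :
  measurable_fun setT (gauss_kernel tau).
Proof.
apply: measurableT_comp => //; apply: measurable_funM => //.
by apply: measurableT_comp => //; apply: measurable_funX.
Qed.

Lemma gauss_kernel_ge0 (R : realType) (tau x : R) : 0 <= gauss_kernel tau x.
Proof. exact: expR_ge0. Qed.

Lemma gauss_kernel_le1 (R : realType) (tau x : R) : 0 < tau -> gauss_kernel tau x <= 1.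
Proof.
move=> t0; rewrite /gauss_kernel -[leRHS]expR0 ler_expR mulNr oppr_le0.
by rewrite divr_ge0 ?sqr_ge0// mulr_ge0// ltW.
Qed.

(** The exponent of the kernel times the density of N(0, s^2), as a function of y, is that of a
    normal density of variance s^2 tau / t plus a term in a alone. The difference of the two sides
    contains the factor t - (tau + c^2 s^2). *)
Lemma complete_square (F : numFieldType) (tau s a c y t : F) :
  tau != 0 -> s != 0 -> t != 0 -> t = tau + c ^+ 2 * s ^+ 2 ->
  - (a + c * y) ^+ 2 / (2 * tau) + - y ^+ 2 / (s ^+ 2 * 2) =
  - a ^+ 2 / (2 * t) + - (y - - (a * c * s ^+ 2 / t)) ^+ 2 / (s ^+ 2 * (tau / t) * 2).
Proof.
move=> tau0 s0 t0 tE; apply/eqP; rewrite -subr_eq0; apply/eqP.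
transitivity ((t - (tau + c ^+ 2 * s ^+ 2)) * (t * y ^+ 2 - a ^+ 2 * s ^+ 2)
              / (2 * tau * t * s ^+ 2)).
  by field; rewrite tau0 s0 t0.
by rewrite {1}tE subrr !mul0r.
Qed.

(** Variances add under convolution: integrating out an N(0, s^2) variable turns tau into tau + c^2
    s^2. After completing the square the integrand is a constant multiple of a normal density. *)
Lemma integral_gauss_kernel (R : realType) (tau s a c : R) : 0 < tau -> 0 < s ->
  (\int[normal_prob 0%R s]_y (gauss_kernel tau (a + c * y))%:E =
   (Num.sqrt (tau / (tau + c ^+ 2 * s ^+ 2)) *
    gauss_kernel (tau + c ^+ 2 * s ^+ 2) a)%:E)%E.
Proof.
move=> t0 s0.
have mf : measurable_fun setT (fun y => (gauss_kernel tau (a + c * y))%:E).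
  apply/measurable_EFinP; apply: (measurableT_comp (measurable_gauss_kernel tau)).
  by apply: measurable_funD => //; apply: measurable_funM.
rewrite integral_normal_prob//; last first.
  under eq_integral do rewrite gee0_abs ?lee_fin ?gauss_kernel_ge0//.
  apply: (@le_lt_trans _ _ (\int[normal_prob 0%R s]_y (cst 1%E) y)%E).
    apply: ge0_le_integral => //.
    by move=> x _; rewrite lee_fin gauss_kernel_ge0.
    by move=> x _; rewrite lee_fin gauss_kernel_le1.
  by rewrite integral_cst//= mul1e probability_setT ltry.
set t' := tau + _.
have t'0 : 0 < t' by rewrite /t' ltr_wpDr// mulr_ge0 ?sqr_ge0.
pose s' := s * Num.sqrt (tau / t').
have s'0 : 0 < s' by rewrite mulr_gt0// sqrtr_gt0 divr_gt0.
pose m' := - (a * c * s ^+ 2 / t').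
have s'2 : s' ^+ 2 = s ^+ 2 * (tau / t') by rewrite exprMn sqr_sqrtr// divr_ge0 ?ltW.
have key y : gauss_kernel tau (a + c * y) * normal_pdf 0 s y =
    (Num.sqrt (tau / t') * gauss_kernel t' a) * normal_pdf m' s' y.
  rewrite !normal_pdfE ?gt_eqF// /normal_peak /normal_fun /gauss_kernel.
  rewrite mulrCA [RHS]mulrACA -!expRD.
  congr (_ * expR _).
    rewrite (_ : s' ^+ 2 * pi *+ 2 = (s ^+ 2 * pi *+ 2) * (tau / t')); last first.
      by rewrite s'2 mulrAC mulrnAl.
    have X0 : 0 <= s ^+ 2 * pi *+ 2 by rewrite mulrn_wge0// mulr_ge0 ?pi_ge0// sqr_ge0.
    rewrite [Num.sqrt (_ * (tau / t'))]sqrtrM//.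
    have q0 : Num.sqrt (tau / t') != 0 by rewrite gt_eqF// sqrtr_gt0 divr_gt0.
    by rewrite invfM mulrCA (mulfV q0) mulr1.
  rewrite -[s ^+ 2 *+ 2]mulr_natr -[s' ^+ 2 *+ 2]mulr_natr s'2 /m' subr0.
  exact: (@complete_square R tau s a c y t' (lt0r_neq0 t0) (lt0r_neq0 s0) (lt0r_neq0 t'0) erefl).
under eq_integral do rewrite -EFinM key EFinM.
rewrite integralZl//=; last exact: integrable_normal_pdf.
by rewrite integral_normal_pdf mule1.
Qed.

Definition cylinder (R : realType) (T : Type) (I : finType) (D : I -> T -> R) (J : pred I)
  (B : I -> set R) : set T := [set w | forall i, J i -> B i (D i w)].

(** A pi-system generating the sigma-algebra of the coordinates [D i] with [J i]. *)
Definition cylinders (R : realType) (T : Type) (I : finType) (D : I -> T -> R) (J : pred I) :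
  set (set T) :=
  [set A | exists2 B : I -> set R, (forall i, measurable (B i)) & A = cylinder D J B].

Lemma cylinders_setI (R : realType) (T : Type) (I : finType) (D : I -> T -> R) (J : pred I) :
  setI_closed (cylinders D J).
Proof.
move=> _ _ [B mB ->] [C mC ->]; exists (fun i => B i `&` C i).
  by move=> i; exact: measurableI.
apply/seteqP; split => w; first by move=> [h1 h2] i Ji; split; [exact: h1|exact: h2].
by move=> h; split => i /h [].
Qed.

Lemma measurable_cylinder (R : realType) disp (T : measurableType disp)
    (I : finType) (D : I -> T -> R) (J : pred I) (B : I -> set R) :
  (forall i, measurable_fun setT (D i)) -> (forall i, measurable (B i)) ->
  measurable (cylinder D J B).
Proof.
move=> mD mB; apply: (@measurable_forall _ _ _ (fun i w => J i -> B i (D i w))) => i.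
have [Ji|nJi] := boolP (J i); last first.
  by rewrite [X in measurable X](_ : _ = setT)//;
    apply/seteqP; split => // w _ /=; rewrite (negPf nJi).
rewrite [X in measurable X](_ : _ = setT `&` D i @^-1` B i); first exact: mD.
by apply/seteqP; split => w /=; [move=> /(_ isT)|case].
Qed.

Lemma cylinders_measurable (R : realType) disp (T : measurableType disp)
    (I : finType) (D : I -> T -> R) (J : pred I) :
  (forall i, measurable_fun setT (D i)) -> cylinders D J `<=` measurable.
Proof. by move=> mD _ [B mB ->]; exact: measurable_cylinder. Qed.

Lemma indep_cylinders (R : realType) disp (T : measurableType disp)
    (P : probability T R) (I : finType) (D : I -> T -> R) (J : pred I) (E : set T) :
  measurable E -> (forall i, measurable_fun setT (D i)) ->
  (forall B : I -> set R, (forall i, measurable (B i)) ->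
     P (E `&` cylinder D J B) = (P E * P (cylinder D J B))%E) ->
  forall A, <<s cylinders D J >> A -> P (E `&` A) = (P E * P A)%E.
Proof.
move=> mE mD h; apply: indep_sigma_algebra => //.
- exact: cylinders_measurable.
- exact: cylinders_setI.
- by move=> _ [B mB ->]; exact: h.
Qed.

Lemma measurable_coordinate (R : realType) (T : pointedType) (I : finType) (D : I -> T -> R)
    (J : pred I) (i : I) : J i ->
  measurable_fun setT (D i : g_sigma_algebraType (cylinders D J) -> R).
Proof.
move=> Ji _ B mB; rewrite setTI; apply: sub_sigma_algebra.
exists (fun j => if j == i then B else setT); first by move=> j; case: ifP.
apply/seteqP; split => w /=; last by move=> /(_ i Ji); rewrite eqxx.
by move=> Bw j _; case: ifP => // /eqP ->.
Qed.

Lemma measurable_combination (R : realType) disp (T : measurableType disp)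
    (I : Type) (s : seq I) (J : pred I) (c : I -> R) (D : I -> T -> R) :
  (forall i, J i -> measurable_fun setT (D i)) ->
  measurable_fun setT (fun w => \sum_(i <- s | J i) c i * D i w).
Proof.
move=> mD; elim: s => [|i s IH].
  by rewrite (_ : (fun w => _) = cst 0)//; apply/funext => w; rewrite big_nil.
have [Ji|nJi] := boolP (J i); last first.
  rewrite (_ : (fun w => _) = (fun w => \sum_(i <- s | J i) c i * D i w))//.
  by apply/funext => w; rewrite big_cons (negPf nJi).
rewrite (_ : (fun w => _) = (fun w => c i * D i w + \sum_(i <- s | J i) c i * D i w)).
  by apply: measurable_funD => //; apply: measurable_funM => //; exact: mD.
by apply/funext => w; rewrite big_cons Ji.
Qed.

Definition gaussian_family (R : realType) disp (T : measurableType disp)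
    (P : probability T R) (I : finType) (D : I -> T -> R) (sd : I -> R) : Prop :=
  forall B : I -> set R, (forall i, measurable (B i)) ->
  P [set w | forall i, B i (D i w)] = (\prod_i normal_prob 0%R (sd i) (B i))%E.

Lemma gaussian_family_coordinate (R : realType) disp (T : measurableType disp)
    (P : probability T R) (I : finType) (D : I -> T -> R) (sd : I -> R)
    (i : I) (C : set R) (B : I -> set R) :
  gaussian_family P D sd -> measurable C -> (forall i, measurable (B i)) ->
  P (D i @^-1` C `&` cylinder D (predC1 i) B) =
  (normal_prob 0%R (sd i) C * P (cylinder D (predC1 i) B))%E.
Proof.
move=> gD mC mB.
have cyl C' : D i @^-1` C' `&` cylinder D (predC1 i) B =
    [set w | forall j, (if j == i then C' else B j) (D j w)].
  apply/seteqP; split => w.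
    by move=> [Cw Bw] j; case: eqVneq => [->//|ji]; exact: Bw.
  move=> h; split; first by have := h i; rewrite eqxx.
  by move=> j /= ji; have := h j; rewrite (negPf ji).
have PE C' : measurable C' -> P (D i @^-1` C' `&` cylinder D (predC1 i) B) =
    (normal_prob 0%R (sd i) C' * \prod_(j | j != i) normal_prob 0%R (sd j) (B j))%E.
  move=> mC'; rewrite cyl.
  have -> := gD (fun j => if j == i then C' else B j); last by move=> j; case: ifP.
  rewrite (bigD1 i)//= eqxx; congr (_ * _)%E.
  by apply: eq_bigr => j ji; rewrite (negPf ji).
rewrite PE//; congr (_ * _)%E.
have := PE setT measurableT; rewrite preimage_setT setTI => ->.
by rewrite probability_setT mul1e.
Qed.

(** Induction on the list with tau arbitrary, since integrating out one coordinate enlarges tau by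
    its variance. That coordinate is independent of the remaining sum, which is measurable for the
    sigma-algebra of the other coordinates. *)
Lemma gauss_kernel_sum (R : realType) disp (T : measurableType disp)
    (P : probability T R) (I : finType) (D : I -> T -> R) (sd c : I -> R) (s : seq I)
    (tau a : R) :
  (forall i, measurable_fun setT (D i)) -> (forall i, 0 < sd i) ->
  gaussian_family P D sd -> uniq s -> 0 < tau ->
  let v := \sum_(i <- s) c i ^+ 2 * sd i ^+ 2 in
  (\int[P]_w (gauss_kernel tau (a + \sum_(i <- s) c i * D i w))%:E =
   (Num.sqrt (tau / (tau + v)) * gauss_kernel (tau + v) a)%:E)%E.
Proof.
move=> mD sd0 gD; elim: s tau => [|i s IH] tau us t0 /=.
  under eq_integral do rewrite big_nil addr0.
  rewrite integral_cst//= probability_setT mule1 big_nil addr0 divff ?gt_eqF//.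
  by rewrite sqrtr1 mul1r.
move: us => /= /andP[nis us].
set A := fun w => \sum_(j <- s) c j * D j w.
have AE w : A w = \sum_(j <- s | j != i) c j * D j w.
  rewrite /A [RHS]big_mkcond; apply: eq_big_seq => j js; case: eqVneq => // ji.
  by rewrite -ji js in nis.
have mA : measurable_fun setT A.
  rewrite (_ : A = (fun w => \sum_(j <- s | predC1 i j) c j * D j w)); last exact/funext.
  exact: measurable_combination.
have mA' : measurable_fun setT (A : g_sigma_algebraType (cylinders D (predC1 i)) -> R).
  rewrite (_ : A = (fun w => \sum_(j <- s | predC1 i j) c j * D j w)); last exact/funext.
  apply: (@measurable_combination _ _ (g_sigma_algebraType (cylinders D (predC1 i)))).
  by move=> j ji; exact: measurable_coordinate.
pose f (z : measurableTypeR R * measurableTypeR R) : \bar R :=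
  (gauss_kernel tau (a + (z.1 + c i * z.2)))%:E.
have -> : (\int[P]_w (gauss_kernel tau (a + \sum_(j <- i :: s) c j * D j w))%:E =
    \int[P]_w f (A w, D i w))%E.
  by apply: eq_integral => w _; rewrite big_cons /f /A/= [X in _ + X]addrC.
have indA (B C : set R) : measurable B -> measurable C ->
    P (A @^-1` B `&` D i @^-1` C) = (P (A @^-1` B) * normal_prob 0%R (sd i) C)%E.
  move=> mB mC; rewrite setIC.
  have mE : measurable (D i @^-1` C) by rewrite -[X in measurable X]setTI; exact: mD.
  have PD : P (D i @^-1` C) = normal_prob 0%R (sd i) C.
    have := gaussian_family_coordinate i gD mC (B := fun=> setT) (fun=> measurableT).
    have -> : cylinder D (predC1 i) (fun=> setT) = setT by apply/seteqP; split.
    by rewrite setIT probability_setT mule1.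
  have -> := indep_cylinders (J := predC1 i) mE mD _ (A := A @^-1` B).
  - by rewrite PD muleC.
  - by move=> B' mB'; rewrite PD; exact: (gaussian_family_coordinate i gD mC mB').
  - by have := mA' measurableT B mB; rewrite setTI.
have mf : measurable_fun setT f.
  apply/measurable_EFinP; apply: (measurableT_comp (measurable_gauss_kernel tau)).
  by apply: measurable_funD => //; apply: measurable_funD => //; apply: measurable_funM.
have f0 z : (0 <= f z)%E by rewrite lee_fin gauss_kernel_ge0.
rewrite (integral_indep_pair mA (mD i) indA mf f0).
under eq_integral => w _ do rewrite /f/=.
set t1 := tau + c i ^+ 2 * sd i ^+ 2.
have t10 : 0 < t1 by rewrite ltr_wpDr// mulr_ge0 ?sqr_ge0.
under eq_integral => w _.
  under eq_integral do rewrite addrA.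
  rewrite integral_gauss_kernel// -/t1 EFinM; over.
rewrite /= ge0_integralZl_EFin ?sqrtr_ge0//; last 2 first.
- by move=> w _; rewrite lee_fin gauss_kernel_ge0.
- apply/measurable_EFinP; apply: (measurableT_comp (measurable_gauss_kernel t1)).
  exact: measurable_funD.
rewrite IH// -/A big_cons -EFinM mulrA -sqrtrM ?divr_ge0 ?ltW//.
rewrite mulrA divfK ?gt_eqF// /t1 -addrA; congr (Num.sqrt _ * _)%:E.
Qed.

(* Y has law N(0, v), expressed by the integrals of Gaussian kernels only: they
   suffice for the small ball and tail bounds, and no characteristic function or
   convolution of normal laws is needed. *)
Definition gaussian_var (R : realType) disp (T : measurableType disp)
    (P : probability T R) (Y : T -> R) (v : R) : Prop :=
  forall tau : R, 0 < tau ->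
  (\int[P]_w (gauss_kernel tau (Y w))%:E = (Num.sqrt (tau / (tau + v)))%:E)%E.

(** With tau = eta^2 the kernel is at least 1/2 on the event, while its expectation is sqrt(eta^2 /
    (eta^2 + v)). *)
Lemma gaussian_var_anti (R : realType) disp (T : measurableType disp)
    (P : probability T R) (Y : T -> R) (v eta : R) :
  measurable_fun setT Y -> gaussian_var P Y v -> 0 < v -> 0 < eta ->
  (P [set w | (`|Y w| < eta)%R] <= (2 * eta / Num.sqrt v)%:E)%E.
Proof.
move=> mY gY v0 e0; pose A := [set w | `|Y w| < eta].
have mA : measurable A by apply: measurable_lt_set => //; exact: measurableT_comp.
have mk tau : measurable_fun setT (fun w => (gauss_kernel tau (Y w))%:E).
  by apply/measurable_EFinP; apply: (measurableT_comp (measurable_gauss_kernel tau)).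
have e2 : 0 < eta ^+ 2 by rewrite exprn_gt0.
have h : ((2^-1)%:E * P A <= (Num.sqrt (eta ^+ 2 / (eta ^+ 2 + v)))%:E)%E.
  rewrite -gY// -integral_cst//.
  apply: (@le_trans _ _ (\int[P]_(w in A) (gauss_kernel (eta ^+ 2) (Y w))%:E)%E); last first.
    by apply: ge0_subset_integral => // w _; rewrite lee_fin gauss_kernel_ge0.
  apply: ge0_le_integral => //.
  - by move=> w _; rewrite lee_fin invr_ge0.
  - exact: measurable_funTS (mk _).
  - move=> w Aw; rewrite lee_fin /gauss_kernel.
    apply: le_trans (expR_ge1Dx _); rewrite mulNr.
    have : Y w ^+ 2 / (2 * eta ^+ 2) <= 2^-1.
      rewrite ler_pdivrMr ?mulr_gt0// mulrA mulVf// mul1r -real_normK ?num_real//.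
      by rewrite lerXn2r ?nnegrE ?(ltW e0)// ltW.
    by lra.
have PA : P A = (fine (P A))%:E by rewrite fineK// fin_num_measure.
move: h; rewrite -/A PA -EFinM !lee_fin => h.
have {}h : fine (P A) <= 2 * Num.sqrt (eta ^+ 2 / (eta ^+ 2 + v)).
  by rewrite -ler_pdivrMl.
apply: (le_trans h); rewrite -mulrA ler_wpM2l//.
have -> : eta / Num.sqrt v = Num.sqrt (eta ^+ 2 / v).
  by rewrite sqrtrM ?sqr_ge0// sqrtr_sqr ger0_norm ?ltW// sqrtrV ?ltW.
apply: ler_wsqrtr; rewrite ler_wpM2l ?(ltW e2)// lef_pV2 ?posrE ?addr_gt0//.
by rewrite lerDr ltW.
Qed.

(** A substitute for Chebyshev's inequality in terms of kernels. With tau = eta^2 / 2 the kernel is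
    at most 1/2 on the event, so half of its probability is at most 1 - sqrt(q) <= 1 - q <= v / tau,
    where q = tau / (tau + v). *)
Lemma gaussian_var_tail (R : realType) disp (T : measurableType disp)
    (P : probability T R) (Y : T -> R) (v eta : R) :
  measurable_fun setT Y -> gaussian_var P Y v -> 0 <= v -> 0 < eta ->
  (P [set w | (eta <= `|Y w|)%R] <= (4 * v / eta ^+ 2)%:E)%E.
Proof.
move=> mY gY v0 e0; pose A := [set w | eta <= `|Y w|].
have mA : measurable A by apply: measurable_le_set => //; exact: measurableT_comp.
pose tau := eta ^+ 2 / 2; have tau0 : 0 < tau by rewrite divr_gt0 ?exprn_gt0.
have mk : measurable_fun setT (fun w => (gauss_kernel tau (Y w))%:E).
  by apply/measurable_EFinP; apply: (measurableT_comp (measurable_gauss_kernel tau)).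
have h : ((Num.sqrt (tau / (tau + v)))%:E + (2^-1)%:E * P A <= 1)%E.
  have -> : (P A = \int[P]_w (\1_A w)%:E)%E by rewrite integral_indic// setIT.
  rewrite -gY//.
  rewrite -ge0_integralZl_EFin//; last by apply/measurable_EFinP; exact: measurable_indic.
  have f10 w : [set: T] w -> (0 <= (gauss_kernel tau (Y w))%:E)%E.
    by rewrite lee_fin gauss_kernel_ge0.
  have f20 w : [set: T] w -> (0 <= (2^-1)%:E * (\1_A w)%:E :> \bar R)%E.
    by rewrite lee_fin mulr_ge0 ?invr_ge0.
  have mf2 : measurable_fun setT (fun w => (2^-1)%:E * (\1_A w)%:E : \bar R)%E.
    by apply: emeasurable_funM => //; apply/measurable_EFinP; exact: measurable_indic.
  rewrite -(ge0_integralD _ _ f10 mk f20 mf2)//.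
  apply: (@le_trans _ _ (\int[P]_w cst 1%E w)%E); last first.
    by rewrite integral_cst//= mul1e probability_setT.
  apply: ge0_le_integral => //.
  - by move=> w _; rewrite adde_ge0 ?f10 ?f20.
  - exact: emeasurable_funD.
  - move=> w _; rewrite -EFinM -EFinD lee_fin indicE.
    have [/set_mem Aw|nAw] := boolP (w \in A); last first.
      by rewrite mulr0 addr0 gauss_kernel_le1.
    rewrite mulr1 /gauss_kernel mulNr expRN.
    have h2 : 2 <= expR (Y w ^+ 2 / (2 * tau)).
      apply: le_trans (expR_ge1Dx _).
      have : 1 <= Y w ^+ 2 / (2 * tau).
        rewrite ler_pdivlMr ?mulr_gt0// mul1r /tau mulrCA divff// mulr1.
        by rewrite -[leRHS]real_normK ?num_real// lerXn2r ?nnegrE ?(ltW e0).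
      by lra.
    have : (expR (Y w ^+ 2 / (2 * tau)))^-1 <= 2^-1 by rewrite lef_pV2 ?posrE ?expR_gt0.
    by lra.
have PA : P A = (fine (P A))%:E by rewrite fineK// fin_num_measure.
move: h; rewrite -/A PA -EFinM -EFinD !lee_fin => h.
set q := tau / (tau + v) in h.
have q1 : q <= 1 by rewrite ler_pdivrMr ?mul1r ?lerDl// ltr_wpDr.
have q0 : 0 <= q by rewrite divr_ge0 ?addr_ge0// ltW.
have sq : q <= Num.sqrt q.
  rewrite -{1}(sqr_sqrtr q0) expr2 ler_piMr ?sqrtr_ge0//.
  by rewrite -sqrtr1 ler_wsqrtr.
have : 1 - q <= 2 * v / eta ^+ 2.
  have -> : 1 - q = v / (tau + v) by rewrite /q; field; rewrite gt_eqF// ltr_wpDr.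
  have -> : 2 * v / eta ^+ 2 = v / tau by rewrite /tau; field; rewrite gt_eqF.
  by rewrite ler_wpM2l// lef_pV2 ?posrE ?lerDl// ltr_wpDr.
have -> : 4 * v / eta ^+ 2 = 2 * (2 * v / eta ^+ 2) by ring.
by lra.
Qed.

Lemma telescope_index (R : eqType) (V : zmodType) (f : R -> V) (pts : seq R) (x0 x y : R) :
  x \in pts -> y \in pts -> (index x pts <= index y pts)%N ->
  f y - f x = \sum_(l < (size pts).-1)
    (f (nth x0 pts l.+1) - f (nth x0 pts l)) *+ (index x pts <= l < index y pts)%N.
Proof.
move=> xp yp xy.
have yL : (index y pts <= (size pts).-1)%N by move: yp; rewrite -index_mem; lia.
set a := index x pts; set b := index y pts.
(* Clamping the index between a and b makes the restricted sum telescope over the whole range. *)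
pose h l := f (nth x0 pts (minn (maxn l a) b)).
have hE l : (f (nth x0 pts l.+1) - f (nth x0 pts l)) *+ (a <= l < b)%N = h l.+1 - h l.
  rewrite /h; have [al|la] /= := leqP a l.
    have [lb|bl] := ltnP l b.
      by rewrite mulr1n; congr (f (nth _ _ _) - f (nth _ _ _)); lia.
    by rewrite mulr0n; apply/esym/eqP; rewrite subr_eq0; apply/eqP; congr (f (nth _ _ _)); lia.
  by rewrite mulr0n; apply/esym/eqP; rewrite subr_eq0; apply/eqP; congr (f (nth _ _ _)); lia.
under eq_bigr do rewrite hE.
rewrite -(big_mkord xpredT (fun l => h l.+1 - h l)) telescope_sumr// /h.
have -> : minn (maxn (size pts).-1 a) b = b by lia.
have -> : minn (maxn 0 a) b = a by rewrite /a /b in xy *; lia.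
by rewrite !nth_index.
Qed.

(** * Wiener integrals of step functions *)

(* The value of the step function g on the l-th cell of the grid pts. *)
Definition step_coef (R : realType) (pts : seq R) (g : steps R) (l : nat) : R :=
  \sum_(q <- g) q.2 * (index q.1.1 pts <= l < index q.1.2 pts)%N%:R.

Definition on_grid (R : realType) (pts : seq R) (g : steps R) : Prop :=
  forall q, q \in g -> [/\ q.1.1 \in pts, q.1.2 \in pts & q.1.1 <= q.1.2].

Lemma step_int_grid (R : realType) (Omega : Type) (B : R -> Omega -> R) (pts : seq R)
    (g : steps R) (w : Omega) : sorted <%R pts -> on_grid pts g ->
  step_int B g w = \sum_(l < (size pts).-1)
    step_coef pts g l * (B (pts`_l.+1) w - B (pts`_l) w).
Proof.
move=> sp gp; rewrite /step_int /step_coef.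
under [RHS]eq_bigr do rewrite mulr_suml.
rewrite exchange_big /=; apply: eq_big_seq => q /gp[q1 q2 q12].
rewrite (telescope_index (fun t => B t w) 0 q1 q2); last first.
  rewrite leqNgt; apply/negP => lt; move: q12; rewrite leNgt => /negP; apply.
  rewrite -(nth_index 0 q1) -(nth_index 0 q2).
  by rewrite (lt_sorted_ltn_nth 0 sp) ?inE ?index_mem.
rewrite mulr_sumr; apply: eq_bigr => l _.
by rewrite -mulrA mulr_natl.
Qed.

Lemma indic_itvoc (R : realType) (s t x : R) : s <= t ->
  \1_(`]s, t]%classic) x = (x <= t)%R%:R - (x <= s)%R%:R :> R.
Proof.
move=> st; rewrite indicE; have [xs|xs] := leP x s.
  rewrite (le_trans xs st) subrr memNset//=.
  by rewrite in_itv/= ltNge xs.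
have [xt|xt] := leP x t; rewrite ?subr0.
  by rewrite mem_set//= in_itv/= xs xt.
by rewrite memNset//= in_itv/= xs/= leNgt xt.
Qed.

(** At a fixed x a step function is the step integral against the deterministic path t |-> 1_{x <=
    t}, so this is an instance of [step_int_grid]. *)
Lemma step_fun_grid (R : realType) (pts : seq R) (g : steps R) (x : R) :
  sorted <%R pts -> on_grid pts g ->
  step_fun g x = \sum_(l < (size pts).-1)
    step_coef pts g l * ((x <= pts`_l.+1)%R%:R - (x <= pts`_l)%R%:R).
Proof.
move=> sp gp.
rewrite -(step_int_grid (fun t y => (y <= t)%R%:R) x sp gp).
apply: eq_big_seq => q /gp[q1 q2 q12].
by rewrite indic_itvoc.
Qed.

(** The cells of the grid are disjoint, so the cross terms of the square vanish. The right-hand side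
    is the variance of the corresponding step integral. *)
Lemma integral_step_fun_sqr (R : realType) (pts : seq R) (g : steps R) (s t : R) :
  sorted <%R pts -> on_grid pts g -> (forall x, x \in pts -> s <= x <= t) ->
  (\int[@lebesgue_measure R]_(x in `[s, t]) ((step_fun g x) ^+ 2)%:E =
   (\sum_(l < (size pts).-1) step_coef pts g l ^+ 2 * (pts`_l.+1 - pts`_l))%:E)%E.
Proof.
move=> sp gp pst.
have ltp l k : (l < k)%N -> (k < size pts)%N -> pts`_l < pts`_k.
  by move=> lk kp; rewrite (lt_sorted_ltn_nth 0 sp) ?inE// (ltn_trans lk).
have lep l k : (l <= k)%N -> (k < size pts)%N -> pts`_l <= pts`_k.
  by move=> lk kp; rewrite (lt_sorted_leq_nth 0 sp) ?inE// (leq_ltn_trans lk).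
have lS (l : 'I_(size pts).-1) : (l.+1 < size pts)%N by have := ltn_ord l; lia.
pose J (l : 'I_(size pts).-1) := `]pts`_l, pts`_l.+1]%classic.
have sqE x : (step_fun g x) ^+ 2 = \sum_(l < (size pts).-1) step_coef pts g l ^+ 2 * \1_(J l) x.
  rewrite (step_fun_grid x sp gp).
  under eq_bigr => l _ do rewrite -indic_itvoc ?(ltW (ltp _ _ (leqnn _) (lS l)))// -/(J l).
  rewrite expr2 mulr_suml; apply: eq_bigr => l _.
  rewrite (bigD1 l)//= mulrDr [X in _ + X]mulr_sumr [X in _ + X]big1 ?addr0.
    by rewrite mulrACA -!expr2; congr (_ * _);
      rewrite indicE; case: (_ \in _); rewrite ?expr0n ?expr1n.
  move=> k kl; rewrite mulrACA [X in _ * X](_ : _ = 0) ?mulr0//.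
  rewrite !indicE; apply/eqP; rewrite -natrM mulnb pnatr_eq0 eqb0; apply/negP.
  move=> /andP[/set_mem xl /set_mem xk]; move: xl xk.
  rewrite /J/= !in_itv/= => /andP[l1 l2] /andP[k1 k2].
  move: kl; rewrite -val_eqE/= neq_ltn => /orP[kl|lk].
    by have := lep _ _ kl (ltn_trans (ltnSn _) (lS l)); rewrite leNgt (lt_le_trans l1 k2).
  by have := lep _ _ lk (ltn_trans (ltnSn _) (lS k)); rewrite leNgt (lt_le_trans k1 l2).
under eq_integral do rewrite sqE -sumEFin.
have mJ l : measurable_fun `[s, t]%classic (fun x => (\1_(J l) x)%:E : \bar R).
  by apply: measurable_funTS; apply/measurable_EFinP;
    apply: measurable_indic; exact: measurable_itv.
rewrite ge0_integral_sum//; last 2 first.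
- move=> l; apply/measurable_EFinP; apply: measurable_funM => //.
  by apply: measurable_funTS; apply: measurable_indic; exact: measurable_itv.
- by move=> l x _; rewrite lee_fin mulr_ge0 ?sqr_ge0.
rewrite -sumEFin; apply: eq_bigr => l _.
under eq_integral do rewrite EFinM.
rewrite ge0_integralZl_EFin ?sqr_ge0//; last exact: mJ.
have -> : (\int[lebesgue_measure]_(x in `[s, t]) (\1_(J l) x)%:E =
    lebesgue_measure (J l `&` `[s, t]))%E.
  by rewrite integral_indic//; exact: measurable_itv.
rewrite [RHS]EFinM; congr (_ * _)%E.
have -> : J l `&` `[s, t] = J l.
  apply/setIidl => x; rewrite /J/= !in_itv/= => /andP[x1 x2].
  have /andP[s1 _] := pst _ (mem_nth 0 (ltnW (lS l))).
  have /andP[_ t2] := pst _ (mem_nth 0 (lS l)).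
  by rewrite (le_trans s1 (ltW x1)) (le_trans x2 t2).
by rewrite lebesgue_measure_itv/= lte_fin ltp// EFinB.
Qed.

(** * Brownian increments along a grid, their joint law and their independence of the past *)

Lemma filtrationI (R : realType) disp (T : measurableType disp)
    (F : R -> set (set T)) (t : R) (A B : set T) :
  filtration F -> 0 <= t -> F t A -> F t B -> F t (A `&` B).
Proof.
move=> [fF _] t0 FA FB; have [sF _] := fF t t0.
rewrite -(sigma_algebra_id sF) in FA FB *.
exact: (@measurableI _ (g_sigma_algebraType (F t)) _ _ FA FB).
Qed.

(** Being a sigma-algebra, [F t] coincides with the one it generates. This makes it a measurable
    structure of its own, to which the closure properties of measurable sets and functions apply. *)
Lemma measurable_filtrationP (R : realType) disp (T : measurableType disp)
    (F : R -> set (set T)) (t : R) (A : set T) :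
  filtration F -> 0 <= t ->
  F t A <-> @measurable _ (g_sigma_algebraType (F t)) A.
Proof.
move=> [fF _] t0; have [sF _] := fF t t0.
by rewrite -[X in X A <-> _](sigma_algebra_id sF).
Qed.

Lemma adapted_measurable (R : realType) disp (T : measurableType disp)
    (F : R -> set (set T)) (p : nat) (Z : R -> T -> 'cV[R]_p) (s t : R) (j : 'I_p) :
  filtration F -> 0 <= s -> s <= t -> adapted_at F Z s ->
  measurable_fun setT ((fun w => Z s w j 0) : g_sigma_algebraType (F t) -> R).
Proof.
move=> fF s0 st aZ _ B mB; rewrite setTI.
apply/(measurable_filtrationP _ fF (le_trans s0 st)).
by have [_ mono] := fF; apply: (mono s t s0 st); exact: aZ.
Qed.

Lemma filtration_sub_measurable (R : realType) (disp : measure_display)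
    (T : measurableType disp) (F : R -> set (set T)) (t : R) (f : T -> R) :
  filtration F -> 0 <= t ->
  measurable_fun setT (f : g_sigma_algebraType (F t) -> R) -> measurable_fun setT f.
Proof.
move=> fF t0 mf _ B mB; have [_ sub] := fF.1 t t0; apply: sub.
by apply/measurable_filtrationP => //; exact: mf.
Qed.

Definition grid_incr (R : realType) (T : Type) (m L : nat) (W : R -> T -> 'cV[R]_m)
    (p : nat -> R) (i : 'I_L * 'I_m) (w : T) : R :=
  W (p i.1.+1) w i.2 0 - W (p i.1) w i.2 0.

Lemma measurable_grid_incr (R : realType) disp (T : measurableType disp)
    (P : probability T R) (F : R -> set (set T)) (m L : nat) (W : R -> T -> 'cV[R]_m)
    (p : nat -> R) (t : R) (i : 'I_L * 'I_m) :
  filtration F -> brownian_motion P F W ->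
  (forall l, (l <= L)%N -> 0 <= p l <= t) ->
  measurable_fun setT (grid_incr W p i : g_sigma_algebraType (F t) -> R).
Proof.
move=> fF [aW _ _ _] pt.
have /andP[a1 a2] := pt _ (ltn_ord i.1); have /andP[b1 b2] := pt _ (ltnW (ltn_ord i.1)).
by apply: measurable_funB; apply: adapted_measurable => //; exact: aW.
Qed.

(** Induction on the number of cells: E together with the constraints on earlier increments is an
    event at time [p k], so the next increment splits off as a factor. Keeping E in the formula
    gives the joint law and the independence of the past at once. *)
Lemma brownian_grid (R : realType) disp (T : measurableType disp)
    (P : probability T R) (F : R -> set (set T)) (m L : nat) (W : R -> T -> 'cV[R]_m)
    (p : nat -> R) (E : set T) (B : 'I_L * 'I_m -> set R) :
  filtration F -> brownian_motion P F W ->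
  0 <= p 0%N -> (forall l, (l < L)%N -> p l < p l.+1) ->
  F (p 0%N) E -> (forall i, measurable (B i)) ->
  P (E `&` [set w | forall i, B i (grid_incr W p i w)]) =
  (P E * \prod_(i : 'I_L * 'I_m) normal_prob 0%R (Num.sqrt (p i.1.+1 - p i.1)) (B i))%E.
Proof.
move=> fF bW p0 pS FE mB.
suff h k : (k <= L)%N ->
    let A := E `&` [set w | forall i : 'I_L * 'I_m, (i.1 < k)%N -> B i (grid_incr W p i w)] in
    [/\ 0 <= p k, F (p k) A & P A =
    (P E * \prod_(i : 'I_L * 'I_m | (i.1 < k)%N)
      normal_prob 0%R (Num.sqrt (p i.1.+1 - p i.1)) (B i))%E].
  have [_ _ hL] := h L (leqnn L).
  transitivity (P (E `&` [set w | forall i : 'I_L * 'I_m, (i.1 < L)%N -> B i (grid_incr W p i w)])).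
    congr (P (E `&` _)); apply/seteqP; split => w h' i; first by move=> _; exact: h'.
    by apply: h'; exact: ltn_ord.
  by rewrite hL; congr (_ * _)%E; apply: eq_bigl => i; rewrite ltn_ord.
elim: k => [_|k IH kL] /=.
  rewrite (_ : [set w | _] = setT) ?setIT; last by apply/seteqP; split.
  by split => //; rewrite big_pred0 ?mule1// => i; rewrite ltn0.
have [pk0 FA PA] := IH (ltnW kL).
have pkS := pS _ kL.
have [aW _ incW _] := bW.
set A := E `&` [set w | _] in FA PA.
pose ok : 'I_L := Ordinal kL.
pose C := [set w | forall j, B (ok, j) (W (p k.+1) w j 0 - W (p k) w j 0)].
have -> : E `&` [set w | forall i : 'I_L * 'I_m, (i.1 < k.+1)%N -> B i (grid_incr W p i w)] =
    A `&` C.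
  apply/seteqP; split => w.
    move=> [Ew h]; split; last by move=> j; apply: (h (ok, j)) => /=.
    by split=> // i ik; apply: h; rewrite (ltn_trans ik).
  move=> [[Ew h1] h2]; split=> // -[i j] /=; rewrite ltnS leq_eqVlt => /orP[/eqP ik|ik].
    by have := h2 j; rewrite (_ : i = ok)//; apply: val_inj.
  exact: (h1 (i, j)).
split.
- exact: le_trans pk0 (ltW pkS).
- apply: filtrationI => //; first exact: le_trans pk0 (ltW pkS).
    by have [_ mono] := fF; apply: (mono _ _ pk0 (ltW pkS)).
  apply/(measurable_filtrationP _ fF (le_trans pk0 (ltW pkS))).
  apply: (@measurable_forall _ (g_sigma_algebraType (F (p k.+1))) _
    (fun j w => B (ok, j) (W (p k.+1) w j 0 - W (p k) w j 0))) => j.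
  rewrite -[X in measurable X]setTI.
  have mf : measurable_fun setT ((fun w => W (p k.+1) w j 0 - W (p k) w j 0)
     : g_sigma_algebraType (F (p k.+1)) -> R).
    apply: measurable_funB; apply: adapted_measurable => //.
    + exact: le_trans pk0 (ltW pkS).
    + exact/aW/(le_trans pk0 (ltW pkS)).
    + exact: ltW.
    + exact: aW.
  exact: mf.
- have -> : P (A `&` C) = (P A * \prod_(j < m)
      normal_prob 0%R (Num.sqrt (p k.+1 - p k)) (B (ok, j)))%E.
    by apply: incW => // j; exact: mB.
  rewrite PA -muleA; congr (_ * _)%E.
  rewrite [RHS](bigID (fun i : 'I_L * 'I_m => (i.1 < k)%N))/=; congr (_ * _)%E.
    by apply: eq_bigl => i; rewrite andb_idl// => /ltnW.
  rewrite (reindex_onto (fun j : 'I_m => (ok, j)) (fun i => i.2)) /=.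
    by apply: eq_bigl => j; rewrite ltnS leqnn ltnn eqxx.
  move=> [i j] /= /andP[]; rewrite ltnS -leqNgt => ik ki.
  by congr (_, _); apply: val_inj => /=; apply/eqP; rewrite eqn_leq ki ik.
Qed.

Definition steps_in (R : realType) (s t : R) (g : steps R) : Prop :=
  forall q, q \in g -> [/\ s <= q.1.1, q.1.1 <= q.1.2 & q.1.2 <= t].

Definition wiener_sum (R : realType) (T : Type) (m : nat) (W : R -> T -> 'cV[R]_m)
    (G : 'I_m -> steps R) (w : T) : R :=
  \sum_j step_int (fun t w => W t w j 0) (G j) w.

Lemma grid_exists (R : realType) (K : finType) (G : K -> steps R) (s t : R) :
  s <= t -> (forall k, steps_in s t (G k)) -> exists pts : seq R,
  [/\ sorted <%R pts, forall k, on_grid pts (G k), pts`_0 = s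
    & forall x, x \in pts -> s <= x <= t].
Proof.
move=> st hG.
(* Adding s makes the grid nonempty and lets it begin at the time from which the past is split
   off. *)
pose E := s :: flatten [seq [seq q.1.1 | q <- G k] ++ [seq q.1.2 | q <- G k] | k <- enum K].
pose pts := sort <=%R (undup E).
have inE' x : (x \in pts) = (x \in E) by rewrite mem_sort mem_undup.
have Est x : x \in pts -> s <= x <= t.
  rewrite inE' in_cons => /orP[/eqP ->|]; first by rewrite lexx st.
  move=> /flattenP[l /mapP[k _ ->]]; rewrite mem_cat => /orP[|] /mapP[q /hG[h1 h2 h3] ->].
    by rewrite h1 (le_trans h2 h3).
  by rewrite h3 (le_trans h1 h2).
have sp : sorted <%R pts.
  by rewrite lt_sorted_uniq_le sort_uniq undup_uniq sort_sorted//; exact: le_total.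
exists pts; split=> //.
- move=> k q qG; have [_ q12 _] := hG k q qG.
  have inE2 x : x \in [seq q.1.1 | q <- G k] ++ [seq q.1.2 | q <- G k] -> x \in pts.
    move=> xG; rewrite inE' in_cons; apply/orP; right; apply/flattenP.
    exists ([seq q.1.1 | q <- G k] ++ [seq q.1.2 | q <- G k]) => //.
    by apply/mapP; exists k; rewrite ?mem_enum.
  by split => //; apply: inE2; rewrite mem_cat; apply/orP; [left|right]; apply/mapP; exists q.
- have sin : s \in pts by rewrite inE' mem_head.
  have pos : (0 < size pts)%N by move: sin; case: (pts).
  apply/eqP; rewrite eq_le; have /andP[-> _] := Est _ (mem_nth 0 pos); rewrite andbT.
  rewrite -[leRHS](nth_index 0 sin).
  by rewrite (lt_sorted_leq_nth 0 sp) ?inE// index_mem.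
Qed.

Lemma wiener_sum_grid (R : realType) (T : Type) (m : nat) (W : R -> T -> 'cV[R]_m)
    (G : 'I_m -> steps R) (pts : seq R) (w : T) :
  sorted <%R pts -> (forall j, on_grid pts (G j)) ->
  wiener_sum W G w = \sum_(i : 'I_(size pts).-1 * 'I_m)
    step_coef pts (G i.2) i.1 * grid_incr W (nth 0 pts) i w.
Proof.
move=> sp gp; rewrite -(pair_bigA _ (fun l j => step_coef pts (G j) (l : 'I__)
  * grid_incr W (nth 0 pts) (l, j) w))/= exchange_big.
by apply: eq_bigr => j _; rewrite (step_int_grid _ _ sp (gp j)).
Qed.

Lemma grid_incr_gaussian (R : realType) disp (T : measurableType disp)
    (P : probability T R) (F : R -> set (set T)) (m L : nat) (W : R -> T -> 'cV[R]_m)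
    (p : nat -> R) :
  filtration F -> brownian_motion P F W ->
  0 <= p 0%N -> (forall l, (l < L)%N -> p l < p l.+1) ->
  gaussian_family P (grid_incr W p) (fun i : 'I_L * 'I_m => Num.sqrt (p i.1.+1 - p i.1)).
Proof.
move=> fF bW p0 pS B mB.
have FT : F (p 0%N) setT.
  by apply/(measurable_filtrationP _ fF p0); exact: measurableT.
have := brownian_grid fF bW p0 pS FT mB.
by rewrite setTI probability_setT mul1e.
Qed.

Lemma sorted_grid (R : realType) (pts : seq R) (s t : R) : sorted <%R pts -> 0 <= s ->
  pts`_0 = s -> (forall x, x \in pts -> s <= x <= t) -> s <= t ->
  [/\ 0 <= pts`_0, forall l, (l < (size pts).-1)%N -> pts`_l < pts`_l.+1
    & forall l, (l <= (size pts).-1)%N -> 0 <= pts`_l <= t].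
Proof.
move=> sp s0 p0 pst st; split; first by rewrite p0.
  move=> l hl; have l2 : (l.+1 < size pts)%N by move: hl; case: (size pts).
  by rewrite (lt_sorted_ltn_nth 0 sp) ?inE// ltnW.
move=> l hl; have [ls|sl] := ltnP l (size pts).
  by have /andP[h1 ->] := pst _ (mem_nth 0 ls); rewrite (le_trans s0 h1).
(* Only the empty grid is concerned here; the default value 0 lies in the interval. *)
by rewrite nth_default// lexx (le_trans s0 st).
Qed.

Lemma wiener_sum_measurable (R : realType) disp (T : measurableType disp)
    (P : probability T R) (F : R -> set (set T)) (m : nat) (W : R -> T -> 'cV[R]_m)
    (G : 'I_m -> steps R) (s t : R) :
  filtration F -> brownian_motion P F W -> 0 <= s -> s <= t ->
  (forall j, steps_in s t (G j)) ->
  measurable_fun setT (wiener_sum W G : g_sigma_algebraType (F t) -> R).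
Proof.
move=> fF bW s0 st hG; have [pts [sp gp p0 pst]] := grid_exists st hG.
have [q0 qS qt] := sorted_grid sp s0 p0 pst st.
rewrite (_ : wiener_sum W G = fun w => \sum_(i : 'I_(size pts).-1 * 'I_m)
    step_coef pts (G i.2) i.1 * grid_incr W (nth 0 pts) i w); last first.
  by apply/funext => w; exact: wiener_sum_grid.
apply: (@measurable_combination _ _ (g_sigma_algebraType (F t))) => i _.
exact: (@measurable_grid_incr _ _ _ P F m _ W (nth 0 pts) t _ fF bW qt).
Qed.

(** On a common grid for all components the sum is a linear combination of independent normal
    increments, and its variance is given by the isometry. *)
Lemma wiener_sum_gaussian (R : realType) disp (T : measurableType disp)
    (P : probability T R) (F : R -> set (set T)) (m : nat) (W : R -> T -> 'cV[R]_m)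
    (G : 'I_m -> steps R) (s t : R) :
  filtration F -> brownian_motion P F W -> 0 <= s -> s <= t ->
  (forall j, steps_in s t (G j)) ->
  exists v : R, [/\ 0 <= v, gaussian_var P (wiener_sum W G) v &
    (v%:E = \sum_j \int[@lebesgue_measure R]_(x in `[s, t]) (step_fun (G j) x ^+ 2)%:E)%E].
Proof.
move=> fF bW s0 st hG; have [pts [sp gp p0 pst]] := grid_exists st hG.
have [q0 qS qt] := sorted_grid sp s0 p0 pst st.
pose c (i : 'I_(size pts).-1 * 'I_m) := step_coef pts (G i.2) i.1.
pose sd (i : 'I_(size pts).-1 * 'I_m) := Num.sqrt (pts`_i.1.+1 - pts`_i.1).
have sd2 i : sd i ^+ 2 = pts`_i.1.+1 - pts`_i.1.
  by rewrite sqr_sqrtr// subr_ge0 ltW// qS.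
exists (\sum_i c i ^+ 2 * sd i ^+ 2); split.
- by apply: sumr_ge0 => i _; rewrite mulr_ge0 ?sqr_ge0.
- move=> tau tau0; under eq_integral do rewrite (wiener_sum_grid _ _ sp gp).
  have mD (i : 'I_(size pts).-1 * 'I_m) : measurable_fun setT (grid_incr W (nth 0 pts) i).
    apply: (filtration_sub_measurable fF (le_trans s0 st)).
    exact: (@measurable_grid_incr _ _ _ P F m _ W (nth 0 pts) t _ fF bW qt).
  have sd0 i : 0 < sd i by rewrite sqrtr_gt0 subr_gt0 qS.
  have := gauss_kernel_sum c 0 mD sd0 (grid_incr_gaussian fF bW q0 qS) (index_enum_uniq _) tau0.
  rewrite /= => h; under eq_integral do rewrite -[X in gauss_kernel _ X]add0r.
  by rewrite h /gauss_kernel expr0n/= oppr0 mul0r expR0 mulr1.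
- under [RHS]eq_bigr do rewrite (integral_step_fun_sqr sp (gp _) pst).
  rewrite sumEFin exchange_big /= pair_bigA /=; congr (_%:E); apply: eq_bigr => i _.
  by rewrite sd2.
Qed.

(** Along a grid common to all k, the event belongs to the sigma-algebra of increments after time s,
    and these are jointly independent of [F s]. *)
Lemma wiener_sum_indep (R : realType) disp (T : measurableType disp)
    (P : probability T R) (F : R -> set (set T)) (m : nat) (W : R -> T -> 'cV[R]_m)
    (K : finType) (G : K -> 'I_m -> steps R) (s t : R) (E : set T) (Q : K -> set R) :
  filtration F -> brownian_motion P F W -> 0 <= s -> s <= t ->
  (forall k j, steps_in s t (G k j)) -> F s E -> (forall k, measurable (Q k)) ->
  let A := [set w | forall k, Q k (wiener_sum W (G k) w)] in
  P (E `&` A) = (P E * P A)%E.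
Proof.
move=> fF bW s0 st hG FE mQ A.
have [pts [sp gp' p0 pst]] := @grid_exists R (K * 'I_m)%type (fun kj => G kj.1 kj.2) s t st
  (fun kj => hG kj.1 kj.2).
have gp k j : on_grid pts (G k j) := gp' (k, j).
have [q0 qS qt] := sorted_grid sp s0 p0 pst st.
pose D := grid_incr (L := (size pts).-1) W (nth 0 pts).
have mD i : measurable_fun setT (D i).
  apply: (filtration_sub_measurable fF (le_trans s0 st)).
  exact: (@measurable_grid_incr _ _ _ P F m _ W (nth 0 pts) t _ fF bW qt).
have mE : measurable E by apply: (fF.1 s s0).2.
have cylE B : cylinder D xpredT B = [set w | forall i, B i (D i w)].
  by apply/seteqP; split => w h i; [exact: h|move=> _; exact: h].
apply: (indep_cylinders (D := D) (J := xpredT)) => //.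
  move=> B mB; rewrite cylE (brownian_grid fF bW q0 qS)//; last by rewrite p0.
  congr (_ * _)%E; apply/esym; exact: (grid_incr_gaussian fF bW q0 qS).
apply: (@measurable_forall _ (g_sigma_algebraType (cylinders D xpredT)) _
  (fun k w => Q k (wiener_sum W (G k) w))) => k.
rewrite -[X in measurable X]setTI.
suff : measurable_fun setT (wiener_sum W (G k) : g_sigma_algebraType (cylinders D xpredT) -> R).
  by move=> h; exact: h.
rewrite (_ : wiener_sum W (G k) = fun w => \sum_(i : 'I_(size pts).-1 * 'I_m)
    step_coef pts (G k i.2) i.1 * D i w); last first.
  by apply/funext => w; exact: wiener_sum_grid.
apply: (@measurable_combination _ _ (g_sigma_algebraType (cylinders D xpredT))) => i _.
exact: measurable_coordinate.
Qed.

Definition indep_past (R : realType) disp (T : measurableType disp)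
    (P : probability T R) (F : R -> set (set T)) (s : R) (A : set T) : Prop :=
  forall E, F s E -> P (E `&` A) = (P E * P A)%E.

(** Mutual independence follows from independence of the past alone, because the events on earlier
    intervals all lie in the filtration at the beginning of the next one. *)
Lemma indep_blocks (R : realType) disp (T : measurableType disp)
    (P : probability T R) (F : R -> set (set T)) (p : nat) (s t : 'I_p -> R)
    (A : 'I_p -> set T) :
  filtration F -> (forall i, 0 <= s i) -> (forall i, s i <= t i) ->
  (forall i i' : 'I_p, (i < i')%N -> t i <= s i') ->
  (forall i, F (t i) (A i)) -> (forall i, indep_past P F (s i) (A i)) ->
  P [set w | forall i, A i w] = (\prod_i P (A i))%E.
Proof.
move=> fF s0 st ts FA iA.
suff h k : (k <= p)%N ->
  (forall i : 'I_p, (k <= i)%N -> F (s i) [set w | forall i : 'I_p, (i < k)%N -> A i w]) /\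
  P [set w | forall i : 'I_p, (i < k)%N -> A i w] = (\prod_(i : 'I_p | (i < k)%N) P (A i))%E.
  have [_ hp] := h p (leqnn p).
  transitivity (P [set w | forall i : 'I_p, (i < p)%N -> A i w]).
    by congr (P _); apply/seteqP; split => w hw i; [move=> _; exact: hw|apply: hw; exact: ltn_ord].
  by rewrite hp; apply: eq_bigl => i; rewrite ltn_ord.
elim: k => [_|k IH kp].
  have -> : [set w | forall i : 'I_p, (i < 0)%N -> A i w] = setT by apply/seteqP; split.
  split => [i _|]; last by rewrite probability_setT big_pred0.
  by apply/(measurable_filtrationP _ fF (s0 i)); exact: measurableT.
have [Fk Pk] := IH (ltnW kp); pose ok := Ordinal kp.
have -> : [set w | forall i : 'I_p, (i < k.+1)%N -> A i w] =
    [set w | forall i : 'I_p, (i < k)%N -> A i w] `&` A ok.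
  apply/seteqP; split => w.
    by move=> h; split; [move=> i ik; apply: h; exact: ltnW|exact: h].
  move=> [h1 h2] i; rewrite ltnS leq_eqVlt => /orP[/eqP ik|ik]; last exact: h1.
  by rewrite (_ : i = ok)//; apply: val_inj.
split.
  move=> i ki; have [_ mono] := fF.
  have ti : t ok <= s i by apply: ts.
  apply: filtrationI => //; last exact: (mono _ _ (le_trans (s0 ok) (st ok)) ti).
  apply: (mono (s ok)) => //; first exact: le_trans (st ok) ti.
  exact: Fk.
rewrite (iA ok _ (Fk ok (leqnn _))) Pk muleC.
rewrite [RHS](bigD1 ok)//=; congr (_ * _)%E; apply: eq_bigl => i.
by rewrite ltnS [in RHS]leq_eqVlt -val_eqE /=; case: ltngtP.
Qed.

(** * Linear combinations of step functions and the small ball estimate for step integrands *)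

(** The encoding of the linear combination of the [g a] with coefficients [u a]: weights are
    multiplied and lists concatenated. *)
Definition step_scale (R : realType) (I : finType) (u : I -> R) (g : I -> steps R) :
    steps R :=
  flatten [seq [seq (q.1, u a * q.2) | q <- g a] | a <- enum I].

Lemma big_step_scale (R : realType) (V : nmodType) (I : finType) (u : I -> R)
    (g : I -> steps R) (f : R * R * R -> V) :
  \sum_(q <- step_scale u g) f q = \sum_a \sum_(q <- g a) f (q.1, u a * q.2).
Proof.
rewrite /step_scale big_flatten big_map big_enum /=.
by apply: eq_bigr => a _; rewrite big_map.
Qed.

Lemma step_fun_scale (R : realType) (I : finType) (u : I -> R) (g : I -> steps R) x :
  step_fun (step_scale u g) x = \sum_a u a * step_fun (g a) x.
Proof.
rewrite /step_fun big_step_scale; apply: eq_bigr => a _; rewrite mulr_sumr.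
by apply: eq_bigr => q _; rewrite mulrA.
Qed.

Lemma step_int_scale (R : realType) (T : Type) (B : R -> T -> R) (I : finType) (u : I -> R)
    (g : I -> steps R) w :
  step_int B (step_scale u g) w = \sum_a u a * step_int B (g a) w.
Proof.
rewrite /step_int big_step_scale; apply: eq_bigr => a _; rewrite mulr_sumr.
by apply: eq_bigr => q _; rewrite mulrA.
Qed.

Lemma steps_in_scale (R : realType) (I : finType) (u : I -> R) (g : I -> steps R) s t :
  (forall a, steps_in s t (g a)) -> steps_in s t (step_scale u g).
Proof.
move=> h q /flattenP[l /mapP[a _ ->] /mapP[q' q'g ->]] /=.
exact: h q'g.
Qed.

Lemma wiener_sum_scale (R : realType) (T : Type) (m : nat) (W : R -> T -> 'cV[R]_m)
    (I : finType) (u : I -> R) (G : I -> 'I_m -> steps R) w :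
  wiener_sum W (fun j => step_scale u (G^~ j)) w = \sum_a u a * wiener_sum W (G a) w.
Proof.
rewrite /wiener_sum; under eq_bigr do rewrite step_int_scale.
by rewrite exchange_big; apply: eq_bigr => a _; rewrite mulr_sumr.
Qed.

Lemma measurable_exists (disp : measure_display) (T : measurableType disp) (I : finType)
    (N : I -> set T) : (forall i, measurable (N i)) -> measurable [set w | exists i, N i w].
Proof.
move=> mN; rewrite [X in measurable X](_ : _ = \bigcup_i N i); last first.
  by apply/seteqP; split => w [i]; exists i.
by apply: countable_bigcupT_measurable; first exact: countableP.
Qed.

Lemma measure_exists_le (R : realType) disp (T : measurableType disp)
    (P : measure T R) (I : finType) (N : I -> set T) : (forall i, measurable (N i)) ->
  (P [set w | exists i, N i w] <= \sum_i P (N i))%E.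
Proof.
move=> mN.
suff h (s : seq I) : let A := \big[setU/set0]_(i <- s) N i in
    [/\ measurable A, (P A <= \sum_(i <- s) P (N i))%E &
       forall w i, i \in s -> N i w -> A w].
  have [mA PA hA] := h (index_enum I).
  apply: le_trans PA; apply: le_measure; rewrite ?inE//; first exact: measurable_exists.
  by move=> w [i]; apply: hA; exact: mem_index_enum.
elim: s => [|i s /= [mA PA hA]]; first by rewrite /= !big_nil measure0.
rewrite /= !big_cons; split; first exact: measurableU.
  by apply: (le_trans (measureU2 P (mN i) mA)); exact: leeD2l.
by move=> w k; rewrite in_cons => /orP[/eqP ->|ks] Nw; [left|right; exact: hA Nw].
Qed.

Lemma measurable_floor_eq (R : realType) (theta : R) (z : int) : 0 < theta ->
  measurable [set x : R | Num.floor (x / theta) = z].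
Proof.
move=> t0; rewrite [X in measurable X](_ : _ = `[z%:~R * theta, (z + 1)%:~R * theta[%classic).
  exact: measurable_itv.
apply/seteqP; split => x /=; rewrite in_itv/= -ler_pdivlMr// -ltr_pdivrMr//.
  by move=> <-; exact: floor_itv.
by move=> h; apply/eqP; rewrite floor_eq.
Qed.

Lemma floor_eq_dist (R : realType) (theta x y : R) : 0 < theta ->
  Num.floor (x / theta) = Num.floor (y / theta) -> `|x - y| <= theta.
Proof.
move=> t0 xy; have := floor_itv (x / theta); have := floor_itv (y / theta).
rewrite xy intrD !ler_pdivlMr// !ltr_pdivrMr// mulrDl mul1r.
by move=> /andP[h1 h2] /andP[h3 h4]; rewrite ler_norml; apply/andP; split; lra.
Qed.

(* The vectors other than the i-th are rounded to a fine grid.  Given the cell, the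
   direction u orthogonal to the rounded vectors is deterministic, and the
   component of the i-th vector along u is independent of the cell. *)
Lemma step_small_ball1 (R : realType) disp (T : measurableType disp)
    (P : probability T R) (F : R -> set (set T)) (m p d : nat) (W : R -> T -> 'cV[R]_m)
    (s t : 'I_p -> R) (G : 'I_p -> 'I_d -> 'I_m -> steps R) (mu eta : R) (i : 'I_p) :
  filtration F -> brownian_motion P F W -> (0 < d)%N ->
  (forall i, 0 <= s i) -> (forall i, s i <= t i) ->
  (forall i i' : 'I_p, (i < i')%N -> t i <= s i') ->
  (forall i a j, steps_in (s i) (t i) (G i a j)) -> 0 < mu -> 0 < eta ->
  (forall x : 'I_p -> 'I_d -> R, exists u : 'I_d -> R,
    [/\ \sum_a u a ^+ 2 <= 1, forall i', i' != i -> \sum_a u a * x i' a = 0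
      & (mu%:E <= \sum_j \int[@lebesgue_measure R]_(x in `[s i, t i])
           ((\sum_a u a * step_fun (G i a j) x) ^+ 2)%:E)%E]) ->
  exists N : set T, [/\ measurable N, (P N <= (4 * eta / Num.sqrt mu)%:E)%E &
    forall w, ~ N w -> forall c : 'I_p -> R, c i = 1 -> (forall j, `|c j| <= 1) ->
      eta ^+ 2 <= \sum_a (\sum_j c j * wiener_sum W (G j a) w) ^+ 2].
Proof.
move=> fF bW d0 s0 st ts hG mu0 eta0 hu.
pose X w (k : 'I_p * 'I_d) := wiener_sum W (G k.1 k.2) w.
have p0 : (0 < p)%N by exact: leq_ltn_trans (ltn_ord i).
(* Along u, rounding changes each other vector by at most d theta, hence all of them together by at
   most p d theta = eta. *)
pose theta := eta / (p * d)%:R.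
have theta0 : 0 < theta by rewrite divr_gt0// ltr0n muln_gt0 p0.
(* The label of the cell. The constant 0 at index i keeps it free of information on the i-th
   vector. *)
pose Z w : {ffun 'I_p * 'I_d -> int} :=
  [ffun k => if k.1 == i then 0 else Num.floor (X w k / theta)].
pose C n := [set w | pickle (Z w) = n].
have mX k : measurable_fun setT (X^~ k).
  apply: (filtration_sub_measurable fF (le_trans (s0 k.1) (st k.1))).
  exact: (wiener_sum_measurable fF bW (s0 _) (st _) (hG k.1 k.2)).
have claim n : exists H : set T, [/\ measurable (C n), measurable H,
   (P (C n `&` H) <= (4 * eta / Num.sqrt mu)%:E * P (C n))%E &
    forall w, C n w -> ~ H w -> forall c : 'I_p -> R, c i = 1 -> (forall j, `|c j| <= 1) ->
      eta ^+ 2 <= \sum_a (\sum_j c j * X w (j, a)) ^+ 2].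
  have [[w0 Cw0]|nC] := pselect (exists w, C n w); last first.
    have C0 : C n = set0 by apply/seteqP; split => // w Cw; apply: nC; exists w.
    by exists set0; rewrite C0 setI0 measure0 mule0; split.
  (* Orthogonality is imposed at one sample point w0 of the cell only, which makes u the same on the
     entire cell. *)
  have [u [u1 ux uV]] := hu (fun i' a => X w0 (i', a)).
  pose Y w := \sum_a u a * X w (i, a).
  (* Of the threshold 2 eta, one eta bounds the combination where the conclusion fails and the other
     bounds the rounding errors of the remaining vectors. *)
  pose H := [set w | `|Y w| < 2 * eta].
  pose Gu j := step_scale u ((G i)^~ j).
  have hGu j : steps_in (s i) (t i) (Gu j) by apply: steps_in_scale => a; exact: hG.
  have YE : Y = wiener_sum W Gu by apply/funext => w; rewrite wiener_sum_scale.
  have mY' : measurable_fun setT (Y : g_sigma_algebraType (F (t i)) -> R).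
    by rewrite YE; exact: (wiener_sum_measurable fF bW (s0 _) (st _) hGu).
  have mY : measurable_fun setT Y.
    exact: (filtration_sub_measurable fF (le_trans (s0 i) (st i)) mY').
  have mH : measurable H by apply: measurable_lt_set => //; exact: measurableT_comp.
  (* The cell and an event on the i-th vector are written with one event per time interval, as
     [indep_blocks] requires. *)
  pose A (B : set T) (i' : 'I_p) : set T := if i' == i then B else
    [set w | forall a, Num.floor (X w (i', a) / theta) = Z w0 (i', a)].
  have CE (B : set T) : C n `&` B = [set w | forall i', A B i' w].
    apply/seteqP; split => w.
      move=> [Cw Bw] i'; rewrite /A; case: eqVneq => [//|ii'] a /=.
      have /(pcan_inj pickleK)/ffunP/(_ (i', a)) : pickle (Z w0) = pickle (Z w) by rewrite Cw Cw0.
      by rewrite !ffunE /= (negPf ii').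
    move=> h; split; last by have := h i; rewrite /A eqxx.
    rewrite /C /= -Cw0; congr pickle; apply/ffunP => -[i' a]; rewrite !ffunE/=.
    case: eqVneq => // ii'; have := h i'; rewrite /A (negPf ii') => /(_ a) /= ->.
    by rewrite ffunE /= (negPf ii').
  have floorF i' : i' != i ->
      F (t i') (A setT i') /\ indep_past P F (s i') (A setT i').
    move=> ii'; rewrite /A (negPf ii'); split; last first.
      move=> E FE; apply: (@wiener_sum_indep _ _ _ P F m W 'I_d (G i') (s i') (t i') E
        (fun a => [set x | Num.floor (x / theta) = Z w0 (i', a)])) => // a.
      exact: measurable_floor_eq.
    apply/(measurable_filtrationP _ fF (le_trans (s0 i') (st i'))).
    apply: (@measurable_forall _ (g_sigma_algebraType (F (t i'))) _
      (fun a w => Num.floor (X w (i', a) / theta) = Z w0 (i', a))) => a.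
    rewrite -[X in measurable X]setTI.
    exact: (wiener_sum_measurable fF bW (s0 _) (st _) (hG i' a)) (measurable_floor_eq _ theta0).
  have prodP B : F (t i) B -> indep_past P F (s i) B ->
      P (C n `&` B) = (P B * \prod_(i' | i' != i) P (A setT i'))%E.
    move=> FB iB; rewrite CE (indep_blocks (s := s) (t := t) (A := A B) fF)//.
    - rewrite (bigD1 i)//= {1}/A eqxx; congr (_ * _)%E; apply: eq_bigr => i' ii'.
      by rewrite /A (negPf ii').
    - move=> i'; have [->|ii'] := eqVneq i' i; first by rewrite /A eqxx.
      by have [] := floorF i' ii'; rewrite /A (negPf ii').
    - move=> i'; have [->|ii'] := eqVneq i' i; first by rewrite /A eqxx.
      by have [] := floorF i' ii'; rewrite /A (negPf ii').
  have PC : P (C n) = (\prod_(i' | i' != i) P (A setT i'))%E.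
    rewrite -[C n]setIT prodP ?probability_setT ?mul1e//.
      by apply/(measurable_filtrationP _ fF (le_trans (s0 i) (st i))); exact: measurableT.
    by move=> E FE; rewrite setIT probability_setT mule1.
  have PCH : P (C n `&` H) = (P H * P (C n))%E.
    rewrite prodP -?PC//.
      apply/(measurable_filtrationP _ fF (le_trans (s0 i) (st i))).
      apply: (@measurable_lt_set _ _ (g_sigma_algebraType (F (t i)))) => //.
      exact: measurableT_comp.
    move=> E FE.
    have := @wiener_sum_indep _ _ _ P F m W unit (fun=> Gu) (s i) (t i) E
      (fun=> [set x | `|x| < 2 * eta]) fF bW (s0 i) (st i) (fun=> hGu) FE.
    rewrite /= => /(_ _).
    have -> : [set w | unit -> `|wiener_sum W Gu w| < 2 * eta] = H.
      by rewrite /H YE; apply/seteqP; split => w /= h; [exact: h tt|].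
    by apply => _; apply: measurable_lt_set => //.
  have mC : measurable (C n).
    rewrite -[C n]setIT CE; apply: measurable_forall => i'; rewrite /A.
    case: eqP => // _; apply: (@measurable_forall _ _ _
      (fun a w => Num.floor (X w (i', a) / theta) = Z w0 (i', a))) => a.
    rewrite -[X in measurable X]setTI.
    exact: mX (measurable_floor_eq _ theta0).
  exists H; split => //.
    rewrite PCH lee_wpmul2r//.
    have [v [v0 gv vE]] := wiener_sum_gaussian fF bW (s0 i) (st i) hGu.
    have muv : mu <= v.
      rewrite -lee_fin vE (le_trans uV)//; apply: lee_sum => j _.
      apply: le_of_eq; apply: eq_integral => x _.
      by rewrite step_fun_scale.
    have vp : 0 < v := lt_le_trans mu0 muv.
    have e2 : 0 < 2 * eta by rewrite mulr_gt0.
    have hH : (P H <= (2 * (2 * eta) / Num.sqrt v)%:E)%E.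
      by rewrite /H YE; apply: gaussian_var_anti => //; rewrite -YE.
    apply: (le_trans hH).
    rewrite lee_fin mulrA -natrM ler_wpM2l ?mulr_ge0 ?(ltW eta0)//.
    by rewrite lef_pV2 ?posrE ?sqrtr_gt0// ler_wsqrtr.
  move=> w Cw nHw c ci c1; rewrite leNgt; apply/negP => lt; apply: nHw.
  pose U j := \sum_a u a * X w (j, a).
  pose y a := \sum_j c j * X w (j, a).
  have yU : \sum_a u a * y a = \sum_j c j * U j.
    rewrite /y; under eq_bigr do rewrite mulr_sumr.
    rewrite exchange_big; apply: eq_bigr => j _; rewrite mulr_sumr.
    by apply: eq_bigr => a _; rewrite mulrCA.
  have y_lt : `|\sum_a u a * y a| < eta.
    rewrite -(@ltr_pXn2r _ 2)// ?nnegrE ?(ltW eta0)// real_normK ?num_real//.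
    apply: le_lt_trans lt; apply: le_trans (cauchy_schwarz_sum u y) _.
    by rewrite ler_piMl// sumr_ge0// => a _; exact: sqr_ge0.
  have ua a : `|u a| <= 1.
    rewrite -(@ler_pXn2r _ 2)// ?nnegrE// real_normK ?num_real// expr1n.
    apply: le_trans u1; rewrite (bigD1 a)//= lerDl sumr_ge0// => b _; exact: sqr_ge0.
  have Uj j : j != i -> `|U j| <= d%:R * theta.
    move=> ji; have -> : U j = \sum_a u a * (X w (j, a) - X w0 (j, a)).
      under [RHS]eq_bigr do rewrite mulrBr.
      by rewrite sumrB (ux j ji) subr0.
    apply: le_trans (ler_norm_sum _ _ _) _.
    rewrite -[d in d%:R]card_ord mulr_natl -sumr_const; apply: ler_sum => a _.
    rewrite normrM -[leRHS]mul1r ler_pM//; apply: floor_eq_dist => //.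
    have /(pcan_inj pickleK)/ffunP/(_ (j, a)) : pickle (Z w) = pickle (Z w0) by rewrite Cw Cw0.
    by rewrite !ffunE /= (negPf ji).
  change (is_true (`|Y w| < 2 * eta)).
  have -> : Y w = \sum_a u a * y a - \sum_(j | j != i) c j * U j.
    by rewrite yU (bigD1 i)//= ci mul1r addrK.
  apply: (le_lt_trans (ler_normB _ _)).
  rewrite mulr_natl mulr2n; apply: ltr_leD => //.
  apply: le_trans (ler_norm_sum _ _ _) _.
  apply: (@le_trans _ _ (\sum_(j < p) d%:R * theta)).
    rewrite big_mkcond; apply: ler_sum => j _; case: ifP => ji; last first.
      by rewrite mulr_ge0// ltW.
    by rewrite normrM -[leRHS]mul1r ler_pM// Uj.
  rewrite sumr_const card_ord -[X in X <= _]mulr_natl mulrA -natrM /theta mulrCA divff ?mulr1//.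
  by rewrite pnatr_eq0 -lt0n muln_gt0 p0.
have [H hH] := choice claim.
have mC n : measurable (C n) by have [] := hH n.
have mH n : measurable (H n) by have [] := hH n.
(* The bound on each cell is proportional to the probability of the cell, and the cells are
   disjoint, so summation loses nothing. *)
exists (\bigcup_n (C n `&` H n)); split.
- by apply: bigcupT_measurable => n; exact: measurableI.
- apply: le_trans (measure_sigma_subadditive P (fun n => measurableI _ _ (mC n) (mH n))
    (bigcupT_measurable _ (fun n => measurableI _ _ (mC n) (mH n))) (@subset_refl _ _)) _.
  have de : 0 <= 4 * eta / Num.sqrt mu.
    by rewrite divr_ge0 ?sqrtr_ge0// mulr_ge0// ltW.
  apply: (@le_trans _ _ (\sum_(0 <= n <oo) ((4 * eta / Num.sqrt mu)%:E * P (C n)))%E).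
    by apply: lee_nneseries => // n _; have [] := hH n.
  rewrite nneseriesZl//.
  have -> : (\sum_(0 <= n <oo) P (C n) = P (\bigcup_n C n))%E.
    rewrite (measure_bigcup P setT)//; first by apply: eq_eseriesl => n; rewrite in_setT.
    by apply/trivIsetP => n1 n2 _ _ n12; apply/seteqP; split => // w [h1 h2];
      move: n12; rewrite -h1 -h2 eqxx.
  rewrite -[leRHS]mule1 lee_wpmul2l// probability_le1//.
  exact: bigcupT_measurable.
- move=> w nw; have [_ _ _ h] := hH (pickle (Z w)).
  by apply: h => // Hw; apply: nw; exists (pickle (Z w)).
Qed.

Lemma step_small_ball (R : realType) disp (T : measurableType disp)
    (P : probability T R) (F : R -> set (set T)) (m p d : nat) (W : R -> T -> 'cV[R]_m)
    (s t : 'I_p -> R) (G : 'I_p -> 'I_d -> 'I_m -> steps R) (mu eta : R) :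
  filtration F -> brownian_motion P F W -> (0 < d)%N ->
  (forall i, 0 <= s i) -> (forall i, s i <= t i) ->
  (forall i i' : 'I_p, (i < i')%N -> t i <= s i') ->
  (forall i a j, steps_in (s i) (t i) (G i a j)) -> 0 < mu -> 0 < eta ->
  (forall i (x : 'I_p -> 'I_d -> R), exists u : 'I_d -> R,
    [/\ \sum_a u a ^+ 2 <= 1, forall i', i' != i -> \sum_a u a * x i' a = 0
      & (mu%:E <= \sum_j \int[@lebesgue_measure R]_(x in `[s i, t i])
           ((\sum_a u a * step_fun (G i a j) x) ^+ 2)%:E)%E]) ->
  exists N : set T, [/\ measurable N, (P N <= (p%:R * (4 * eta / Num.sqrt mu))%:E)%E &
    forall w, ~ N w -> sep eta (fun i => \col_a wiener_sum W (G i a) w)].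
Proof.
move=> fF bW d0 s0 st ts hG mu0 eta0 hu.
have /choice[N hN] := fun i => step_small_ball1 fF bW d0 s0 st ts hG mu0 eta0 (hu i).
have mN i : measurable (N i) by have [] := hN i.
exists [set w | exists i, N i w]; split.
- exact: measurable_exists.
- apply: (le_trans (measure_exists_le P mN)).
  apply: (@le_trans _ _ (\sum_(i < p) (4 * eta / Num.sqrt mu)%:E)%E).
    by apply: lee_sum => i _; have [] := hN i.
  by rewrite sumEFin sumr_const card_ord lee_fin [X in _ <= X]mulr_natl.
- move=> w nNw c i ci c1; have [_ _ h] := hN i.
  have := h w _ c ci c1; rewrite (_ : \sum_a _ =
    \sum_a (\sum_j c j *: \col_a0 wiener_sum W (G j a0) w) a 0 ^+ 2).
    by apply => Nw; apply: nNw; exists i.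
  apply: eq_bigr => a _; rewrite summxE; congr (_ ^+ 2); apply: eq_bigr => j _.
  by rewrite !mxE.
Qed.

(** * General deterministic integrands *)

Lemma cvge0_eventually (R : realType) (u : nat -> \bar R) (e : R) :
  u @ \oo --> 0%E -> 0 < e -> \forall k \near \oo, (u k <= e%:E)%E.
Proof.
move=> u0 e0.
have h : ereal_nbhs (0%E : \bar R) (fun x : \bar R => (x < e%:E)%E) by apply: open_ereal_lt'.
have : \forall k \near \oo, (u k < e%:E)%E := u0 _ h.
by apply: filterS => k /ltW.
Qed.

Lemma integral_sqrB_le (R : realType) disp (T : measurableType disp)
    (mu : measure T R) (D : set T) (f1 f2 f3 : T -> R) : measurable D ->
  measurable_fun D f1 -> measurable_fun D f2 -> measurable_fun D f3 ->
  (\int[mu]_(x in D) ((f1 x - f2 x) ^+ 2)%:E <=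
   2%:E * \int[mu]_(x in D) ((f1 x - f3 x) ^+ 2)%:E +
   2%:E * \int[mu]_(x in D) ((f2 x - f3 x) ^+ 2)%:E)%E.
Proof.
move=> mD m1 m2 m3.
have msq (g h : T -> R) : measurable_fun D g -> measurable_fun D h ->
    measurable_fun D (fun x => ((g x - h x) ^+ 2)%:E).
  by move=> mg mh; apply/measurable_EFinP; apply: measurable_funX; exact: measurable_funB.
have sq0 (g h : T -> R) x : (0 <= ((g x - h x) ^+ 2)%:E)%E by rewrite lee_fin sqr_ge0.
rewrite -!ge0_integralZl_EFin//; [|exact: msq|exact: msq].
have m13 := measurable_funeM 2%:E (msq _ _ m1 m3).
have m23 := measurable_funeM 2%:E (msq _ _ m2 m3).
rewrite -ge0_integralD//; last 2 first.
- by move=> x _; rewrite mule_ge0.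
- by move=> x _; rewrite mule_ge0.
apply: ge0_le_integral => //.
- exact: msq.
- exact: emeasurable_funD.
- move=> x _; rewrite -!EFinM -EFinD lee_fin.
  rewrite -subr_ge0 (_ : _ - _ = (f1 x + f2 x - 2 * f3 x) ^+ 2) ?sqr_ge0//; ring.
Qed.

Lemma chebyshev_sqr (R : realType) disp (T : measurableType disp)
    (P : measure T R) (Z : T -> R) (e eta : R) : measurable_fun setT Z -> 0 < eta ->
  (\int[P]_w ((Z w) ^+ 2)%:E <= e%:E)%E ->
  (P [set w | eta <= `|Z w|]%R <= (e / eta ^+ 2)%:E)%E.
Proof.
move=> mZ eta0 le; set A := [set w | _].
have mA : measurable A by apply: measurable_le_set => //; exact: measurableT_comp.
have e2 : 0 < eta ^+ 2 by rewrite exprn_gt0.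
rewrite EFinM lee_pdivlMr//.
apply: le_trans le; rewrite muleC -integral_cst//.
have mZ2 : measurable_fun setT (fun w => ((Z w) ^+ 2)%:E).
  by apply/measurable_EFinP; exact: measurable_funX.
apply: (@le_trans _ _ (\int[P]_(w in A) ((Z w) ^+ 2)%:E)%E); last first.
  by apply: ge0_subset_integral => // w _; rewrite lee_fin sqr_ge0.
apply: ge0_le_integral => //.
- by move=> w _; rewrite lee_fin ltW.
- exact: measurable_funTS.
- move=> w Aw; rewrite lee_fin -[leRHS]real_normK ?num_real//.
  by rewrite lerXn2r ?nnegrE ?(ltW eta0).
Qed.

Lemma measurable_step_fun (R : realType) (g : steps R) :
  measurable_fun setT (step_fun g : R -> R).
Proof.
have -> : step_fun g = (fun x => \sum_(q <- g | xpredT q) q.2 * \1_(`]q.1.1, q.1.2]%classic) x).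
  by [].
apply: measurable_combination => q _; apply: measurable_indic; exact: measurable_itv.
Qed.

(** Endpoints are clamped, so a step lying wholly before s becomes an empty interval and contributes
    nothing. *)
Definition step_above (R : realType) (s : R) (g : steps R) : steps R :=
  [seq (Num.max q.1.1 s, Num.max q.1.2 s, q.2) | q <- g].

Definition step_below (R : realType) (s : R) (g : steps R) : steps R :=
  [seq (Num.min q.1.1 s, Num.min q.1.2 s, q.2) | q <- g].

Definition step_opp (R : realType) (g : steps R) : steps R :=
  [seq (q.1, - q.2) | q <- g].

Lemma step_int_cat (R : realType) (T : Type) (B : R -> T -> R) g h w :
  step_int B (g ++ h) w = step_int B g w + step_int B h w.
Proof. exact: big_cat. Qed.

Lemma step_fun_cat (R : realType) (g h : steps R) x :
  step_fun (g ++ h) x = step_fun g x + step_fun h x.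
Proof. exact: big_cat. Qed.

Lemma step_int_opp (R : realType) (T : Type) (B : R -> T -> R) g w :
  step_int B (step_opp g) w = - step_int B g w.
Proof. by rewrite /step_int big_map -sumrN; apply: eq_bigr => q _; rewrite mulNr. Qed.

Lemma step_fun_opp (R : realType) (g : steps R) x :
  step_fun (step_opp g) x = - step_fun g x.
Proof. by rewrite /step_fun big_map -sumrN; apply: eq_bigr => q _; rewrite mulNr. Qed.

Lemma step_int_split (R : realType) (T : Type) (B : R -> T -> R) (s : R) g w :
  step_int B g w = step_int B (step_above s g) w + step_int B (step_below s g) w.
Proof.
rewrite /step_int !big_map -big_split; apply: eq_bigr => q _ /=.
by rewrite -mulrDr; congr (_ * _); case: (leP q.1.2 s) => h1; case: (leP q.1.1 s) => h2;
  rewrite ?subrr ?addr0 ?add0r//; ring.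
Qed.

Lemma step_fun_above (R : realType) (s x : R) (g : steps R) : s < x ->
  (forall q, q \in g -> q.1.1 <= q.1.2) -> step_fun (step_above s g) x = step_fun g x.
Proof.
move=> sx hg; rewrite /step_fun big_map; apply: eq_big_seq => q /hg q12 /=.
congr (_ * _); rewrite !indic_itvoc ?le_max2//; by rewrite !le_max !(leNgt x s) sx !orbF.
Qed.

Lemma step_fun_below (R : realType) (s x : R) (g : steps R) : x <= s ->
  (forall q, q \in g -> q.1.1 <= q.1.2) -> step_fun (step_below s g) x = step_fun g x.
Proof.
move=> xs hg; rewrite /step_fun big_map; apply: eq_big_seq => q /hg q12 /=.
congr (_ * _); rewrite !indic_itvoc//; first by rewrite !le_min xs !andbT.
by rewrite le_min !ge_min q12 lexx orbT.
Qed.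

Lemma step_fun_left (R : realType) (s t x : R) (g : steps R) : x <= s ->
  steps_in s t g -> step_fun g x = 0.
Proof.
move=> xs hg; rewrite /step_fun big1_seq// => q /= /hg[q1 q12 _].
by rewrite indic_itvoc// (le_trans xs q1) (le_trans (le_trans xs q1) q12) subrr mulr0.
Qed.

Lemma step_fun_right (R : realType) (s t x : R) (g : steps R) : t < x ->
  steps_in s t g -> step_fun g x = 0.
Proof.
move=> tx hg; rewrite /step_fun big1_seq// => q /= /hg[q1 q12 q2].
rewrite indic_itvoc// !leNgt (le_lt_trans q2 tx) (le_lt_trans (le_trans q12 q2) tx).
by rewrite subrr mulr0.
Qed.

Lemma steps_in_above (R : realType) (r s t : R) (g : steps R) : s <= t ->
  steps_in r t g -> steps_in s t (step_above s g).
Proof.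
move=> st hg q /mapP[q' /hg[q1 q12 q2] ->] /=; split.
- by rewrite le_max lexx orbT.
- by rewrite ge_max !le_max q12 lexx orbT.
- by rewrite ge_max q2 st.
Qed.

Lemma steps_in_below (R : realType) (r s t : R) (g : steps R) : r <= s ->
  steps_in r t g -> steps_in r s (step_below s g).
Proof.
move=> rs hg q /mapP[q' /hg[q1 q12 q2] ->] /=; split.
- by rewrite le_min q1 rs.
- by rewrite le_min !ge_min q12 lexx orbT.
- by rewrite ge_min lexx orbT.
Qed.

Lemma steps_in_opp (R : realType) (s t : R) (g : steps R) :
  steps_in s t g -> steps_in s t (step_opp g).
Proof. by move=> hg q /mapP[q' /hg h ->]. Qed.

Lemma steps_in_cat (R : realType) (s t : R) (g h : steps R) :
  steps_in s t g -> steps_in s t h -> steps_in s t (g ++ h).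
Proof. by move=> hg hh q; rewrite mem_cat => /orP[/hg|/hh]. Qed.

Lemma steps_inW (R : realType) (s t s' t' : R) (g : steps R) : s' <= s -> t <= t' ->
  steps_in s t g -> steps_in s' t' g.
Proof.
by move=> ss tt hg q /hg[h1 h2 h3]; split => //; [exact: le_trans h1|exact: le_trans tt].
Qed.

Lemma step_int_component (R : realType) (T : Type) (m : nat) (W : R -> T -> 'cV[R]_m)
    (j : 'I_m) (g : steps R) w :
  step_int (fun t w => W t w j 0) g w = wiener_sum W (fun i => if i == j then g else [::]) w.
Proof.
rewrite /wiener_sum (bigD1 j)//= eqxx big1 ?addr0// => i ij.
by rewrite (negPf ij) /step_int big_nil.
Qed.

Lemma step_int_tail (R : realType) disp (T : measurableType disp)
    (P : probability T R) (F : R -> set (set T)) (m : nat) (W : R -> T -> 'cV[R]_m)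
    (j : 'I_m) (g : steps R) (s t e eta : R) :
  filtration F -> brownian_motion P F W -> 0 <= s -> s <= t -> steps_in s t g ->
  0 < eta ->
  (\int[@lebesgue_measure R]_(x in `[s, t]) (step_fun g x ^+ 2)%:E <= e%:E)%E ->
  measurable_fun setT (step_int (fun t w => W t w j 0) g) /\
  (P [set w | eta <= `|step_int (fun t w => W t w j 0) g w|]%R <= (4 * e / eta ^+ 2)%:E)%E.
Proof.
move=> fF bW s0 st hg eta0 he; pose G i := if i == j then g else [::].
have hG i : steps_in s t (G i) by rewrite /G; case: ifP.
have -> : step_int (fun t w => W t w j 0) g = wiener_sum W G.
  by apply/funext => w; exact: step_int_component.
have mG : measurable_fun setT (wiener_sum W G).
  apply: (filtration_sub_measurable fF (le_trans s0 st)).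
  exact: (wiener_sum_measurable fF bW s0 st hG).
split => //; have [v [v0 gv vE]] := wiener_sum_gaussian fF bW s0 st hG.
apply: (le_trans (gaussian_var_tail mG gv v0 eta0)); rewrite lee_fin.
rewrite ler_wpM2r ?invr_ge0 ?sqr_ge0// ler_wpM2l// -lee_fin (le_trans _ he)// vE.
rewrite (bigD1 j)//= big1 ?adde0; first by rewrite /G eqxx.
move=> i ij; rewrite /G (negPf ij); apply: integral0_eq => x _.
by rewrite /step_fun big_nil expr0n.
Qed.

Lemma step_int_measurable (R : realType) disp (T : measurableType disp)
    (P : probability T R) (F : R -> set (set T)) (m : nat) (W : R -> T -> 'cV[R]_m)
    (j : 'I_m) (g : steps R) (s t : R) :
  filtration F -> brownian_motion P F W -> 0 <= s -> s <= t -> steps_in s t g ->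
  measurable_fun setT (step_int (fun t w => W t w j 0) g).
Proof.
move=> fF bW s0 st hg; pose G i := if i == j then g else [::].
have hG i : steps_in s t (G i) by rewrite /G; case: ifP.
have -> : step_int (fun t w => W t w j 0) g = wiener_sum W G.
  by apply/funext => w; exact: step_int_component.
apply: (filtration_sub_measurable fF (le_trans s0 st)).
exact: (wiener_sum_measurable fF bW s0 st hG).
Qed.

(** The approximating sequences for the integrals up to s and up to t are unrelated, so their
    difference need not be carried by [s, t]. The step function for t is therefore cut at s. Its
    part before s and the step function for s both approximate f on [0, s], hence their difference
    [l] has small energy and, by the Gaussian tail bound, a small integral. *)
Lemma wiener_incr_approx (R : realType) disp (T : measurableType disp)
    (P : probability T R) (F : R -> set (set T)) (m : nat) (W : R -> T -> 'cV[R]_m)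
    (j : 'I_m) (f : R -> R) (s t e eta : R) (Ys Yt : T -> R) :
  filtration F -> brownian_motion P F W -> 0 <= s -> s <= t ->
  measurable_fun `[0, t]%classic f -> 0 < e -> 0 < eta ->
  is_wiener_int P (fun s w => W s w j 0) f s Ys ->
  is_wiener_int P (fun s w => W s w j 0) f t Yt ->
  exists (g : steps R) (N : set T),
  [/\ steps_in s t g,
      (\int[@lebesgue_measure R]_(x in `]s, t]) ((step_fun g x - f x) ^+ 2)%:E <= e%:E)%E,
      measurable N, (P N <= e%:E)%E &
      forall w, ~ N w -> `|step_int (fun s w => W s w j 0) g w - (Yt w - Ys w)| < eta].
Proof.
move=> fF bW s0 st mf e0 eta0 [mYs [gs [hs ls1 ls2]]] [mYt [gt [ht lt1 lt2]]].
pose B (s : R) w := W s w j 0.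
pose eta3 := eta / 3; have eta30 : 0 < eta3 by rewrite divr_gt0.
(* Three events are discarded: two approximation errors, each of probability at most e1 / eta3^2,
   and a large integral of [l], whose energy is at most 4 e1 and whose tail bound is 16 e1 / eta3^2.
   The sum is 18 e1 / eta3^2. *)
pose e1 := Num.min e (e * eta3 ^+ 2 / 18).
have e10 : 0 < e1 by rewrite lt_min e0 divr_gt0// mulr_gt0// exprn_gt0.
near \oo => k.
have hsk : (\int[@lebesgue_measure R]_(x in `[0%R, s])
      ((step_fun (gs k) x - f x) ^+ 2)%:E <= e1%:E)%E.
  by near: k; exact: cvge0_eventually.
have htk : (\int[@lebesgue_measure R]_(x in `[0%R, t])
      ((step_fun (gt k) x - f x) ^+ 2)%:E <= e1%:E)%E.
  by near: k; exact: cvge0_eventually.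
have Psk : (\int[P]_w ((step_int B (gs k) w - Ys w) ^+ 2)%:E <= e1%:E)%E.
  by near: k; exact: cvge0_eventually.
have Ptk : (\int[P]_w ((step_int B (gt k) w - Yt w) ^+ 2)%:E <= e1%:E)%E.
  by near: k; exact: cvge0_eventually.
have t0 : 0 <= t := le_trans s0 st.
have hgs : steps_in 0 s (gs k) by move=> q; exact: hs.
have hgt : steps_in 0 t (gt k) by move=> q; exact: ht.
have ogt q : q \in gt k -> q.1.1 <= q.1.2 by move=> /hgt[].
pose g := step_above s (gt k).
pose l := gs k ++ step_opp (step_below s (gt k)).
have hl : steps_in 0 s l.
  by apply: steps_in_cat => //; apply: steps_in_opp; apply: (steps_in_below (t := t)).
have mf' : measurable_fun `[0, s]%classic f.
  by apply: measurable_funS mf => // x /=; rewrite !in_itv/= => /andP[-> h]; exact: le_trans st.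
have mstep h D : measurable_fun D (step_fun h : R -> R).
  by apply: measurable_funTS; exact: measurable_step_fun.
have int_l : (\int[@lebesgue_measure R]_(x in `[0%R, s]) (step_fun l x ^+ 2)%:E <= (4 * e1)%:E)%E.
  have -> : (\int[@lebesgue_measure R]_(x in `[0%R, s]) (step_fun l x ^+ 2)%:E =
    \int[@lebesgue_measure R]_(x in `[0%R, s]) ((step_fun (gs k) x - step_fun (gt k) x) ^+ 2)%:E)%E.
    apply: eq_integral => x /[!inE]/= /[!in_itv]/= /andP[x0 xs].
    by rewrite step_fun_cat step_fun_opp step_fun_below.
  have := integral_sqrB_le lebesgue_measure (measurable_itv `[0%R, s])
    (mstep (gs k) _) (mstep (gt k) _) mf'.
  move=> /le_trans; apply.
  have -> : (4 * e1)%:E = (2%:E * e1%:E + 2%:E * e1%:E)%E.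
    by rewrite -!EFinM -EFinD; congr (_%:E); ring.
  apply: leeD; apply: lee_wpmul2l => //.
  apply: le_trans htk; apply: ge0_subset_integral => //.
  - apply/measurable_EFinP; apply: measurable_funX; apply: measurable_funB => //; exact: mstep.
  - by move=> x _; rewrite lee_fin sqr_ge0.
  - by move=> x /=; rewrite !in_itv/= => /andP[-> h]; exact: le_trans st.
have [ml Pl] := step_int_tail j fF bW (lexx 0) s0 hl eta30 int_l.
have mgs := step_int_measurable j fF bW (lexx 0) s0 hgs.
have mgt := step_int_measurable j fF bW (lexx 0) t0 hgt.
pose N1 := [set w | eta3 <= `|step_int B (gt k) w - Yt w|].
pose N2 := [set w | eta3 <= `|step_int B (gs k) w - Ys w|].
pose N3 := [set w | eta3 <= `|step_int B l w|].
have P1 := chebyshev_sqr (measurable_funB mgt mYt) eta30 Ptk.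
have P2 := chebyshev_sqr (measurable_funB mgs mYs) eta30 Psk.
have mN1 : measurable N1.
  by apply: measurable_le_set => //; apply: measurableT_comp => //; exact: measurable_funB.
have mN2 : measurable N2.
  by apply: measurable_le_set => //; apply: measurableT_comp => //; exact: measurable_funB.
have mN3 : measurable N3 by apply: measurable_le_set => //; apply: measurableT_comp.
exists g, (N1 `|` N2 `|` N3); split.
- exact: (steps_in_above (r := 0)).
- have -> : (\int[@lebesgue_measure R]_(x in `]s, t]) ((step_fun g x - f x) ^+ 2)%:E =
    \int[@lebesgue_measure R]_(x in `]s, t]) ((step_fun (gt k) x - f x) ^+ 2)%:E)%E.
    apply: eq_integral => x /[!inE]/= /[!in_itv]/= /andP[sx xt].
    by rewrite step_fun_above.
  apply: (@le_trans _ _ e1%:E); last by rewrite lee_fin ge_min lexx.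
  apply: le_trans htk; apply: ge0_subset_integral => //.
  - apply/measurable_EFinP; apply: measurable_funX; apply: measurable_funB => //; exact: mstep.
  - by move=> x _; rewrite lee_fin sqr_ge0.
  - by move=> x /=; rewrite !in_itv/= => /andP[/ltW h ->]; rewrite (le_trans s0 h).
- by apply: measurableU => //; exact: measurableU.
- apply: (le_trans (measureU2 P (measurableU _ _ mN1 mN2) mN3)).
  apply: (@le_trans _ _ ((e1 / eta3 ^+ 2)%:E + (e1 / eta3 ^+ 2)%:E +
    (4 * (4 * e1) / eta3 ^+ 2)%:E)%E).
    apply: leeD => //; apply: (le_trans (measureU2 P mN1 mN2)); exact: leeD.
  rewrite -!EFinD lee_fin (_ : _ + _ = 18 * e1 / eta3 ^+ 2); last by field; rewrite gt_eqF.
  rewrite ler_pdivrMr ?exprn_gt0// mulrC -ler_pdivlMr//.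
  by rewrite ge_min lexx orbT.
- move=> w nN; have n1 : `|step_int B (gt k) w - Yt w| < eta3.
    by rewrite ltNge; apply/negP => h; apply: nN; left; left.
  have n2 : `|step_int B (gs k) w - Ys w| < eta3.
    by rewrite ltNge; apply/negP => h; apply: nN; left; right.
  have n3 : `|step_int B l w| < eta3 by rewrite ltNge; apply/negP => h; apply: nN; right.
  have E1 : step_int B l w = step_int B (gs k) w - step_int B (step_below s (gt k)) w.
    by rewrite step_int_cat step_int_opp.
  have E2 := step_int_split B s (gt k) w.
  have -> : step_int B g w - (Yt w - Ys w) =
    (step_int B (gt k) w - Yt w) - (step_int B (gs k) w - Ys w) + step_int B l w.
    by rewrite E1 E2 /g; ring.
  have e3 : eta = eta3 + eta3 + eta3 by rewrite /eta3; field.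
  rewrite e3; apply: (le_lt_trans (ler_normD _ _)); apply: ltrD => //.
  by apply: (le_lt_trans (ler_normB _ _)); exact: ltrD.
Unshelve. all: by end_near.
Qed.

Lemma itvoc_splitU (R : realType) (a b c : R) : a <= b -> b <= c ->
  `]a, c]%classic = `]a, b]%classic `|` `]b, c]%classic.
Proof.
move=> ab bc; apply/seteqP; split => x /=; rewrite !in_itv/=.
  move=> /andP[ax xc]; have [xb|bx] := leP x b; [left|right]; first by rewrite ax.
  by rewrite xc.
by move=> [|] /andP[h1 h2]; [rewrite h1 (le_trans h2)|rewrite h2 (le_lt_trans ab)].
Qed.

(* The second difference of the integral process is the integral of f with its sign
   reversed on [t0, t1]. *)
Lemma wiener_pair_approx (R : realType) disp (T : measurableType disp)
    (P : probability T R) (F : R -> set (set T)) (m : nat) (W : R -> T -> 'cV[R]_m)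
    (j : 'I_m) (f : R -> R) (t0 t1 t2 e eta : R) (Y0 Y1 Y2 : T -> R) :
  filtration F -> brownian_motion P F W -> 0 <= t0 -> t0 <= t1 -> t1 <= t2 ->
  measurable_fun `[0, t2]%classic f -> 0 < e -> 0 < eta ->
  is_wiener_int P (fun s w => W s w j 0) f t0 Y0 ->
  is_wiener_int P (fun s w => W s w j 0) f t1 Y1 ->
  is_wiener_int P (fun s w => W s w j 0) f t2 Y2 ->
  exists (g : steps R) (N : set T),
  [/\ steps_in t0 t2 g,
      (\int[@lebesgue_measure R]_(x in `[t0, t2])
         ((step_fun g x - (if x <= t1 then - f x else f x)%R) ^+ 2)%:E <= e%:E)%E,
      measurable N, (P N <= e%:E)%E &
      forall w, ~ N w -> `|step_int (fun s w => W s w j 0) g w -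
        ((Y2 w - Y1 w) - (Y1 w - Y0 w))| < eta].
Proof.
move=> fF bW p0 t01 t12 mf e0 eta0 w0 w1 w2.
have e20 : 0 < e / 2 by rewrite divr_gt0.
have eta20 : 0 < eta / 2 by rewrite divr_gt0.
have mf1 : measurable_fun `[0, t1]%classic f.
  by apply: measurable_funS mf => // x /=; rewrite !in_itv/= => /andP[-> h]; exact: le_trans t12.
have [g1 [N1 [sg1 ig1 mN1 PN1 hN1]]] := wiener_incr_approx fF bW p0 t01 mf1 e20 eta20 w0 w1.
have [g2 [N2 [sg2 ig2 mN2 PN2 hN2]]] :=
  wiener_incr_approx fF bW (le_trans p0 t01) t12 mf e20 eta20 w1 w2.
have E12 : e = e / 2 + e / 2 by field.
exists (g2 ++ step_opp g1), (N1 `|` N2); split.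
- apply: steps_in_cat; first exact: steps_inW sg2.
  by apply: steps_in_opp; exact: steps_inW sg1.
- pose H x := ((step_fun (g2 ++ step_opp g1) x - (if x <= t1 then - f x else f x)) ^+ 2)%:E.
  have H1 x : x \in (`]t0, t1]%classic : set R) -> H x = ((step_fun g1 x - f x) ^+ 2)%:E.
    rewrite inE/= in_itv/= => /andP[_ xt1].
    rewrite /H xt1 step_fun_cat step_fun_opp (step_fun_left xt1 sg2) add0r opprK.
    by rewrite addrC -sqrrN opprB.
  have H2 x : x \in (`]t1, t2]%classic : set R) -> H x = ((step_fun g2 x - f x) ^+ 2)%:E.
    rewrite inE/= in_itv/= => /andP[xt1 _].
    by rewrite /H (leNgt x) xt1 step_fun_cat step_fun_opp (step_fun_right xt1 sg1) subr0.
  have mH1 : measurable_fun `]t0, t1]%classic H.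
    apply: (eq_measurable_fun (fun x => ((step_fun g1 x - f x) ^+ 2)%:E)).
      by move=> x /H1 ->.
    apply/measurable_EFinP; apply: measurable_funX; apply: measurable_funB.
      by apply: measurable_funTS; exact: measurable_step_fun.
    apply: measurable_funS mf => // x /=; rewrite !in_itv/= => /andP[h1 h2].
    by rewrite (le_trans p0 (ltW h1)) (le_trans h2).
  have mH2 : measurable_fun `]t1, t2]%classic H.
    apply: (eq_measurable_fun (fun x => ((step_fun g2 x - f x) ^+ 2)%:E)).
      by move=> x /H2 ->.
    apply/measurable_EFinP; apply: measurable_funX; apply: measurable_funB.
      by apply: measurable_funTS; exact: measurable_step_fun.
    apply: measurable_funS mf => // x /=; rewrite !in_itv/= => /andP[h1 ->].
    by rewrite (le_trans p0 (le_trans t01 (ltW h1))).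
  have mH : measurable_fun (`]t0, t1]%classic `|` `]t1, t2]%classic) H.
    by apply/measurable_funU.
  rewrite -/(H _) -[X in (X <= _)%E]/(\int[lebesgue_measure]_(x in `[t0, t2]) H x)%E.
  rewrite -integral_itv_obnd_cbnd ?(itvoc_splitU t01 t12)//.
  rewrite ge0_integral_setU//; last 2 first.
  + by move=> x _; rewrite lee_fin sqr_ge0.
  + apply/disj_setPS => x [] /=; rewrite !in_itv/= => /andP[_ h] /andP[h' _].
    by move: h'; rewrite ltNge h.
  rewrite E12 EFinD; apply: leeD; [apply: le_trans ig1|apply: le_trans ig2];
    by apply: le_of_eq; exact: eq_integral.
- exact: measurableU.
- by apply: (le_trans (measureU2 P mN1 mN2)); rewrite E12 EFinD; exact: leeD.
- move=> w nN; have n1 := hN1 w (fun h => nN (or_introl h)).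
  have n2 := hN2 w (fun h => nN (or_intror h)).
  rewrite step_int_cat step_int_opp.
  set a := step_int _ g1 w in n1 *; set b := step_int _ g2 w in n2 *.
  rewrite (_ : _ - _ = (b - (Y2 w - Y1 w)) - (a - (Y1 w - Y0 w))); last by ring.
  apply: (le_lt_trans (ler_normB _ _)).
  by rewrite [ltRHS](_ : _ = eta / 2 + eta / 2); [exact: ltrD|field].
Qed.

(** This carries an energy lower bound for a combination of the true integrands over to the
    approximating ones, uniformly in u: Cauchy-Schwarz and |u| <= 1 bound the squared error of the
    combination by the sum of the squared errors. *)
Lemma combination_energy_le (R : realType) disp (T : measurableType disp)
    (mu : measure T R) (D : set T) (I : finType) (u : I -> R) (f g : I -> T -> R) (e : R) :
  measurable D -> (forall a, measurable_fun D (f a)) -> (forall a, measurable_fun D (g a)) ->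
  \sum_a u a ^+ 2 <= 1 ->
  (forall a, (\int[mu]_(x in D) ((g a x - f a x) ^+ 2)%:E <= e%:E)%E) ->
  (\int[mu]_(x in D) ((\sum_a u a * f a x) ^+ 2)%:E <=
   2%:E * (\int[mu]_(x in D) ((\sum_a u a * g a x) ^+ 2)%:E) + (2 * (#|I|%:R * e))%:E)%E.
Proof.
move=> mD mf mg u1 hfg.
have mcomb (h : I -> T -> R) : (forall a, measurable_fun D (h a)) ->
    measurable_fun D (fun x => ((\sum_a u a * h a x) ^+ 2)%:E).
  move=> mh; apply/measurable_EFinP; apply: measurable_funX.
  by apply: measurable_sum => a; exact: measurable_funM.
have mdiff a : measurable_fun D (fun x => ((g a x - f a x) ^+ 2)%:E).
  by apply/measurable_EFinP; apply: measurable_funX; exact: measurable_funB.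
have sq0 (y : R) : (0 <= (y ^+ 2)%:E)%E by rewrite lee_fin sqr_ge0.
apply: (@le_trans _ _ (2%:E * (\int[mu]_(x in D) ((\sum_a u a * g a x) ^+ 2)%:E) +
   2%:E * \sum_a \int[mu]_(x in D) ((g a x - f a x) ^+ 2)%:E)%E); last first.
  apply: leeD2l; rewrite EFinM; apply: lee_wpmul2l => //.
  apply: (@le_trans _ _ (\sum_(a : I) e%:E)%E); first exact: lee_sum.
  by rewrite sumEFin sumr_const lee_fin mulr_natl.
rewrite -ge0_integral_sum//.
have mS : measurable_fun D (fun x => \sum_a ((g a x - f a x) ^+ 2)%:E)%E.
  exact: emeasurable_sum.
have S0 x : D x -> (0 <= \sum_a ((g a x - f a x) ^+ 2)%:E)%E by move=> _; exact: sume_ge0.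
rewrite -!ge0_integralZl_EFin//; last exact: mcomb.
rewrite -ge0_integralD//; last 4 first.
- by move=> x _; rewrite mule_ge0.
- by apply: measurable_funeM; exact: mcomb.
- by move=> x Dx; rewrite mule_ge0// S0.
- exact: measurable_funeM.
apply: ge0_le_integral => //.
- exact: mcomb.
- by apply: emeasurable_funD; apply: measurable_funeM => //; exact: mcomb.
- move=> x _; rewrite sumEFin -!EFinM -EFinD lee_fin.
  set A := \sum_a u a * f a x; set S := \sum_a u a * g a x.
  have h : (S - A) ^+ 2 <= \sum_a (g a x - f a x) ^+ 2.
    have -> : S - A = \sum_a u a * (g a x - f a x).
      by rewrite /S /A -sumrB; apply: eq_bigr => a _; rewrite mulrBr.
    apply: (le_trans (cauchy_schwarz_sum _ _)).
    by rewrite ler_piMl// sumr_ge0// => a _; exact: sqr_ge0.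
  apply: (@le_trans _ _ (2 * S ^+ 2 + 2 * (S - A) ^+ 2)); last by rewrite lerD2l ler_wpM2l.
  rewrite -subr_ge0 (_ : _ - _ = (2 * S - A) ^+ 2) ?sqr_ge0//; ring.
Qed.

(** The integrands, with their sign reversed on the first half of each interval, are approximated by
    step functions. The step estimate is applied with energy mu / 4 and separation 2 eta, which
    gives 16 p eta / sqrt(mu), and [sep_perturb] returns to separation eta. The approximation errors
    account for the 17th multiple. *)
Lemma wiener_small_ball (R : realType) disp (T : measurableType disp)
    (P : probability T R) (F : R -> set (set T)) (m p d : nat) (W : R -> T -> 'cV[R]_m)
    (t0 t1 t2 : 'I_p -> R) (sigma : 'I_d -> 'I_m -> R -> R)
    (Y : R -> 'I_d -> 'I_m -> T -> R) (mu eta : R) :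
  filtration F -> brownian_motion P F W -> (0 < d)%N ->
  (forall i, [/\ 0 <= t0 i, t0 i <= t1 i, t1 i <= t2 i & t2 i <= 1]) ->
  (forall i i' : 'I_p, (i < i')%N -> t2 i <= t0 i') ->
  (forall a j, measurable_fun (`[0%R, 1%R]%classic : set (measurableTypeR R)) (sigma a j)) ->
  (forall t a j, 0 <= t <= 1 ->
     is_wiener_int P (fun s w => W s w j 0) (sigma a j) t (Y t a j)) ->
  0 < mu -> 0 < eta ->
  (forall i (x : 'I_p -> 'I_d -> R), exists u : 'I_d -> R,
    [/\ \sum_a u a ^+ 2 <= 1, forall i', i' != i -> \sum_a u a * x i' a = 0
      & (mu%:E <= \sum_j \int[@lebesgue_measure R]_(x in `[t0 i, t2 i])
           ((\sum_a u a * sigma a j x) ^+ 2)%:E)%E]) ->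
  exists N : set T, [/\ measurable N, (P N <= (17 * p%:R * eta / Num.sqrt mu)%:E)%E &
    forall w, ~ N w -> sep eta (fun i => \col_a \sum_j
      ((Y (t2 i) a j w - Y (t1 i) a j w) - (Y (t1 i) a j w - Y (t0 i) a j w)))].
Proof.
move=> fF bW d0 ht tt ms hY mu0 eta0 hu.
have [p0|p0] := posnP p.
  exists set0; rewrite measure0; split => //.
    by rewrite p0 mulr0 !mul0r.
  by move=> w _ c [i hi]; exfalso; rewrite p0 in hi.
(* The number of approximated integrals, plus one so that K is positive even if d or m vanishes. *)
pose K : R := (p * d * m).+1%:R.
have K0 : 0 < K by rewrite ltr0n.
(* The first bound keeps at least mu / 4 of the energy; the second limits the probability of all
   approximation failures together to p eta / sqrt(mu). *)
pose e := Num.min (mu / (4 * K)) (p%:R * eta / Num.sqrt mu / K).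
have e0 : 0 < e.
  rewrite lt_min !divr_gt0 ?mulr_gt0 ?ltr0n ?sqrtr_gt0//.
pose eta' := eta / K.
have eta'0 : 0 < eta' by rewrite divr_gt0.
have dpos i : 0 <= t0 i by have [] := ht i.
have /choice[GN hGN] : forall k : 'I_p * 'I_d * 'I_m, exists gN : steps R * set T,
  let: (i, a, j) := k in
  [/\ steps_in (t0 i) (t2 i) gN.1,
      (\int[@lebesgue_measure R]_(x in `[t0 i, t2 i])
         ((step_fun gN.1 x -
           (if x <= t1 i then - sigma a j x else sigma a j x)%R) ^+ 2)%:E <= e%:E)%E,
      measurable gN.2, (P gN.2 <= e%:E)%E &
      forall w, ~ gN.2 w -> `|step_int (fun s w => W s w j 0) gN.1 w -
        ((Y (t2 i) a j w - Y (t1 i) a j w) - (Y (t1 i) a j w - Y (t0 i) a j w))| < eta'].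
  move=> [[i a] j]; have [h0 h1 h2 h3] := ht i.
  have mf : measurable_fun `[0, t2 i]%classic (sigma a j).
    by apply: measurable_funS (ms a j) => // x /=;
      rewrite !in_itv/= => /andP[-> h]; exact: le_trans h3.
  have [g [N [? ? ? ? ?]]] := wiener_pair_approx fF bW h0 h1 h2 mf e0 eta'0
    (hY _ a j (ltac:(lra) : 0 <= t0 i <= 1)) (hY _ a j (ltac:(lra) : 0 <= t1 i <= 1))
    (hY _ a j (ltac:(lra) : 0 <= t2 i <= 1)).
  by exists (g, N).
pose G i a j := (GN (i, a, j)).1.
have hG i a j : steps_in (t0 i) (t2 i) (G i a j) by have [] := hGN (i, a, j).
have t02 i : t0 i <= t2 i by have [_ h1 h2 _] := ht i; exact: le_trans h2.
have mu40 : 0 < mu / 4 by rewrite divr_gt0.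
have eta20 : 0 < 2 * eta by rewrite mulr_gt0.
pose tau i a j x := if x <= t1 i then - sigma a j x else sigma a j x.
have mtau i a j : measurable_fun `[t0 i, t2 i]%classic (tau i a j).
  have mf : measurable_fun `[t0 i, t2 i]%classic (sigma a j).
    have [h0 _ _ h3] := ht i.
    apply: measurable_funS (ms a j) => // x /=; rewrite !in_itv/= => /andP[h1 h2].
    by rewrite (le_trans h0 h1) (le_trans h2 h3).
  apply: measurable_fun_if => //.
  - by apply: measurable_fun_ler => //; exact: measurable_id.
  - by apply: measurableT_comp => //; apply: measurable_funS mf => // x [].
  - by apply: measurable_funS mf => // x [].
have hstep i (x : 'I_p -> 'I_d -> R) : exists u : 'I_d -> R,
    [/\ \sum_a u a ^+ 2 <= 1, forall i', i' != i -> \sum_a u a * x i' a = 0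
      & ((mu / 4)%:E <= \sum_j \int[@lebesgue_measure R]_(x in `[t0 i, t2 i])
           ((\sum_a u a * step_fun (G i a j) x) ^+ 2)%:E)%E].
  have [u [u1 ux uV]] := hu i x; exists u; split => //.
  set V := (\sum_j _)%E.
  have V0 : (0 <= V)%E by apply: sume_ge0 => j _;
    apply: integral_ge0 => y _; rewrite lee_fin sqr_ge0.
  have : (mu%:E <= 2%:E * V + (mu / 2)%:E)%E.
    apply: (le_trans uV).
    apply: (@le_trans _ _ (\sum_j (2%:E * (\int[@lebesgue_measure R]_(x in `[t0 i, t2 i])
           ((\sum_a u a * step_fun (G i a j) x) ^+ 2)%:E) + (2 * (d%:R * e))%:E))%E).
      apply: lee_sum => j _.
      (* All components change sign at the same time, so the squared combination is unaffected. *)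
      have -> : (\int[@lebesgue_measure R]_(x in `[t0 i, t2 i]) ((\sum_a u a * sigma a j x) ^+ 2)%:E
        = \int[@lebesgue_measure R]_(x in `[t0 i, t2 i]) ((\sum_a u a * tau i a j x) ^+ 2)%:E)%E.
        apply: eq_integral => y _; rewrite /tau; case: (y <= t1 i) => //.
        by congr (_%:E); rewrite -[LHS]sqrrN -sumrN;
          congr (_ ^+ 2); apply: eq_bigr => a _; rewrite mulrN.
      have mst a : measurable_fun `[t0 i, t2 i]%classic (step_fun (G i a j) : R -> R).
        by apply: measurable_funTS; exact: measurable_step_fun.
      have he a : (\int[@lebesgue_measure R]_(x in `[t0 i, t2 i])
          ((step_fun (G i a j) x - tau i a j x) ^+ 2)%:E <= e%:E)%E.
        by have [] := hGN (i, a, j).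
      have := combination_energy_le (mu := @lebesgue_measure R) (measurable_itv `[t0 i, t2 i])
        (mtau i ^~ j) mst u1 he.
      by rewrite card_ord.
    rewrite big_split /= -ge0_sume_distrr; last first.
      by move=> j _; apply: integral_ge0 => y _; rewrite lee_fin sqr_ge0.
    rewrite leeD2l// sumEFin sumr_const card_ord lee_fin.
    have : e <= mu / (4 * K) by rewrite ge_min lexx.
    rewrite ler_pdivlMr ?mulr_gt0// => he.
    rewrite -[X in X <= _]mulr_natl.
    have hK : d%:R * m%:R <= K.
      rewrite -natrM ler_nat; apply: leq_trans (leqnSn _).
      by rewrite -mulnA leq_pmull.
    have := ler_wpM2l (ltW e0) hK.
    have : 0 <= d%:R * m%:R * e by rewrite !mulr_ge0 ?ler0n// ltW.
    by lra.
  case: V V0 => [v _|_ _|//]; last by rewrite leey.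
  by rewrite -EFinM -EFinD !lee_fin; lra.
have [N [mN PN hN]] := step_small_ball fF bW d0 dpos t02 tt hG mu40 eta20 hstep.
have mGN k : measurable (GN k).2 by move: k => [[i a] j]; have [] := hGN (i, a, j).
exists (N `|` [set w | exists k, (GN k).2 w]); split.
- by apply: measurableU => //; exact: measurable_exists.
- apply: (le_trans (measureU2 P mN (measurable_exists mGN))).
  apply: (@le_trans _ _ ((16 * p%:R * eta / Num.sqrt mu)%:E + (p%:R * eta / Num.sqrt mu)%:E)%E).
    apply: leeD.
      apply: (le_trans PN); rewrite lee_fin.
      have -> : Num.sqrt (mu / 4) = Num.sqrt mu / 2.
        rewrite sqrtrM ?ltW//; congr (_ * _); rewrite sqrtrV//; congr (_^-1).
        by rewrite (_ : 4 = 2 ^+ 2) ?sqrtr_sqr ?ger0_norm//; ring.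
      have sq0 : Num.sqrt mu != 0 by rewrite gt_eqF ?sqrtr_gt0.
      by apply: le_of_eq; field.
    apply: (le_trans (measure_exists_le P mGN)).
    apply: (@le_trans _ _ (\sum_(k : 'I_p * 'I_d * 'I_m) e%:E)%E).
      by apply: lee_sum => -[[i a] j] _; have [] := hGN (i, a, j).
    rewrite sumEFin sumr_const !card_prod !card_ord lee_fin -[X in X <= _]mulr_natl.
    have : e <= p%:R * eta / Num.sqrt mu / K by rewrite ge_min lexx orbT.
    rewrite ler_pdivlMr// mulrC; apply: le_trans.
    by rewrite ler_wpM2r ?(ltW e0)// ler_nat.
  rewrite -EFinD lee_fin; apply: le_of_eq.
  have sq0 : Num.sqrt mu != 0 by rewrite gt_eqF ?sqrtr_gt0.
  by field.
- move=> w nN; have nN1 : ~ N w by move=> h; apply: nN; left.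
  have -> : eta = 2 * eta / 2 by field.
  apply: (sep_perturb (hN w nN1)).
  have hsmall i a : `|\sum_j ((Y (t2 i) a j w - Y (t1 i) a j w) - (Y (t1 i) a j w - Y (t0 i) a j w))
      - wiener_sum W (G i a) w| <= m%:R * eta'.
    rewrite /wiener_sum -sumrB (le_trans (ler_norm_sum _ _ _))//.
    rewrite -[m in m%:R]card_ord mulr_natl -sumr_const; apply: ler_sum => j _.
    have [_ _ _ _ h] := hGN (i, a, j).
    by rewrite distrC ltW// h// => hw; apply: nN; right; exists (i, a, j).
  apply: (@le_trans _ _ (4 * p%:R * \sum_(i < p) \sum_(a < d) (m%:R * eta') ^+ 2)).
    rewrite ler_wpM2l ?mulr_ge0 ?ler0n//; apply: ler_sum => i _; apply: ler_sum => a _.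
    rewrite !mxE -[leLHS]real_normK ?num_real// lerXn2r ?nnegrE//.
    by rewrite mulr_ge0 ?ler0n// ltW.
  have -> : \sum_(i < p) \sum_(a < d) (m%:R * eta') ^+ 2 =
      p%:R * (d%:R * (m%:R * eta') ^+ 2) by rewrite !sumr_const !card_ord !mulr_natl.
  have -> : 4 * p%:R * (p%:R * (d%:R * (m%:R * eta') ^+ 2)) =
    4 * eta ^+ 2 * ((p ^ 2 * d * m ^ 2)%:R / K ^+ 2).
    rewrite /eta' !natrM ?natrX; field; rewrite gt_eqF//.
  rewrite exprMn [2 ^+ 2](_ : _ = 4); last by ring.
  apply: ler_piMr; first by rewrite mulr_ge0 ?sqr_ge0.
  rewrite ler_pdivrMr ?exprn_gt0// mul1r /K -natrX ler_nat.
  apply: (@leq_trans ((p * d * m) ^ 2)); last by rewrite leq_exp2r.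
  by rewrite !expnMn leq_mul// leq_mul// expnS expn1 leq_pmull.
Qed.

(** * The drift *)

Lemma measurable_eucl (R : realType) disp (T : measurableType disp)
    (D : set T) (d : nat) (v : T -> 'cV[R]_d) :
  (forall i, measurable_fun D (fun x => v x i 0)) -> measurable_fun D (fun x => eucl (v x)).
Proof.
move=> mv; apply: (measurableT_comp (f := @Num.sqrt R)).
  by apply: continuous_measurable_fun; exact: sqrt_continuous.
by apply: measurable_sum => i; apply: measurable_funX.
Qed.

Lemma abs_le_eucl (R : realType) (d : nat) (v : 'cV[R]_d) i : `|v i 0| <= eucl v.
Proof.
rewrite /eucl -sqrtr_sqr ler_wsqrtr// (bigD1 i)//= lerDl sumr_ge0// => j _.
exact: sqr_ge0.
Qed.

Lemma eucl_ge0 (R : realType) (d : nat) (v : 'cV[R]_d) : 0 <= eucl v.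
Proof. exact: sqrtr_ge0. Qed.

Lemma measurable_section (R : realType) disp (T : measurableType disp)
    (d' : measure_display) (U : measurableType d')
    (A : set (measurableTypeR R)) (f : measurableTypeR R * T -> U) (w : T) :
  measurable A -> measurable_fun (A `*` setT) f -> measurable_fun A (fun t => f (t, w)).
Proof.
move=> mA mf; apply: (@measurable_comp _ _ _ _ _ _ (A `*` setT) f A (fun t => (t, w))) => //.
- exact: (measurableX mA measurableT).
- by move=> _ [t At <-].
- by apply: measurable_funTS; exact: pair2_measurable.
Qed.

(** The drift is jointly measurable only for times in [0, 1], so the function is extended by 0
    outside the strip before Tonelli's theorem is applied. *)
Lemma tonelli_strip (R : realType) disp (T : measurableType disp)
    (P : probability T R) (A : set (measurableTypeR R)) (f : measurableTypeR R * T -> \bar R) :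
  measurable A -> measurable_fun (A `*` setT) f -> (forall z, 0 <= f z)%E ->
  [/\ measurable_fun setT (fun w => \int[@lebesgue_measure R]_(t in A) f (t, w))%E,
    measurable_fun A (fun t => \int[P]_w f (t, w))%E &
  (\int[P]_w \int[@lebesgue_measure R]_(t in A) f (t, w) =
   \int[@lebesgue_measure R]_(t in A) \int[P]_w f (t, w))%E].
Proof.
move=> mA mf f0; pose phi := f \_ (A `*` setT).
have mAT : measurable (A `*` [set: T]) by exact: (measurableX mA measurableT).
have mphi : measurable_fun setT phi by exact: ((measurable_restrictT f mAT).1 mf).
have phi0 z : (0 <= phi z)%E by rewrite /phi patchE; case: ifP.
have phiE t w : phi (t, w) = ((fun t => f (t, w)) \_ A) t.
  rewrite /phi !patchE; have [tA|tA] := boolP (t \in A).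
    by rewrite mem_set//; split => //; exact: set_mem.
  by rewrite memNset// => -[/mem_set]; rewrite (negPf tA).
have inner w : (\int[@lebesgue_measure R]_(t in A) f (t, w) =
    \int[@lebesgue_measure R]_t phi (t, w))%E.
  by rewrite integral_mkcond; apply: eq_integral => t _; rewrite phiE.
split.
  rewrite (_ : (fun w => _) = fubini_G (@lebesgue_measure R) phi).
    exact: measurable_fun_fubini_tonelli_G.
  by apply/funext => w; rewrite inner.
  apply: (eq_measurable_fun (fubini_F P phi)); last first.
    by apply: measurable_funTS; exact: measurable_fun_fubini_tonelli_F.
  move=> t tA; apply: eq_integral => w _.
  by rewrite phiE patchE tA.
under eq_integral do rewrite inner.
rewrite -(fubini_tonelli (m1 := @lebesgue_measure R) (m2 := P) phi mphi phi0).
rewrite [RHS]integral_mkcond; apply: eq_integral => t _.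
rewrite patchE; have [tA|tA] := boolP (t \in A).
  by apply: eq_integral => w _; rewrite phiE patchE tA.
by apply: integral0_eq => w _; rewrite phiE patchE (negPf tA).
Qed.

(** Pointwise |z| <= theta + z^4 / theta^3, by distinguishing |z| <= theta and |z| > theta. *)
Lemma fourth_moment_first (R : realType) disp (T : measurableType disp)
    (P : probability T R) (Z : T -> R) (theta : R) : measurable_fun setT Z -> 0 < theta ->
  (\int[P]_w (Z w ^+ 4)%:E <= (theta ^+ 4)%:E)%E ->
  (\int[P]_w `|Z w|%:E <= (2 * theta)%:E)%E.
Proof.
move=> mZ t0 hZ.
have mZ4 : measurable_fun setT (fun w => (Z w ^+ 4)%:E).
  by apply/measurable_EFinP; exact: measurable_funX.
have Z4 w : 0 <= Z w ^+ 4 by rewrite (exprM _ 2 2) sqr_ge0.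
have c0 : 0 <= (theta ^+ 3)^-1 by rewrite invr_ge0 exprn_ge0 ?ltW.
apply: (@le_trans _ _ (\int[P]_w (theta%:E + ((theta ^+ 3)^-1)%:E * (Z w ^+ 4)%:E))%E).
  apply: ge0_le_integral => //.
  - by apply/measurable_EFinP; exact: measurableT_comp.
  - by apply: emeasurable_funD => //; exact: measurable_funeM.
  - move=> w _; rewrite -EFinM -EFinD lee_fin.
    have [h|h] := leP `|Z w| theta; first by rewrite (le_trans h)// lerDl mulr_ge0.
    apply: (@le_trans _ _ ((theta ^+ 3)^-1 * Z w ^+ 4)); last by rewrite lerDr ltW.
    rewrite ler_pdivlMl ?exprn_gt0// -[leRHS]ger0_norm// normrX [leRHS]exprSr.
    by rewrite ler_wpM2r// lerXn2r ?nnegrE ?(ltW t0)// ltW.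
rewrite ge0_integralD//; last 3 first.
- by move=> w _; rewrite lee_fin ltW.
- by move=> w _; rewrite mule_ge0// lee_fin.
- exact: measurable_funeM.
rewrite integral_cst//= probability_setT mule1 ge0_integralZl_EFin//; last first.
  by move=> w _; rewrite lee_fin.
apply: (@le_trans _ _ (theta%:E + ((theta ^+ 3)^-1)%:E * (theta ^+ 4)%:E)%E).
  by apply: leeD2l; apply: lee_wpmul2l.
rewrite -EFinM -EFinD lee_fin; apply: le_of_eq.
by field; rewrite gt_eqF.
Qed.

(** As |t - s| <= 1, the class bounds the fourth moment by Lb^4. The constant Lb + 1 replaces Lb to
    stay positive when Lb = 0. *)
Lemma drift_first_moment (R : realType) disp (T : measurableType disp)
    (P : probability T R) (F : R -> set (set T)) (d : nat) (betab Lb : R)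
    (b : R -> T -> 'cV[R]_d) (s t : R) :
  filtration F -> drift_class P F betab Lb b -> 0 <= betab -> 0 <= Lb ->
  0 <= s -> s <= t -> t <= 1 ->
  (\int[P]_w (eucl (b t w - b s w))%:E <= (2 * (Lb + 1))%:E)%E.
Proof.
move=> fF [[ab _ _] hb] b0 L0 s0 st t1.
have mb u : 0 <= u <= 1 -> forall i, measurable_fun setT (fun w => b u w i 0).
  move=> u01 i _ B mB; rewrite setTI.
  have /andP[u0 _] := u01; have [_ sub] := fF.1 u u0; apply: sub.
  exact: ab.
have mZ : measurable_fun setT (fun w => eucl (b t w - b s w)).
  apply: measurable_eucl => i; under eq_fun do rewrite !mxE.
  by apply: measurable_funB; apply: mb; lra.
have th0 : 0 < Lb + 1 by lra.
have -> : (\int[P]_w (eucl (b t w - b s w))%:E = \int[P]_w `|eucl (b t w - b s w)|%:E)%E.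
  by apply: eq_integral => w _; rewrite ger0_norm ?eucl_ge0.
apply: (fourth_moment_first mZ th0).
have := hb t s s0 st t1; set I := (\int[P]_w _)%E => hI.
have I0 : (0 <= I)%E by apply: integral_ge0 => w _; rewrite lee_fin exprn_ge0 ?eucl_ge0.
have : (poweR I 4^-1 <= (Lb + 1)%:E)%E.
  apply: (le_trans hI); rewrite lee_fin.
  apply: (@le_trans _ _ Lb); last by lra.
  rewrite ler_piMr//; apply: (@le_trans _ _ (1 `^ betab)); last by rewrite powR1.
  by apply: ge0_ler_powR => //; rewrite ?nnegrE// ger0_norm; lra.
case: I I0 {hI} => [x|_|//]; last first.
  by rewrite /poweR /= gt_eqF// leye_eq.
rewrite lee_fin => x0; rewrite poweR_EFin !lee_fin => hx.
have -> : x = (x `^ 4^-1) ^+ 4.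
  by rewrite -powR_mulrn ?powR_ge0// -powRrM mulVf ?powRr1.
by rewrite lerXn2r ?nnegrE ?powR_ge0// ltW.
Qed.

Lemma Rintegral_shift (R : realType) (f : R -> R) (c s t : R) : 0 <= s -> s <= t -> t <= 1 ->
  (@lebesgue_measure R).-integrable `[0, 1]%classic (EFin \o f) ->
  (\int[@lebesgue_measure R]_(x in `[0, t]) f x) - (\int[@lebesgue_measure R]_(x in `[0, s]) f x) =
  (\int[@lebesgue_measure R]_(x in `]s, t]) (f x - c)) + c * (t - s).
Proof.
move=> s0 st t1 fi.
have fi' (J : interval R) : [set` J] `<=` `[0, 1]%classic ->
    (@lebesgue_measure R).-integrable [set` J] (EFin \o f).
  by move=> J01; apply: integrableS fi.
rewrite Rintegral_itvB; last 3 first.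
- apply: fi' => x /=; rewrite !in_itv/= => /andP[-> h]; exact: le_trans t1.
- by rewrite bnd_simp.
- by rewrite bnd_simp.
have ci : (@lebesgue_measure R).-integrable `]s, t]%classic (EFin \o cst c).
  apply/integrableP; split; first by apply/measurable_EFinP; exact: measurable_cst.
  by rewrite /= integral_cst//= lebesgue_measure_itv/=;
    case: ifP; rewrite ?mule0 ?ltry// -EFinB -EFinM ltry.
rewrite RintegralB//; last first.
  apply: fi' => x /=; rewrite !in_itv/= => /andP[h1 h2].
  by rewrite (le_trans s0 (ltW h1)) (le_trans h2 t1).
rewrite [X in _ - X + _]Rintegral_cst//= lebesgue_measure_itv/= lte_fin.
have [st'|ts] := ltP s t; first by rewrite -EFinB/= subrK.
by rewrite /= mulr0 subr0 (_ : t = s) ?subrr ?mulr0 ?addr0//; apply/eqP; rewrite eq_le ts st.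
Qed.

Lemma markov_ereal (R : realType) disp (T : measurableType disp)
    (P : measure T R) (D : T -> \bar R) (e eta : R) : measurable_fun setT D ->
  (forall w, 0 <= D w)%E -> 0 < eta -> (\int[P]_w D w <= e%:E)%E ->
  measurable [set w | eta%:E <= D w]%E /\ (P [set w | eta%:E <= D w] <= (e / eta)%:E)%E.
Proof.
move=> mD D0 eta0 le; set A := [set w | _].
have mA : measurable A.
  by rewrite /A -[X in measurable X]setTI; apply: emeasurable_fun_c_infty.
split => //; rewrite EFinM lee_pdivlMr//.
apply: le_trans le; rewrite muleC -integral_cst//.
apply: (@le_trans _ _ (\int[P]_(w in A) D w)%E); last by apply: ge0_subset_integral.
apply: ge0_le_integral => //.
- by move=> w _; rewrite lee_fin ltW.
- exact: measurable_funTS.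
Qed.

(** A finite expected integral makes almost every path integrable. This is what permits splitting
    the path integrals of b into integrals over subintervals. *)
Lemma integrable_section_ae (R : realType) disp (T : measurableType disp)
    (P : probability T R) (F : R -> set (set T)) (d : nat) (b : R -> T -> 'cV[R]_d) :
  drift P F b -> exists N : set T, [/\ measurable N, P N = 0%E &
    forall w, ~ N w -> forall i, (@lebesgue_measure R).-integrable `[0, 1]%classic
      (EFin \o (fun t => b t w i 0))].
Proof.
move=> [_ mb fin].
have m01 : measurable (`[0%R, 1%R]%classic : set (measurableTypeR R)) by exact: measurable_itv.
pose f (q : measurableTypeR R * T) : \bar R := (eucl (b q.1 q.2))%:E.
have mf : measurable_fun ((`[0%R, 1%R]%classic : set (measurableTypeR R)) `*` setT) f.
  by apply/measurable_EFinP; exact: measurable_eucl.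
have [mPhi _ _] := tonelli_strip P m01 mf (fun z => eucl_ge0 (b z.1 z.2)).
set Phi := (fun w => _) in mPhi.
have Phi0 w : (0 <= Phi w)%E by apply: integral_ge0 => t _; rewrite lee_fin eucl_ge0.
have iPhi : P.-integrable setT Phi.
  by apply/integrableP; split => //; under eq_integral do rewrite gee0_abs//.
have [N [mN PN hN]] := integrable_ae measurableT iPhi.
exists N; split => // w nNw i.
have finPhi : Phi w \is a fin_num by apply: contrapT => h; apply: nNw; apply: hN => /(_ I).
have msec k : measurable_fun (`[0%R, 1%R]%classic : set (measurableTypeR R)) (fun t => b t w k 0).
  exact: (measurable_section w m01 (mb k)).
apply/integrableP; split; first by apply/measurable_EFinP; exact: msec.
apply: (@le_lt_trans _ _ (Phi w)); last by rewrite -ge0_fin_numE.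
apply: ge0_le_integral => //.
- by apply/measurable_EFinP; apply: measurableT_comp => //; exact: msec.
- by apply/measurable_EFinP; apply: measurable_eucl => k; exact: msec.
- by move=> t _; rewrite lee_fin abs_le_eucl.
Qed.

Lemma integrable_itvoc_cst (R : realType) (a b c : R) :
  (@lebesgue_measure R).-integrable `]a, b]%classic (EFin \o cst c).
Proof.
apply/integrableP; split; first by apply/measurable_EFinP; exact: measurable_cst.
rewrite /= integral_cst//= lebesgue_measure_itv/=.
by case: ifP; rewrite ?mule0 ?ltry// -EFinB -EFinM ltry.
Qed.

(* Both integrals are compared with delta b(t0), which cancels: the class bounds only
   the increments of b, not b itself. *)
Lemma drift_pair_small (R : realType) disp (T : measurableType disp)
    (P : probability T R) (F : R -> set (set T)) (d : nat) (betab Lb : R)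
    (b : R -> T -> 'cV[R]_d) (t0 t1 t2 delta eta : R) (i : 'I_d) :
  filtration F -> drift_class P F betab Lb b -> 0 <= betab -> 0 <= Lb ->
  0 <= t0 -> 0 < delta -> t1 = t0 + delta -> t2 = t1 + delta -> t2 <= 1 -> 0 < eta ->
  exists N : set T, [/\ measurable N, (P N <= (4 * (Lb + 1) * delta / eta)%:E)%E &
    forall w, ~ N w -> `|(int_mx (b^~ w) 0 t2 - int_mx (b^~ w) 0 t1
       - (int_mx (b^~ w) 0 t1 - int_mx (b^~ w) 0 t0)) i 0| < eta].
Proof.
move=> fF db b0 L0 p0 del0 e1 e2 t21 eta0.
have [N0 [mN0 PN0 hN0]] := integrable_section_ae db.1.
have [ab mb _] := db.1.
have t01 : t0 <= t1 by rewrite e1; lra.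
have t12 : t1 <= t2 by rewrite e2; lra.
have m02 : measurable (`[t0, t2]%classic : set (measurableTypeR R)) by exact: measurable_itv.
pose f (q : measurableTypeR R * T) : \bar R := `|b q.1 q.2 i 0 - b t0 q.2 i 0|%:E.
have mb0 : measurable_fun setT (fun w => b t0 w i 0).
  move=> _ B mB; rewrite setTI.
  have t001 : 0 <= t0 <= 1 by lra.
  by have [_ sub] := fF.1 t0 p0; apply: sub; exact: ab.
have mf : measurable_fun ((`[t0, t2]%classic : set (measurableTypeR R)) `*` setT) f.
  apply/measurable_EFinP; apply: measurableT_comp => //; apply: measurable_funB.
    apply: measurable_funS (mb i); first exact: (measurableX (measurable_itv _) measurableT).
    move=> [t w] [/=]; rewrite !in_itv/= => /andP[h1 h2] _; split => //=.
    by rewrite ?in_itv/= (le_trans p0 h1) (le_trans h2).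
  by apply: measurable_funTS; apply: (measurableT_comp mb0); exact: measurable_snd.
have f0 z : (0 <= f z)%E by rewrite lee_fin.
have [mD mE ED] := tonelli_strip P m02 mf f0.
set D := (fun w => _) in mD.
have D0 w : (0 <= D w)%E by apply: integral_ge0.
have iD : (\int[P]_w D w <= (4 * (Lb + 1) * delta)%:E)%E.
  rewrite ED; apply: (@le_trans _ _ (\int[@lebesgue_measure R]_(t in `[t0, t2])
    (cst (2 * (Lb + 1))%:E t))%E).
    apply: ge0_le_integral => //; first by move=> t _; apply: integral_ge0.
    move=> t /=; rewrite in_itv/= => /andP[h1 h2].
    have t21' : t <= 1 := le_trans h2 t21.
    apply: le_trans (drift_first_moment fF db b0 L0 p0 h1 t21').
    have mbt k : measurable_fun setT (fun w => b t w k 0).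
      move=> _ B mB; rewrite setTI; have tt : 0 <= t <= 1 by rewrite (le_trans p0 h1).
      by have [_ sub] := fF.1 t (le_trans p0 h1); apply: sub; exact: ab.
    have mb00 k : measurable_fun setT (fun w => b t0 w k 0).
      move=> _ B mB; rewrite setTI; have tt : 0 <= t0 <= 1 by lra.
      by have [_ sub] := fF.1 t0 p0; apply: sub; exact: ab.
    apply: ge0_le_integral => //.
    - by apply/measurable_EFinP; apply: measurableT_comp => //; exact: measurable_funB.
    - apply/measurable_EFinP; apply: measurable_eucl => k; under eq_fun do rewrite !mxE.
      exact: measurable_funB.
    - move=> w _; rewrite lee_fin; have := abs_le_eucl (b t w - b t0 w) i.
      by rewrite !mxE.
  rewrite integral_cst//= lebesgue_measure_itv/= lte_fin ifT; last by rewrite e2 e1; lra.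
  by rewrite -EFinB -EFinM lee_fin e2 e1; lra.
have [mA PA] := markov_ereal mD D0 eta0 iD.
exists ([set w | eta%:E <= D w]%E `|` N0); split.
- exact: measurableU.
- have PN0' : (P N0 <= 0)%E by rewrite PN0.
  by apply: (le_trans (measureU2 P mA mN0)); apply: (le_trans (leeD PA PN0')); rewrite adde0.
move=> w nN; have Dw : (D w < eta%:E)%E.
  by rewrite ltNge; apply/negP => h; apply: nN; left.
have fi := hN0 w (fun h => nN (or_intror h)) i.
rewrite -lte_fin; apply: le_lt_trans Dw.
set c := b t0 w i 0; set g := fun t => b t w i 0.
have gE : (int_mx (b^~ w) 0 t2 - int_mx (b^~ w) 0 t1
       - (int_mx (b^~ w) 0 t1 - int_mx (b^~ w) 0 t0)) i 0 =
  (\int[@lebesgue_measure R]_(x in `]t1, t2]) (g x - c)) -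
  (\int[@lebesgue_measure R]_(x in `]t0, t1]) (g x - c)).
  rewrite !mxE (Rintegral_shift c (le_trans p0 t01) t12 t21 fi).
  rewrite (Rintegral_shift c p0 t01 (le_trans t12 t21) fi) e2 e1; ring.
rewrite gE; apply: (@le_trans _ _ (`|\int[@lebesgue_measure R]_(x in `]t1, t2]) (g x - c)|%:E +
   `|\int[@lebesgue_measure R]_(x in `]t0, t1]) (g x - c)|%:E)%E).
  by rewrite -EFinD lee_fin; exact: ler_normB.
have part a a' : t0 <= a -> a' <= t2 -> a <= a' ->
    (`|\int[@lebesgue_measure R]_(x in `]a, a']) (g x - c)|%:E <=
     \int[@lebesgue_measure R]_(x in `]a, a']) `|g x - c|%:E)%E.
  move=> h1 h2 h3.
  have ig : (@lebesgue_measure R).-integrable `]a, a']%classic (EFin \o (fun x => g x - c)).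
    have ig1 : (@lebesgue_measure R).-integrable `]a, a']%classic (EFin \o g).
      apply: integrableS fi => // x /=; rewrite !in_itv/= => /andP[k1 k2].
      by rewrite (le_trans p0 (le_trans h1 (ltW k1))) (le_trans k2 (le_trans h2 t21)).
    have ic : (@lebesgue_measure R).-integrable `]a, a']%classic (EFin \o cst c).
      exact: integrable_itvoc_cst.
    by apply: (integrableB _ ig1 ic); exact: measurable_itv.
  rewrite /Rintegral -abse_EFin fineK; last exact: integrable_fin_num.
  have := le_abse_integral lebesgue_measure (measurable_itv `]a, a']) (measurable_int _ ig).
  by [].
apply: (le_trans (leeD (part t1 t2 t01 (lexx _) t12) (part t0 t1 (lexx _) t12 t01))).
have mg (J : set (measurableTypeR R)) : J `<=` `[0%R, 1%R]%classic ->
    measurable J -> measurable_fun J (fun x => `|g x - c|%:E).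
  move=> J01 mJ; apply/measurable_EFinP; apply: measurableT_comp => //.
  apply: measurable_funB => //; apply: measurable_funS J01 _ => //.
  exact: (measurable_section w (measurable_itv _) (mb i)).
rewrite addeC -ge0_integral_setU//; last 2 first.
- rewrite -itvoc_splitU//; apply: mg; last exact: measurable_itv.
  move=> x /=; rewrite !in_itv/= => /andP[k1 k2].
  by rewrite (le_trans p0 (ltW k1)) (le_trans k2 t21).
- apply/disj_setPS => x [] /=; rewrite !in_itv/= => /andP[_ h] /andP[h' _].
  by move: h'; rewrite ltNge h.
rewrite -itvoc_splitU//; apply: ge0_subset_integral => //.
- apply: mg; last exact: measurable_itv.
  move=> x /=; rewrite !in_itv/= => /andP[k1 k2].
  by rewrite (le_trans p0 k1) (le_trans k2 t21).
- by move=> x /=; rewrite !in_itv/= => /andP[/ltW -> ->].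
Qed.

(** * Power of the test *)

Lemma trace_gram (R : comPzRingType) (m d n : nat) (B : 'M[R]_(m, d)) (S : 'M[R]_(d, n)) :
  \tr (B *m (S *m S^T) *m B^T) = \sum_k \sum_j (\sum_a B k a * S a j) ^+ 2.
Proof.
have -> : B *m (S *m S^T) *m B^T = (B *m S) *m (B *m S)^T by rewrite trmx_mul !mulmxA.
by apply: eq_bigr => k _; rewrite mxE;
  apply: eq_bigr => j _; rewrite [_^T _ _]mxE [in LHS]mxE expr2.
Qed.

(** The r other vectors leave an orthonormal system B of d - r directions. Its energies add up to
    the time integral of tr(B Sigma(t) B^T), whose integrand is at least lam at each t whatever the
    eigenvectors are, so one row of B carries a fixed share. The factor 2 in the share makes the
    pigeonhole argument strict. *)
Lemma energetic_direction (R : realType) (d m r : nat) (S : R -> 'M[R]_(d, m))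
    (t0 t2 lam : R) (i : 'I_r.+1) (x : 'I_r.+1 -> 'I_d -> R) :
  (r < d)%N -> t0 < t2 -> 0 < lam ->
  (forall a j, measurable_fun (`[t0, t2]%classic : set (measurableTypeR R)) (fun t => S t a j)) ->
  (forall t, t0 <= t <= t2 -> lam <= eigval r.+1 (S t *m (S t)^T)) ->
  exists u : 'I_d -> R,
    [/\ \sum_a u a ^+ 2 <= 1, forall i', i' != i -> \sum_a u a * x i' a = 0
      & (((t2 - t0) * lam / (2 * d%:R))%:E <= \sum_j \int[@lebesgue_measure R]_(t in `[t0, t2])
           ((\sum_a u a * S t a j) ^+ 2)%:E)%E].
Proof.
move=> rd t02 lam0 mS hS.
have [B [BB BX]] := orthonormal_complement (\matrix_(k < r, a < d) x (lift i k) a) rd.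
have d0 : 0 < d%:R :> R by rewrite ltr0n (leq_ltn_trans _ rd).
have uB k : \sum_a B k a ^+ 2 <= 1.
  have /matrixP/(_ k k) := BB; rewrite !mxE eqxx mulr1n => <-.
  by apply: le_of_eq; apply: eq_bigr => a _; rewrite mxE expr2.
have oB k i' : i' != i -> \sum_a B k a * x i' a = 0.
  move=> ii'; rewrite eq_sym in ii'; have [k' -> _] := unlift_some ii'.
  have /matrixP/(_ k k') := BX; rewrite !mxE => h; rewrite -[RHS]h.
  by apply: eq_bigr => a _; rewrite ?mxE.
pose V k := (\sum_j \int[@lebesgue_measure R]_(t in `[t0, t2])
           ((\sum_a B k a * S t a j) ^+ 2)%:E)%E.
have msq k j : measurable_fun (`[t0, t2]%classic : set (measurableTypeR R))
    (fun t => ((\sum_a B k a * S t a j) ^+ 2)%:E).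
  apply/measurable_EFinP; apply: measurable_funX; apply: measurable_sum => a.
  exact: measurable_funM.
have mrow k : measurable_fun (`[t0, t2]%classic : set (measurableTypeR R))
    (fun t => (\sum_j (\sum_a B k a * S t a j) ^+ 2)%:E).
  apply/measurable_EFinP; apply: measurable_sum => j; apply: measurable_funX.
  by apply: measurable_sum => a; exact: measurable_funM.
have sumV : (((t2 - t0) * lam)%:E <= \sum_k V k)%E.
  have -> : (\sum_k V k = \int[@lebesgue_measure R]_(t in `[t0, t2])
      (\tr (B *m (S t *m (S t)^T) *m B^T))%:E)%E.
    under [RHS]eq_integral do rewrite trace_gram -sumEFin.
    rewrite ge0_integral_sum//; last first.
    - by move=> k t _; rewrite lee_fin sumr_ge0// => j _; exact: sqr_ge0.
    apply: eq_bigr => k _; under [RHS]eq_integral do rewrite -sumEFin.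
    rewrite ge0_integral_sum// => j t _; by rewrite lee_fin sqr_ge0.
  have -> : (((t2 - t0) * lam)%:E = \int[@lebesgue_measure R]_(t in `[t0, t2]) cst lam%:E t)%E.
    by rewrite integral_cst//= lebesgue_measure_itv/= lte_fin t02 -EFinB -EFinM mulrC.
  apply: ge0_le_integral => //.
  - by move=> t _; rewrite lee_fin ltW.
  - apply: (eq_measurable_fun (fun t => (\sum_k \sum_j (\sum_a B k a * S t a j) ^+ 2)%:E)).
      by move=> t _; rewrite trace_gram.
    by apply/measurable_EFinP; apply: measurable_sum => k; apply/measurable_EFinP; exact: mrow.
  - move=> t; rewrite /= in_itv/= => ht; rewrite lee_fin (le_trans (hS t ht))//.
    apply: eigval_le_trace => //; first by rewrite trmx_mul trmxK.
    move=> v; have -> : v *m (S t *m (S t)^T) *m v^T = (v *m S t) *m (v *m S t)^T.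
      by rewrite trmx_mul !mulmxA.
    by rewrite mulmx_tr_sqr sumr_ge0// => j _; exact: sqr_ge0.
have [k hk] : exists k, (((t2 - t0) * lam / (2 * d%:R))%:E <= V k)%E.
  apply: contrapT => nex; move: sumV; apply/negP; rewrite -ltNge.
  apply: (@le_lt_trans _ _ (\sum_(k < d - r) ((t2 - t0) * lam / (2 * d%:R))%:E)%E).
    apply: lee_sum => k _; rewrite leNgt; apply/negP => h; apply: nex; exists k; exact: ltW.
  rewrite sumEFin sumr_const card_ord lte_fin -[X in X < _]mulr_natl.
  have c0 : 0 < (t2 - t0) * lam by rewrite mulr_gt0// subr_gt0.
  rewrite mulrCA gtr_pMr// mulrC ltr_pdivrMl ?mulr_gt0// mulr1.
  have : (d - r)%:R <= d%:R :> R by rewrite ler_nat leq_subr.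
  by lra.
by exists (B k); split => // i'; exact: oB.
Qed.

(** The stochastic part is separated by [wiener_small_ball] with mu = delta lam / d, the energy
    along the direction found on an interval of length 2 delta. The drift part and the null sets of
    the model are then treated as a perturbation. *)
Lemma group_small_ball (R : realType) disp (T : measurableType disp)
    (P : probability T R) (F : R -> set (set T)) (m d r : nat) (W : R -> T -> 'cV[R]_m)
    (betab Lb : R) (Sigma : R -> 'M[R]_d) (b X : R -> T -> 'cV[R]_d)
    (t0 t1 t2 : 'I_r.+1 -> R) (delta lam eta : R) :
  (r < d)%N -> filtration F -> brownian_motion P F W -> 0 <= betab -> 0 <= Lb ->
  drift_class P F betab Lb b -> ito_model P F W Sigma b X ->
  (forall i, [/\ 0 <= t0 i, t1 i = t0 i + delta, t2 i = t1 i + delta & t2 i <= 1]) ->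
  (forall i i' : 'I_r.+1, (i < i')%N -> t2 i <= t0 i') ->
  0 < delta -> 0 < lam -> 0 < eta ->
  (forall i t, t0 i <= t <= t2 i -> lam <= eigval r.+1 (Sigma t)) ->
  exists N : set T, [/\ measurable N,
    (P N <= (17 * r.+1%:R * eta / Num.sqrt (delta * lam / d%:R) +
      (r.+1 * d)%:R * (4 * (Lb + 1) * delta / (eta / (2 * (r.+1 * d)%:R))))%:E)%E &
    forall w, ~ N w ->
      sep (eta / 2) (fun i => X (t2 i) w - X (t1 i) w - (X (t1 i) w - X (t0 i) w))].
Proof.
move=> rd fF bW b0 L0 db [_ [_ [S [mS _ SS hX]]]] ht tt del0 lam0 eta0 hlam.
have d0 : (0 < d)%N by exact: leq_ltn_trans rd.
have ht' i : [/\ 0 <= t0 i, t0 i <= t1 i, t1 i <= t2 i & t2 i <= 1].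
  by have [h0 h1 h2 h3] := ht i; split; rewrite ?h2 ?h1; lra.
pose K : R := (r.+1 * d)%:R.
have K0 : 0 < K by rewrite ltr0n muln_gt0.
(* The model equation holds outside a null set that depends on t; only the 3 (r + 1) observation
   times of the group are used. Outside [0, 1] the choice is a dummy. *)
have /choice[YN hYN] : forall t, exists YN : ('I_d -> 'I_m -> T -> R) * set T, 0 <= t <= 1 ->
  [/\ forall i j, is_wiener_int P (fun s w => W s w j 0) (fun s => S s i j) t (YN.1 i j),
      measurable YN.2, P YN.2 = 0%E &
      forall w, ~ YN.2 w -> X t w = X 0 w + int_mx (b^~ w) 0 t + \col_i \sum_j YN.1 i j w].
  move=> t; have [t01|nt] := boolP (0 <= t <= 1); last first.
    by exists ((fun _ _ _ => 0), set0).
  have [Y [hY [N [mN PN hN]]]] := hX t t01.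
  exists (Y, N) => _; split => // w nNw.
  by apply: contrapT => h; apply: nNw; apply: hN.
pose Y t := (YN t).1; pose Z t := (YN t).2.
have [N1 [mN1 PN1 hN1]] : exists N : set T, [/\ measurable N,
    (P N <= (17 * r.+1%:R * eta / Num.sqrt (delta * lam / d%:R))%:E)%E &
    forall w, ~ N w -> sep eta (fun i => \col_a \sum_j
      ((Y (t2 i) a j w - Y (t1 i) a j w) - (Y (t1 i) a j w - Y (t0 i) a j w)))].
  apply: (@wiener_small_ball _ _ _ P F m r.+1 d W t0 t1 t2
    (fun a j s => S s a j) Y _ eta fF bW d0 ht' tt).
  - by move=> a j; exact: mS.
  - by move=> t a j t01; have [] := hYN t t01.
  - by rewrite divr_gt0 ?mulr_gt0// ltr0n.
  - exact: eta0.
  - move=> i x; have [h0 h1 h2 h3] := ht i.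
    have t02 : t0 i < t2 i by rewrite h2 h1; lra.
    have mS' a j : measurable_fun (`[t0 i, t2 i]%classic : set (measurableTypeR R))
        (fun t => S t a j).
      apply: measurable_funS (mS a j) => // t /=; rewrite !in_itv/= => /andP[k1 k2].
      by rewrite (le_trans h0 k1) (le_trans k2 h3).
    have hS t : t0 i <= t <= t2 i -> lam <= eigval r.+1 (S t *m (S t)^T).
      move=> /andP[k1 k2]; have tt01 : 0 <= t <= 1 by rewrite (le_trans h0 k1) (le_trans k2 h3).
      by rewrite -SS//; apply: (hlam i); rewrite k1 k2.
    have [u [u1 ux uV]] := energetic_direction i x rd t02 lam0 mS' hS.
    exists u; split => //; apply: le_trans uV; rewrite lee_fin h2 h1.
    apply: le_of_eq; field.
    by rewrite pnatr_eq0 -lt0n.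
(* With p = r + 1, perturbations of this size contribute 4 p^2 d eta2^2 = eta^2 / d, which
   [sep_perturb] tolerates. *)
pose eta2 := eta / (2 * K).
have eta20 : 0 < eta2 by rewrite divr_gt0 ?mulr_gt0.
have /choice[N2 hN2] : forall k : 'I_r.+1 * 'I_d, exists N : set T,
  [/\ measurable N, (P N <= (4 * (Lb + 1) * delta / eta2)%:E)%E &
    forall w, ~ N w -> `|(int_mx (b^~ w) 0 (t2 k.1) - int_mx (b^~ w) 0 (t1 k.1)
       - (int_mx (b^~ w) 0 (t1 k.1) - int_mx (b^~ w) 0 (t0 k.1))) k.2 0| < eta2].
  move=> [i a] /=; have [h0 h1 h2 h3] := ht i.
  exact: (drift_pair_small a fF db b0 L0 h0 del0 h1 h2 h3 eta20).
have mN2 k : measurable (N2 k) by have [] := hN2 k.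
have t01 i : 0 <= t0 i <= 1 by have [h0 h1 h2 h3] := ht' i; lra.
have t11 i : 0 <= t1 i <= 1 by have [h0 h1 h2 h3] := ht' i; lra.
have t21 i : 0 <= t2 i <= 1 by have [h0 h1 h2 h3] := ht' i; lra.
pose N3 i := Z (t0 i) `|` Z (t1 i) `|` Z (t2 i).
have mZ t : 0 <= t <= 1 -> measurable (Z t) by move=> /hYN[].
have PZ t : 0 <= t <= 1 -> (P (Z t) <= 0)%E by move=> /hYN[_ _ h _]; rewrite h.
have mN3 i : measurable (N3 i) by apply: measurableU; [apply: measurableU|]; exact: mZ.
have PN3 i : (P (N3 i) <= 0)%E.
  have h1 := measureU2 P (measurableU _ _ (mZ _ (t01 i)) (mZ _ (t11 i))) (mZ _ (t21 i)).
  apply: (le_trans h1); rewrite -[leRHS]adde0; apply: leeD; last exact: PZ.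
  apply: (le_trans (measureU2 P (mZ _ (t01 i)) (mZ _ (t11 i)))).
  by rewrite -[leRHS]adde0; apply: leeD; exact: PZ.
exists (N1 `|` [set w | exists k, N2 k w] `|` [set w | exists i, N3 i w]).
have mE2 := measurable_exists mN2; have mE3 := measurable_exists mN3.
split.
- by apply: measurableU => //; exact: measurableU.
- apply: (le_trans (measureU2 P (measurableU _ _ mN1 mE2) mE3)).
  rewrite -[leRHS]adde0; apply: leeD; last first.
    apply: (le_trans (measure_exists_le P mN3)).
    by apply: (@le_trans _ _ (\sum_(i < r.+1) 0)%E);
      [apply: lee_sum => i _; exact: PN3|rewrite big1].
  apply: (le_trans (measureU2 P mN1 mE2)); rewrite EFinD; apply: leeD => //.
  apply: (le_trans (measure_exists_le P mN2)).
  apply: (@le_trans _ _ (\sum_(k : 'I_r.+1 * 'I_d) (4 * (Lb + 1) * delta / eta2)%:E)%E).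
    by apply: lee_sum => k _; have [] := hN2 k.
  by rewrite sumEFin sumr_const card_prod !card_ord lee_fin -[X in X <= _]mulr_natl.
move=> w nN.
have n1 : ~ N1 w by move=> h; apply: nN; left; left.
have n2 k : ~ N2 k w by move=> h; apply: nN; left; right; exists k.
have n3 i : ~ N3 i w by move=> h; apply: nN; right; exists i.
apply: (sep_perturb (hN1 w n1)).
have hdiff i a : `|(X (t2 i) w - X (t1 i) w - (X (t1 i) w - X (t0 i) w) - \col_a \sum_j
      ((Y (t2 i) a j w - Y (t1 i) a j w) - (Y (t1 i) a j w - Y (t0 i) a j w))) a 0| <= eta2.
  have [_ _ /(_ w (n2 (i, a)))/ltW h] := hN2 (i, a); move: h => /=.
  have z0 : ~ Z (t0 i) w by move=> h; apply: (n3 i); left; left.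
  have z1 : ~ Z (t1 i) w by move=> h; apply: (n3 i); left; right.
  have z2 : ~ Z (t2 i) w by move=> h; apply: (n3 i); right.
  have [_ _ _ /(_ w z0) x0] := hYN _ (t01 i); have [_ _ _ /(_ w z1) x1] := hYN _ (t11 i).
  have [_ _ _ /(_ w z2) x2] := hYN _ (t21 i).
  rewrite x0 x1 x2.
  apply: le_trans; apply: le_of_eq; congr `|_|.
  rewrite !mxE !sumrB -/(Y _) -/(Y _) -/(Y _); ring.
apply: (@le_trans _ _ (4 * r.+1%:R * \sum_(i < r.+1) \sum_(a < d) eta2 ^+ 2)).
  rewrite ler_wpM2l ?mulr_ge0 ?ler0n//; apply: ler_sum => i _; apply: ler_sum => a _.
  by rewrite -[leLHS]real_normK ?num_real// lerXn2r ?nnegrE// ltW.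
have -> : \sum_(i < r.+1) \sum_(a < d) eta2 ^+ 2 = r.+1%:R * (d%:R * eta2 ^+ 2).
  by rewrite !sumr_const !card_ord !mulr_natl.
have -> : 4 * r.+1%:R * (r.+1%:R * (d%:R * eta2 ^+ 2)) = eta ^+ 2 / d%:R.
  have p0 : r.+1%:R != 0 :> R by rewrite pnatr_eq0.
  have dn0 : d%:R != 0 :> R by rewrite pnatr_eq0 -lt0n.
  rewrite /eta2 /K natrM; move: p0; generalize (r.+1%:R : R) => p p0.
  by field; rewrite p0 dn0.
by rewrite ler_piMr ?sqr_ge0// invf_le1 ?ltr0n// ler1n.
Qed.

(* If the first rate dominates, A h^(beta + 2) is of order 1/n; otherwise h is of the
   order of the second rate on both sides, which is needed as the exponent e of h may
   have either sign. *)
Lemma bias_le_noise (R : realType) (beta betab Lb A K h : R) (n : nat) :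
  0 < beta -> 0 <= Lb -> 0 < A -> 0 < K -> (0 < n)%N -> 0 < h -> h < K^-1 ->
  let r1 := (A * n%:R) `^ (- (beta + 2)^-1) in
  let r := if Lb == 0 then r1 else
    Num.max r1 ((Lb^-1 * A * n%:R `^ 2^-1) `^ (- (beta - betab + 2^-1)^-1)) in
  h <= K * r -> r <= K * h ->
  A * h `^ beta <=
    (K `^ (beta + 2) + K `^ (beta - betab + 2^-1) +
     K `^ (- (beta - betab + 2^-1))) *
    (n%:R^-1 * h ^- 2 + Lb * n%:R `^ (- 2^-1) * h `^ (betab - 2^-1)).
Proof.
move=> b0 L0 A0 K0 n0 h0 hK r1 r hr rh.
set e := beta - betab + 2^-1.
have N0 : 0 < n%:R :> R by rewrite ltr0n.
have hn0 : h != 0 by rewrite gt_eqF.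
pose k1 := n%:R^-1 * h ^- 2; pose k2 := Lb * n%:R `^ (- 2^-1) * h `^ (betab - 2^-1).
have k10 : 0 <= k1 by rewrite mulr_ge0 ?invr_ge0 ?exprn_ge0 ?ler0n ?ltW.
have k20 : 0 <= k2 by rewrite !mulr_ge0 ?powR_ge0.
have Ks0 : [/\ 0 <= K `^ (beta + 2), 0 <= K `^ e & 0 <= K `^ (- e)] by split; rewrite powR_ge0.
have [K1 K2 K3] := Ks0.
have hbeta : 0 < h `^ beta by rewrite powR_gt0.
have An0 : 0 < A * n%:R by rewrite mulr_gt0.
rewrite -/k1 -/k2.
suff [h1|h2] : (A * h `^ beta <= K `^ (beta + 2) * k1) \/
               (A * h `^ beta <= (K `^ e + K `^ (- e)) * k2).
- apply: (le_trans h1); rewrite -subr_ge0.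
  have -> : (K `^ (beta + 2) + K `^ e + K `^ (- e)) * (k1 + k2) - K `^ (beta + 2) * k1 =
     (K `^ e + K `^ (- e)) * k1 + (K `^ (beta + 2) + K `^ e + K `^ (- e)) * k2 by ring.
  by rewrite addr_ge0// mulr_ge0// ?addr_ge0// addr_ge0.
- apply: (le_trans h2); rewrite -subr_ge0.
  have -> : (K `^ (beta + 2) + K `^ e + K `^ (- e)) * (k1 + k2) - (K `^ e + K `^ (- e)) * k2 =
     (K `^ (beta + 2) + K `^ e + K `^ (- e)) * k1 + K `^ (beta + 2) * k2 by ring.
  by rewrite addr_ge0// mulr_ge0// ?addr_ge0// addr_ge0.
have case1 : h <= K * r1 -> A * h `^ beta <= K `^ (beta + 2) * k1.
  move=> hr1; have b2 : 0 < beta + 2 by lra.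
  have : h `^ (beta + 2) <= (K * r1) `^ (beta + 2).
    by apply: ge0_ler_powR; rewrite ?nnegrE ?mulr_ge0 ?powR_ge0// ltW.
  rewrite powRM ?powR_ge0 ?(ltW K0)// -powRrM mulNr mulVf ?gt_eqF// powR_inv1 ?(ltW An0)//.
  rewrite powRD ?hn0 ?implybT// -[2]/(2%:R) powR_mulrn ?(ltW h0)//.
  rewrite -ler_pdivlMr ?exprn_gt0// => hh.
  rewrite mulrC -ler_pdivlMr//; apply: (le_trans hh).
  by rewrite /k1 invfM; apply: le_of_eq; ring.
have [L00|Ln0] := eqVneq Lb 0; first by left; apply: case1; move: hr; rewrite /r L00 eqxx.
have Lp : 0 < Lb by rewrite lt_neqAle eq_sym Ln0.
move: hr rh; rewrite /r (negPf Ln0); set r2 := (X in Num.max _ X).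
rewrite ge_max => hr /andP[_ r2h].
have [r12|r21] := leP r2 r1.
  by left; apply: case1; move: hr; rewrite max_l.
right; move: hr; rewrite max_r ?(ltW r21)// => hr2.
pose B := Lb^-1 * A * n%:R `^ 2^-1.
have B0 : 0 < B by rewrite !mulr_gt0 ?invr_gt0 ?powR_gt0.
(* For e = 0 the exponent - e^-1 evaluates to 0, so the second rate is 1, and 1 <= K h contradicts h
   < 1 / K. *)
have e_neq0 : e != 0.
  apply: contraTneq r2h => e0; rewrite /r2 -/e e0 invr0 oppr0 powRr0 -ltNge.
  by move: hK; rewrite -ltr_pdivlMl// mulr1.
have r2e : r2 `^ e = B^-1.
  by rewrite /r2 -powRrM mulNr mulVf// powR_inv1// ltW.
have r20 : 0 < r2 by rewrite powR_gt0.
have he : h `^ e <= (K `^ e + K `^ (- e)) * B^-1.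
  have [ep|en] := ltP 0 e.
    have : h `^ e <= (K * r2) `^ e.
      by apply: ge0_ler_powR; rewrite ?nnegrE ?mulr_ge0 ?powR_ge0// ltW.
    rewrite powRM ?(ltW K0) ?(ltW r20)// r2e => /le_trans; apply.
    by rewrite ler_wpM2r ?invr_ge0 ?(ltW B0)// lerDl.
  (* For negative e the power decreases in h, so the lower bound on h is the one to use. *)
  have : r2 `^ (- e) <= (K * h) `^ (- e).
    apply: ge0_ler_powR; rewrite ?nnegrE ?mulr_ge0 ?(ltW K0) ?(ltW h0) ?(ltW r20)//.
    by rewrite oppr_ge0.
  rewrite powRM ?(ltW K0) ?(ltW h0)// !powRN r2e invrK => hh.
  apply: (@le_trans _ _ ((K `^ e)^-1 * B^-1)); last first.
    by rewrite -[(K `^ e)^-1]powRN ler_wpM2r ?invr_ge0 ?(ltW B0)// lerDr.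
  have he0 : 0 < h `^ e by rewrite powR_gt0.
  rewrite ler_pdivlMr//; move: hh; rewrite ler_pdivlMr//.
  by rewrite [B * _]mulrC.
have hb0 : 0 < h `^ (betab - 2^-1) by rewrite powR_gt0.
have -> : h `^ beta = h `^ e * h `^ (betab - 2^-1).
  by rewrite -powRD ?hn0 ?implybT//; congr (_ `^ _); rewrite /e; ring.
have -> : (K `^ e + K `^ (- e)) * k2 =
    A * ((K `^ e + K `^ (- e)) * B^-1) * h `^ (betab - 2^-1).
  rewrite /k2 /B !invfM invrK [n%:R `^ (- _)]powRN.
  set x := K `^ e + _.
  have An : A != 0 by rewrite gt_eqF.
  field; rewrite An /= gt_eqF// powR_gt0//.
by rewrite mulrA ler_wpM2r ?(ltW hb0)// ler_wpM2l// ltW.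
Qed.

Lemma powR_le1 (R : realType) (x p : R) : 0 <= x <= 1 -> 0 <= p -> x `^ p <= 1.
Proof.
move=> /andP[x0 x1] p0; have <- : (1 : R) `^ p = 1 by rewrite powR1.
by rewrite ge0_ler_powR// nnegrE ler01.
Qed.

(** The drift part of the critical value is of order 1/n, hence below n^{-1} h^{-2} as h <= 1; only
    the part q requires the balance of the rates. *)
Lemma bias_plus_small_le (R : realType) (betab Lb A K1 K2 y h q alpha : R) (n : nat) :
  0 <= Lb -> 0 < h -> h <= 1 -> 0 <= K2 -> 0 < alpha -> 0 <= y <= 1 ->
  q <= K1 * kappa_alt betab Lb n h 1 ->
  (q + K2 * Lb ^+ 2 * n%:R^-1 * y) * alpha^-1
    <= (K1 + K2 * Lb ^+ 2) / alpha * kappa_alt betab Lb n h 1.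
Proof.
move=> L0 h0 h1 K20 a0 /andP[y0 y1] hq.
have : 0 <= Lb ^+ 2 by rewrite sqr_ge0.
move: (Lb ^+ 2) => L2 L20.
rewrite [leRHS]mulrAC ler_wpM2r ?invr_ge0 ?(ltW a0)// mulrDl lerD// -!mulrA.
rewrite ler_wpM2l// ler_wpM2l//.
rewrite /kappa_alt mul1r; apply: (@le_trans _ _ (n%:R^-1 * h ^- 2)); last first.
  by rewrite lerDl !mulr_ge0 ?powR_ge0.
by rewrite ler_wpM2l// (le_trans y1)// invf_ge1 ?exprn_gt0// expr_le1// (ltW h0).
Qed.

Lemma crit_nogap_le (R : realType) (c1 c2 alpha betab betaS Lb LS K h : R) (n : nat) :
  0 < c1 -> 0 < c2 -> 0 < alpha -> betaS <= betab -> 0 < betaS -> 0 <= Lb -> 0 < LS ->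
  0 < K -> (0 < n)%N -> 0 < h -> h <= 1 -> h < K^-1 ->
  h <= K * rate_nogap betab betaS Lb LS n -> rate_nogap betab betaS Lb LS n <= K * h ->
  crit_nogap c1 c2 alpha betab betaS Lb LS n h <=
   (c1 * (K `^ (betaS + 2) + K `^ (betaS - betab + 2^-1) + K `^ (- (betaS - betab + 2^-1)))
     + c2 * Lb ^+ 2) / alpha * kappa_alt betab Lb n h 1.
Proof.
move=> c10 c20 a0 bb b0 L0 LS0 K0 n0 h0 h1 hK hr rh.
have := bias_le_noise b0 L0 LS0 K0 n0 h0 hK hr rh.
set K1 := _ + K `^ (- _) => hb.
rewrite /crit_nogap.
have -> : h `^ betaS * (c1 * LS + c2 * Lb ^+ 2 * n%:R^-1 * h `^ betab) =
  c1 * (LS * h `^ betaS) + c2 * Lb ^+ 2 * n%:R^-1 * (h `^ betaS * h `^ betab) by ring.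
apply: bias_plus_small_le => //; first exact: ltW.
  have bb0 : 0 <= betab by rewrite (le_trans _ bb)// ltW.
  by rewrite mulr_ge0 ?powR_ge0//= mulr_ile1 ?powR_ge0// powR_le1// ?(ltW h0)// ltW.
by rewrite -mulrA ler_wpM2l ?(ltW c10)// /kappa_alt mul1r.
Qed.

(** The balance with exponent 2 betaS and A = LS^2 / lam. The resulting constant is free of lam,
    which may thus vary with n. *)
Lemma crit_gap_le (R : realType) (c1 c2 alpha betab betaS Lb LS lam K h : R) (n : nat) :
  0 < c1 -> 0 < c2 -> 0 < alpha -> betaS <= betab -> 0 < betaS -> 0 <= Lb -> 0 < LS -> 0 < lam ->
  0 < K -> (0 < n)%N -> 0 < h -> h <= 1 -> h < K^-1 ->
  h <= K * rate_gap betab betaS Lb LS lam n -> rate_gap betab betaS Lb LS lam n <= K * h ->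
  crit_gap c1 c2 alpha betaS Lb LS lam n h <=
   (c1 * (K `^ (2 * betaS + 2) + K `^ (2 * betaS - betab + 2^-1)
          + K `^ (- (2 * betaS - betab + 2^-1)))
     + c2 * Lb ^+ 2) / alpha * kappa_alt betab Lb n h 1.
Proof.
move=> c10 c20 a0 bb b0 L0 LS0 l0 K0 n0 h0 h1 hK.
have A0 : 0 < lam^-1 * LS ^+ 2 by rewrite mulr_gt0 ?invr_gt0 ?exprn_gt0.
have b20 : 0 < 2 * betaS by rewrite mulr_gt0.
rewrite /rate_gap (_ : lam^-1 * Lb^-1 * LS ^+ 2 = Lb^-1 * (lam^-1 * LS ^+ 2)); last by ring.
move=> hr rh.
have := @bias_le_noise R _ betab _ _ _ _ _ b20 L0 A0 K0 n0 h0 hK hr rh.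
set K1 := _ + K `^ (- _) => hb.
rewrite /crit_gap.
have -> : h `^ (2 * betaS) * (c1 * lam^-1 * LS ^+ 2 + c2 * Lb ^+ 2 * n%:R^-1) =
  c1 * (lam^-1 * LS ^+ 2 * h `^ (2 * betaS)) + c2 * Lb ^+ 2 * n%:R^-1 * h `^ (2 * betaS) by ring.
apply: bias_plus_small_le => //; first exact: ltW.
  by rewrite powR_ge0/= powR_le1// ?(ltW h0)// ltW.
by rewrite -[c1 * K1 * _]mulrA ler_wpM2l ?(ltW c10)// /kappa_alt mul1r.
Qed.

(** * Measurability of the test, counting of good groups and the lower bound for the statistic *)

Lemma block_time_in (R : realType) (n : nat) (h : R) (k i : nat) :
  0 < h -> (0 < n)%N -> (k < Num.truncn h^-1)%N -> (i <= Num.truncn (n%:R * h))%N ->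
  0 <= k%:R * h + i%:R / n%:R <= 1.
Proof.
move=> h0 n0 kh ih.
have N0 : 0 < n%:R :> R by rewrite ltr0n.
rewrite addr_ge0 ?mulr_ge0 ?invr_ge0 ?ler0n ?(ltW h0)//=.
have i1 : i%:R <= n%:R * h.
  by rewrite -truncn_ge_nat ?mulr_ge0 ?ler0n ?(ltW h0).
have k1 : k.+1%:R <= h^-1 by rewrite -truncn_ge_nat ?invr_ge0 ?(ltW h0).
have : k.+1%:R * h <= 1 by rewrite -ler_pdivlMr// div1r.
have : i%:R / n%:R <= h by rewrite ler_pdivrMr// mulrC.
rewrite -natr1 mulrDl mul1r; lra.
Qed.

Lemma measurable_Sigma_hat (R : realType) disp (T : measurableType disp)
    (d n : nat) (h : R) (X : R -> T -> 'cV[R]_d) (k : nat) :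
  (forall t i, 0 <= t <= 1 -> measurable_fun setT (fun w => X t w i 0)) ->
  0 < h -> (0 < n)%N -> (k < Num.truncn h^-1)%N ->
  forall i j, measurable_fun setT (fun w => Sigma_hat n h (X^~ w) k i j).
Proof.
move=> mX h0 n0 kh.
have minc (i : 'I_(Num.truncn (n%:R * h))) a :
    measurable_fun setT (fun w => increment n h (X^~ w) k i.+1 a 0).
  rewrite (_ : (fun _ => _) = (fun w => X (k%:R * h + i.+1%:R / n%:R) w a 0 -
      X (k%:R * h + i%:R / n%:R) w a 0)); last first.
    by apply/funext => w; rewrite /increment !mxE -[i.+1%:R]natr1 addrK natr1.
  by apply: measurable_funB; apply: mX; apply: block_time_in => //; exact: ltnW.
move=> a b; rewrite /Sigma_hat.
set N := Num.truncn _ in minc *.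
pose c w := (n%:R * h)^-1 *: \sum_(i < N) increment n h (X^~ w) k i.+1.
have mc j : measurable_fun setT (fun w => c w j 0).
  rewrite (_ : (fun _ => _) = (fun w => (n%:R * h)^-1 *
      \sum_(i < N) increment n h (X^~ w) k i.+1 j 0)); last first.
    by apply/funext => w; rewrite /c mxE summxE.
  by apply: measurable_funM => //; apply: measurable_sum => i; exact: minc.
rewrite (_ : (fun _ => _) = (fun w => h^-1 * \sum_(i < N)
   ((increment n h (X^~ w) k i.+1 a 0 - c w a 0) *
    (increment n h (X^~ w) k i.+1 b 0 - c w b 0)))); last first.
  apply/funext => w; rewrite mxE summxE big_add1 big_mkord; congr (_ * _).
  rewrite big_add1 big_mkord; apply: eq_bigr => i _.
  by rewrite /outer mxE big_ord1 !mxE.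
apply: measurable_funM => //; apply: measurable_sum => i.
by apply: measurable_funM; apply: measurable_funB => //; exact: minc.
Qed.

Lemma measurable_phi (R : realType) disp (T : measurableType disp)
    (d r n : nat) (h kappa : R) (X : R -> T -> 'cV[R]_d) :
  (forall t i, 0 <= t <= 1 -> measurable_fun setT (fun w => X t w i 0)) ->
  0 < h -> (0 < n)%N -> (r < d)%N ->
  measurable [set w | phi r n h kappa (X^~ w)].
Proof.
move=> mX h0 n0 rd; rewrite /phi /T_stat; apply: measurable_lt_set => //.
rewrite (_ : (fun _ => _) = (fun w => \sum_(k < Num.truncn h^-1)
   h * eigval r.+1 (Sigma_hat n h (X^~ w) k))); last first.
  by apply/funext => w; rewrite big_mkord.
apply: measurable_sum => k; apply: measurable_funM => //.
apply: measurable_eigval => //; last by move=> w; exact: Sigma_hat_sym.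
exact: measurable_Sigma_hat.
Qed.

(** The expected number of events [N i] that occur is at most delta times their total number, so at
    least half of them occur with probability at most 2 delta. *)
Lemma count_markov (R : realType) disp (T : measurableType disp)
    (P : probability T R) (I : finType) (N : I -> set T) (delta : R) :
  (forall i, measurable (N i)) -> (forall i, P (N i) <= delta%:E)%E -> (0 < #|I|)%N ->
  exists E, [/\ measurable E, (P E <= (2 * delta)%:E)%E &
    forall w, ~ E w -> #|I|%:R / 2 <= \sum_i (~~ `[< N i w >])%:R :> R].
Proof.
move=> mN PN I0.
have I0' : 0 < #|I|%:R / 2 :> R by rewrite divr_gt0// ltr0n.
have := @markov_ereal R disp T P (fun w => \sum_(i : I) (\1_(N i) w)%:E)%E
   (#|I|%:R * delta) (#|I|%:R / 2).
move=> []//.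
- by apply: emeasurable_sum => i; apply/measurable_EFinP; exact: measurable_indic.
- by move=> w; apply: sume_ge0 => i _; rewrite lee_fin.
- rewrite ge0_integral_sum//; last first.
    by move=> i; apply/measurable_EFinP; exact: measurable_indic.
  apply: (@le_trans _ _ (\sum_(i : I) delta%:E)%E).
    apply: lee_sum => i _; rewrite integral_indic// setIT; exact: PN.
  by rewrite sumEFin lee_fin sumr_const mulr_natl.
move=> mE PE; eexists; split; [exact: mE| |].
  rewrite (le_trans PE)// lee_fin; apply: le_of_eq.
  by field; rewrite pnatr_eq0 -lt0n.
move=> w /negP; rewrite -ltNge sumEFin lte_fin => hw.
have -> : \sum_i (~~ `[< N i w >])%:R = #|I|%:R - \sum_i \1_(N i) w :> R.
  rewrite -sumr_const -sumrB; apply: eq_bigr => i _.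
  by rewrite indicE; case: asboolP => Ni /=; [rewrite mem_set// subrr|rewrite memNset// subr0].
lra.
Qed.

Lemma eigval_spd_ge0 (R : realType) (d r : nat) (A : 'M[R]_d) :
  (r < d)%N -> spd A -> 0 <= eigval r.+1 A.
Proof.
move=> rd [symA psd]; have [B [BB tr]] := trace_le_eigval symA rd.
suff : 0 <= (d - r)%:R * eigval r.+1 A by rewrite pmulr_rge0// ltr0n subn_gt0.
apply: le_trans tr; rewrite /mxtrace; apply: sumr_ge0 => i _.
have := psd (row i B)^T; rewrite trmxK -row_mul => /le_trans; apply.
apply: le_of_eq.
by rewrite -!row_mul !mxE; apply: eq_bigr => j _; rewrite !mxE.
Qed.

Lemma eigval_Sigma_hat_ge0 (R : realType) (d r n : nat) (h : R) (x : R -> 'cV[R]_d) (k : nat) :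
  (r < d)%N -> 0 < h -> 0 <= eigval r.+1 (Sigma_hat n h x k).
Proof.
move=> rd h0.
(* The lower bound with no group at all, whose left-hand side is 0. *)
have /(_ (fun _ => true)) := @eigval_Sigma_hat_ge R d r n h 0 x k 0 _ rd h0.
rewrite big_ord0 mulr0 pmulr_rge0; first by apply; rewrite ?mul0n.
by rewrite mulr_gt0 ?ltr0n// subn_gt0.
Qed.

(** The weight h of a block cancels the factor 1 / h of the eigenvalue bound, and blocks outside the
    chosen range contribute nonnegative terms. *)
Lemma T_stat_ge (R : realType) (d r n : nat) (h eta : R) (x : R -> 'cV[R]_d)
    (k0 K M : nat) (good : nat -> nat -> bool) :
  (r < d)%N -> 0 < h -> (k0 + K <= Num.truncn h^-1)%N ->
  (2 * (M * r.+1) <= Num.truncn (n%:R * h))%N ->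
  (forall i g, (i < K)%N -> (g < M)%N -> good i g -> sep eta (fun j : 'I_r.+1 =>
     increment n h x (k0 + i) (2 * (g * r.+1 + j) + 2) -
     increment n h x (k0 + i) (2 * (g * r.+1 + j) + 1))) ->
  eta ^+ 2 / 2 * \sum_(i < K) \sum_(g < M) (good i g)%:R <=
  r.+1%:R * (d - r)%:R * T_stat r n h x.
Proof.
move=> rd h0 kK MN hgood.
have c0 : 0 <= r.+1%:R * (d - r)%:R :> R by [].
apply: (@le_trans _ _ (r.+1%:R * (d - r)%:R *
    \sum_(i < K) h * eigval r.+1 (Sigma_hat n h x (k0 + i)))).
  rewrite mulr_sumr [leRHS]mulr_sumr; apply: ler_sum => i _.
  have := eigval_Sigma_hat_ge rd h0 MN (fun g gM => hgood i g (ltn_ord i) gM).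
  move=> le1; rewrite -(ler_pM2l h0) in le1; rewrite mulrCA; apply: le_trans le1.
  apply: le_of_eq.
  by field; rewrite gt_eqF.
rewrite ler_wpM2l//.
have ev0 k : 0 <= h * eigval r.+1 (Sigma_hat n h x k).
  by rewrite mulr_ge0 ?(ltW h0)// eigval_Sigma_hat_ge0.
rewrite /T_stat (@big_cat_nat _ _ _ (k0 + K))//= (@big_cat_nat _ _ _ k0) ?leq_addr//=.
set s0 := \sum_(0 <= i < k0) _; set s2 := \sum_(_ <= i < Num.truncn _) _.
have -> : \sum_(k0 <= i < k0 + K) h * eigval r.+1 (Sigma_hat n h x i) =
    \sum_(i < K) h * eigval r.+1 (Sigma_hat n h x (k0 + i)).
  rewrite -{1}[k0]add0n big_addn addKn big_mkord.
  by apply: eq_bigr => i _; rewrite addnC.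
rewrite -subr_ge0 [_ + s2 - _]addrAC addrK addr_ge0//.
  by apply: sumr_ge0.
by apply: sumr_ge0.
Qed.

(** Starting after floor(a / h) and giving up one block for alignment leaves floor(x) - 1 > x - 2
    blocks, where x = (c - a) / h; this is at least x / 2 because x >= 4. *)
Lemma blocks_within (R : realType) (a c h : R) :
  0 <= a -> c <= 1 -> 0 < h -> 4 * h <= c - a -> exists k0 K : nat,
  [/\ a <= k0%:R * h, (k0 + K)%:R * h <= c, (k0 + K <= Num.truncn h^-1)%N &
      (c - a) / (2 * h) <= K%:R].
Proof.
move=> a0 c1 h0 hac.
have ah0 : 0 <= a / h by rewrite divr_ge0// ltW.
have ca4 : 4 <= (c - a) / h by rewrite ler_pdivlMr.
have ca0 : 0 <= (c - a) / h by rewrite (le_trans _ ca4).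
have /andP[u1 u2] := truncn_itv ah0; have /andP[v1 v2] := truncn_itv ca0.
set u := Num.truncn _ in u1 u2; set q := Num.truncn _ in v1 v2.
have q4 : (1 <= q)%N by rewrite /q truncn_ge_nat// (le_trans _ ca4)// ler_nat.
have uq : (u.+1 + q.-1 = u + q)%N by rewrite addSnnS prednK.
have ss : u%:R + q%:R <= c / h by rewrite (le_trans (lerD u1 v1))// -mulrDl addrC subrK.
exists u.+1, q.-1; rewrite uq natrD; split.
- by rewrite -ler_pdivrMr// ltW.
- by rewrite -ler_pdivlMr.
- rewrite truncn_ge_nat ?invr_ge0 ?(ltW h0)// natrD (le_trans ss)//.
  by rewrite ler_piMl ?invr_ge0 ?(ltW h0).
- have -> : q.-1%:R = q%:R - 1 :> R by rewrite -[q in RHS]prednK// -natr1 addrK.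
  rewrite invfM mulrCA; move: v2; rewrite -natr1; lra.
Qed.

(** A group of p differences uses 2 p increments. As N >= 4 p there are at least two groups, so
    rounding down costs at most a factor 2. *)
Lemma groups_within (R : realType) (p N : nat) (x : R) :
  (0 < p)%N -> x = N%:R -> 4 * p%:R <= x -> exists M : nat,
  [/\ (2 * (M * p) <= N)%N, (0 < M)%N & x / (4 * p%:R) <= M%:R].
Proof.
move=> p0 -> ; rewrite -natrM ler_nat => pN; exists (N %/ (2 * p))%N.
have le1 : (2 * p <= N)%N by apply: leq_trans pN; rewrite leq_mul2r orbT.
split.
- by rewrite mulnCA; exact: leq_divM.
- by rewrite divn_gt0// muln_gt0.
rewrite ler_pdivrMr ?ltr0n ?muln_gt0//.
rewrite -natrM ler_nat.
have p20 : (0 < 2 * p)%N by rewrite muln_gt0.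
apply: leq_trans (ltnW (ltn_ceil N p20)) _.
have M1 : (1 < N %/ (2 * p))%N by rewrite leq_divRL// mulnA.
move: (N %/ _)%N M1 => M M1.
rewrite (_ : M * (4 * p) = (M * 2) * (2 * p))%N; last by rewrite -!mulnA (mulnA 2%N).
rewrite leq_mul2r muln2 -addnn -[M.+1]addn1.
by rewrite leq_add2l (ltnW M1) orbT.
Qed.

Lemma pair_index_le (g j M p N : nat) :
  (g < M)%N -> (j < p)%N -> (2 * (M * p) <= N)%N -> (2 * (g * p + j) + 2 <= N)%N.
Proof.
move=> gM jp; apply: leq_trans.
have : (g.+1 * p <= M * p)%N by rewrite leq_mul2r gM orbT.
rewrite mulSn; move: (g * p)%N (M * p)%N => x y; lia.
Qed.

(** There are at least (c - a) / (2 h) blocks with n h / (4 (r + 1)) groups each, and outside an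
    event of probability at most twice the failure bound of one group, half of these groups are (eta
    / 2)-separated. Inserting this into [T_stat_ge] gives 128 = 8 * 8 * 2. *)
Lemma power_ge (R : realType) disp (T : measurableType disp)
    (P : probability T R) (F : R -> set (set T)) (m d r n : nat) (W : R -> T -> 'cV[R]_m)
    (betab Lb h kappa a c lam eta : R) (Sigma : R -> 'M[R]_d) (b X : R -> T -> 'cV[R]_d) :
  (r < d)%N -> filtration F -> brownian_motion P F W -> 0 <= betab -> 0 <= Lb ->
  drift_class P F betab Lb b -> ito_model P F W Sigma b X ->
  (0 < n)%N -> admissible_block n h -> 4 * r.+1%:R <= n%:R * h ->
  0 <= a -> c <= 1 -> 4 * h <= c - a -> 0 < lam -> 0 < eta ->
  (forall t, a <= t <= c -> lam <= eigval r.+1 (Sigma t)) ->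
  kappa < eta ^+ 2 * n%:R * (c - a) / (128 * r.+1%:R ^+ 2 * (d - r)%:R) ->
  ((1 - 2 * (17 * r.+1%:R * eta / Num.sqrt (n%:R^-1 * lam / d%:R) +
      (r.+1 * d)%:R * (4 * (Lb + 1) * n%:R^-1 / (eta / (2 * (r.+1 * d)%:R)))))%:E
   <= P [set w | phi r n h kappa (X^~ w)])%E.
Proof.
move=> rd filF bmW b0 L0 bdr ito n0 [h0 h1 nh ih] rnh a0 c1 hac l0 e0 hlam hk.
have mX := ito.2.1.
have N0 : 0 < n%:R :> R by rewrite ltr0n.
have [k0 [K [k0a kKc kK hK]]] := blocks_within a0 c1 h0 hac.
have nhE : n%:R * h = (Num.truncn (n%:R * h))%:R by apply/eqP; rewrite eq_sym -natrE.
have [M [MN M0 hM]] := groups_within (ltn0Sn r) nhE rnh.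
set N := Num.truncn (n%:R * h) in nhE MN.
set dl := _ + _ * (_ / _).
(* For s = 0, 1, 2 these are the three consecutive observation times of the j-th difference in group
   g of block k. Increment number 2 q + 1 starts at time index 2 q, which accounts for the shift by
   one against [increment]. *)
pose tm (k g : nat) (j : 'I_r.+1) (s : nat) : R :=
  k%:R * h + (2 * (g * r.+1 + j) + s)%:R / n%:R.
have tmS k g j s : tm k g j s.+1 = tm k g j s + n%:R^-1.
  by rewrite /tm addnS -natr1 mulrDl mul1r addrA.
have idx (g : nat) (j : 'I_r.+1) : (g < M)%N -> (2 * (g * r.+1 + j) + 2 <= N)%N.
  by move=> gM; exact: pair_index_le gM (ltn_ord j) MN.
have tm_end k g j : (g < M)%N -> tm k g j 2 <= k.+1%:R * h.
  move=> gM; rewrite /tm -[k.+1%:R]natr1 [leRHS]mulrDl mul1r lerD2l ler_pdivrMr// mulrC nhE ler_nat.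
  exact: idx.
have tm0 k g j s : 0 <= tm k g j s.
  by rewrite addr_ge0// mulr_ge0 ?ler0n ?invr_ge0 ?ltW.
have kc i : (i < K)%N -> (k0 + i).+1%:R * h <= c.
  move=> iK; apply: le_trans kKc; rewrite ler_wpM2r ?(ltW h0)// ler_nat.
  by rewrite -addnS leq_add2l.
have grp (p : nat * nat) : exists E : set T, (p.1 < K)%N -> (p.2 < M)%N ->
    [/\ measurable E, (P E <= dl%:E)%E & forall w, ~ E w ->
      sep (eta / 2) (fun j => X (tm (k0 + p.1)%N p.2 j 2) w - X (tm (k0 + p.1)%N p.2 j 1) w -
        (X (tm (k0 + p.1)%N p.2 j 1) w - X (tm (k0 + p.1)%N p.2 j 0) w))].
  case: p => i g /=.
  have [/andP[iK gM]|ng] := boolP ((i < K) && (g < M))%N; last first.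
    by exists set0 => iK gM; rewrite iK gM in ng.
  have [||||||E [mE PE sE]] := @group_small_ball R disp T P F m d r W betab Lb Sigma b X
    (fun j => tm (k0 + i)%N g j 0) (fun j => tm (k0 + i)%N g j 1)
    (fun j => tm (k0 + i)%N g j 2) n%:R^-1 lam eta rd filF bmW b0 L0 bdr ito.
  - move=> j; rewrite tm0 -!tmS; split => //.
    by rewrite (le_trans (tm_end _ _ _ gM))// (le_trans (kc _ iK)).
  - move=> j j' jj; rewrite lerD2l ler_wpM2r ?invr_ge0 ?(ltW N0)// ler_nat.
    by rewrite addn0 -mulnSr leq_mul2l/= -addnS leq_add2l.
  - by rewrite invr_gt0.
  - by [].
  - by [].
  - move=> j t /andP[t1 t2]; apply: hlam.
    apply/andP; split; last first.
      by rewrite (le_trans t2)// (le_trans (tm_end _ _ _ gM))// (kc _ iK).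
    apply: le_trans t1.
    rewrite (le_trans k0a)// /tm natrD mulrDl -addrA lerDl.
    exact: (tm0 i g j 0%N).
  by exists E => _ _; split.
have /choice[E hE] := grp.
have [|||G [mG PG hG]] := @count_markov R disp T P ('I_K * 'I_M)%type
    (fun p => E (val p.1, val p.2)) dl.
- by move=> [i g]; have [] := hE (val i, val g) (ltn_ord i) (ltn_ord g).
- by move=> [i g]; have [] := hE (val i, val g) (ltn_ord i) (ltn_ord g).
- rewrite card_prod !card_ord muln_gt0 M0 andbT -(ltr0n R).
  by apply: lt_le_trans hK; rewrite divr_gt0 ?mulr_gt0//; lra.
have sub : ~` G `<=` [set w | phi r n h kappa (X^~ w)].
  move=> w nG; rewrite /phi/=.
  pose good i g := ~~ `[< E (i, g) w >].
  have hgood i g : (i < K)%N -> (g < M)%N -> good i g -> sep (eta / 2) (fun j : 'I_r.+1 =>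
     increment n h (X^~ w) (k0 + i) (2 * (g * r.+1 + j) + 2) -
     increment n h (X^~ w) (k0 + i) (2 * (g * r.+1 + j) + 1)).
    move=> iK gM /asboolP nE; have [_ _ /(_ _ nE)] := hE (i, g) iK gM.
    congr (sep _ _); apply/funext => j /=; rewrite /increment /tm.
    have s1 q : (q + 1)%:R - 1 = q%:R :> R by rewrite natrD addrK.
    have s2 q : (q + 2)%:R - 1 = (q + 1)%:R :> R by rewrite -s1 -addnA.
    by rewrite s1 s2 addn0.
  have := T_stat_ge rd h0 kK MN hgood.
  have := hG w nG; rewrite pair_bigA/= card_prod !card_ord natrM.
  set S := \sum_ _ _; rewrite -/S => hS hT.
  have q0 : 0 < (d - r)%:R :> R by rewrite ltr0n subn_gt0.
  have p0 : 0 < r.+1%:R :> R by rewrite ltr0n.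
  have h2 : (c - a) / (2 * h) * (n%:R * h / (4 * r.+1%:R)) <= K%:R * M%:R.
    apply: ler_pM => //; rewrite divr_ge0 ?mulr_ge0 ?(ltW h0) ?ler0n//; lra.
  rewrite -(ltr_pM2l (mulr_gt0 p0 q0)); apply: (lt_le_trans _ hT).
  apply: (@lt_le_trans _ _ ((eta / 2) ^+ 2 / 2 *
     ((c - a) / (2 * h) * (n%:R * h / (4 * r.+1%:R)) / 2))); last first.
    apply: ler_wpM2l; first by rewrite mulr_ge0 ?sqr_ge0.
    by apply: le_trans hS; rewrite ler_wpM2r.
  rewrite -(ltr_pM2l (mulr_gt0 p0 q0)) in hk; apply: (lt_le_trans hk).
  apply: le_of_eq.
  by field; rewrite !gt_eqF.
apply: (@le_trans _ _ (P (~` G))).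
  by rewrite probability_setC// EFinB leeB.
apply: le_measure => //; rewrite ?inE; first exact: measurableC.
exact: measurable_phi.
Qed.

(** Half of v is given up since the supremum need not be attained. The infimum of the eigenvalue
    over the interval is a genuine lower bound because the eigenvalues are nonnegative. *)
Lemma alt_cov_interval (R : realType) (d r : nat) (hbar v C : R) (Sigma : R -> 'M[R]_d) :
  (r < d)%N -> 0 < hbar -> 0 < v -> alt_cov r hbar v C Sigma -> exists a c lam : R,
  [/\ [/\ 0 <= a, c <= 1 & hbar <= c - a], 0 < lam, v / 2 <= (c - a) * lam &
      forall t, a <= t <= c -> lam <= eigval r.+1 (Sigma t)].
Proof.
move=> rd hb0 v0 [[_ spdS] hsup _].
have v2 : ((v / 2)%:E < v%:E)%E by rewrite lte_fin; lra.
have [x [a [c [a0 c1 hca ->]]]] := ereal_sup_gt (lt_le_trans v2 hsup).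
set lam := inf _; rewrite lte_fin => hv.
have ca0 : 0 < c - a by exact: lt_le_trans hca.
have lam0 : 0 < lam by rewrite -(pmulr_rgt0 _ ca0) (lt_trans _ hv)// divr_gt0.
exists a, c, lam; split => //; first exact: ltW.
move=> t /andP[at1 tc]; apply: ge_inf; last by exists t => //=; rewrite in_itv/= at1.
exists 0 => y [t' /= ]; rewrite in_itv/= => /andP[at' t'c] <-.
by apply: eigval_spd_ge0 => //; apply: spdS; rewrite (le_trans a0)//= (le_trans t'c).
Qed.

(** By the choice of eta the Gaussian term is a multiple of s^{-1/2}. The drift term is of order 1 /
    (n eta), and n^2 eta^2 = n lam / s >= s / 2 gives it the same order. *)
Lemma small_ball_rate (R : realType) (p d n : nat) (Lb s lam eta : R) :
  (0 < p)%N -> (0 < d)%N -> (0 < n)%N -> 0 <= Lb -> 0 < s -> 0 < lam ->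
  s ^+ 2 <= 2 * (lam * n%:R) ->
  eta = Num.sqrt (s^-1 * (n%:R^-1 * lam)) ->
  17 * p%:R * eta / Num.sqrt (n%:R^-1 * lam / d%:R) +
    (p * d)%:R * (4 * (Lb + 1) * n%:R^-1 / (eta / (2 * (p * d)%:R))) <=
  (17 * p%:R / Num.sqrt d%:R^-1 + 16 * (p * d)%:R ^+ 2 * (Lb + 1)) * Num.sqrt s^-1.
Proof.
move=> p0 d0 n0 L0 s0 l0 hs etaE.
have N0 : 0 < n%:R :> R by rewrite ltr0n.
have D0 : 0 < d%:R :> R by rewrite ltr0n.
have Q0 : 0 < (p * d)%:R :> R by rewrite ltr0n muln_gt0 p0.
have nl0 : 0 < n%:R^-1 * lam by rewrite mulr_gt0 ?invr_gt0.
have si0 : 0 < s^-1 by rewrite invr_gt0.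
have eta0 : 0 < eta by rewrite etaE sqrtr_gt0 mulr_gt0.
set x := Num.sqrt s^-1; have x0 : 0 < x by rewrite sqrtr_gt0.
have sd0 : 0 < Num.sqrt d%:R^-1 :> R by rewrite sqrtr_gt0 invr_gt0.
have snl0 : 0 < Num.sqrt (n%:R^-1 * lam) by rewrite sqrtr_gt0.
rewrite [leRHS]mulrDl lerD//.
  rewrite sqrtrM ?(ltW nl0)// etaE sqrtrM ?(ltW si0)// -/x.
  by apply: le_of_eq; field; rewrite !gt_eqF.
move: (p * d)%:R Q0 => Q Q0.
have xx : x ^+ 2 = s^-1 by rewrite sqr_sqrtr// ltW.
have ee : eta ^+ 2 = s^-1 * (n%:R^-1 * lam) by rewrite etaE sqr_sqrtr// mulr_ge0 ?ltW.
have hx : 1 <= 2 * x * (n%:R * eta).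
  have e1 : 0 <= 2 * x * (n%:R * eta) by rewrite !mulr_ge0 ?ltW.
  rewrite -(@ler_sqr R) ?nnegrE// expr1n !exprMn xx ee.
  have -> : 2 ^+ 2 / s * (n%:R ^+ 2 * (s^-1 * (n%:R^-1 * lam))) = 2 * (2 * (lam * n%:R)) / s ^+ 2.
    by field; rewrite !gt_eqF.
  by rewrite ler_pdivlMr ?exprn_gt0//; move: (sqr_ge0 s); lra.
have -> : Q * (4 * (Lb + 1) * n%:R^-1 / (eta / (2 * Q))) =
    8 * Q ^+ 2 * (Lb + 1) / (n%:R * eta).
  by field; rewrite !gt_eqF.
rewrite ler_pdivrMr ?mulr_gt0//.
rewrite (_ : 16 * _ * _ * _ * _ = 8 * Q ^+ 2 * (Lb + 1) * (2 * x * (n%:R * eta))); last first.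
  by ring.
by rewrite ler_peMr// mulr_ge0 ?addr_ge0// mulr_ge0 ?sqr_ge0.
Qed.

(** With s = sqrt(c) and eta^2 = lam / (s n), the threshold of [power_ge] becomes (e - a) lam / (128
    (r + 1)^2 (d - r) s). As (e - a) lam is at least half of the signal, c times the noise level,
    this is at least s / (256 (r + 1)^2 (d - r)) noise levels, more than Kc of them. *)
Lemma alt_power_ge (R : realType) disp (T : measurableType disp)
    (P : probability T R) (F : R -> set (set T)) (m d r n : nat) (W : R -> T -> 'cV[R]_m)
    (betab Lb h hbar kappa c C Kc : R) (Sigma : R -> 'M[R]_d) (b X : R -> T -> 'cV[R]_d) :
  (r < d)%N -> filtration F -> brownian_motion P F W -> 0 <= betab -> 0 <= Lb ->
  drift_class P F betab Lb b -> ito_model P F W Sigma b X ->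
  (0 < n)%N -> admissible_block n h -> 4 * r.+1%:R <= n%:R * h -> 4 * h <= hbar ->
  0 < c -> alt_cov r hbar (kappa_alt betab Lb n h c) C Sigma ->
  kappa <= Kc * kappa_alt betab Lb n h 1 ->
  256 * r.+1%:R ^+ 2 * (d - r)%:R * Kc < Num.sqrt c ->
  ((1 - 2 * ((17 * r.+1%:R / Num.sqrt d%:R^-1 + 16 * (r.+1 * d)%:R ^+ 2 * (Lb + 1)) *
         Num.sqrt (Num.sqrt c)^-1))%:E
   <= P [set w | phi r n h kappa (X^~ w)])%E.
Proof.
move=> rd filF bmW b0 L0 bdr ito n0 adm rnh hhb c0 alt hk hKc.
have [h0 h1 _ _] := adm.
have N0 : 0 < n%:R :> R by rewrite ltr0n.
have q0 : 0 < (d - r)%:R :> R by rewrite ltr0n subn_gt0.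
have p0 : 0 < r.+1%:R :> R by rewrite ltr0n.
set kp := kappa_alt betab Lb n h 1 in hk.
have kpE : kappa_alt betab Lb n h c = c * kp by rewrite /kp /kappa_alt mul1r.
have kpge : n%:R^-1 * h ^- 2 <= kp by rewrite /kp /kappa_alt mul1r lerDl !mulr_ge0 ?powR_ge0.
have nh0 : 0 < n%:R^-1 * h ^- 2 by rewrite mulr_gt0 ?invr_gt0 ?exprn_gt0.
have kp0 : 0 < kp by exact: lt_le_trans kpge.
have ck0 : 0 < c * kp by rewrite mulr_gt0.
rewrite kpE in alt.
have hb0 : 0 < hbar by apply: lt_le_trans hhb; rewrite mulr_gt0.
have [a [e [lam [[a0 e1 hae] lam0 hv hlam]]]] := alt_cov_interval rd hb0 ck0 alt.
set s := Num.sqrt c in hKc *.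
have s0 : 0 < s by rewrite sqrtr_gt0.
have sc : c = s ^+ 2 by rewrite sqr_sqrtr// ltW.
have si0 : 0 < s^-1 by rewrite invr_gt0.
have nl0 : 0 < n%:R^-1 * lam by rewrite mulr_gt0 ?invr_gt0.
pose eta := Num.sqrt (s^-1 * (n%:R^-1 * lam)).
have eta0 : 0 < eta by rewrite sqrtr_gt0 mulr_gt0.
have hae4 : 4 * h <= e - a by exact: le_trans hae.
have hs : s ^+ 2 <= 2 * (lam * n%:R).
  rewrite -sc; have l1 : c * n%:R^-1 <= c * kp.
    rewrite ler_wpM2l ?(ltW c0)// (le_trans _ kpge)// ler_peMr ?invr_ge0 ?(ltW N0)//.
    by rewrite invf_ge1 ?exprn_gt0// expr_le1// (ltW h0).
  have l2 : (e - a) * lam <= lam by rewrite ler_piMl ?(ltW lam0)//; lra.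
  rewrite mulrA -ler_pdivrMr//; lra.
apply: le_trans (power_ge rd filF bmW b0 L0 bdr ito n0 adm rnh a0 e1 hae4 lam0 eta0 hlam _).
  rewrite lee_fin lerB// ler_pM2l//.
  by apply: small_ball_rate => //; exact: leq_ltn_trans rd.
apply: (le_lt_trans hk).
rewrite /eta sqr_sqrtr; last by rewrite mulr_ge0 ?ltW.
apply: (@lt_le_trans _ _ (s / (256 * r.+1%:R ^+ 2 * (d - r)%:R) * kp)).
  rewrite ltr_pM2r// ltr_pdivlMr ?mulr_gt0 ?exprn_gt0// mulrC //.
have -> : s^-1 * (n%:R^-1 * lam) * n%:R * (e - a) / (128 * r.+1%:R ^+ 2 * (d - r)%:R) =
    ((e - a) * lam) * (s^-1 / (128 * r.+1%:R ^+ 2 * (d - r)%:R)).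
  by field; rewrite !gt_eqF.
apply: (@le_trans _ _ (c * kp / 2 * (s^-1 / (128 * r.+1%:R ^+ 2 * (d - r)%:R)))).
  rewrite sc; apply: le_of_eq.
  by field; rewrite !gt_eqF.
by rewrite ler_wpM2r// divr_ge0 ?ltW// !mulr_gt0 ?exprn_gt0.
Qed.

Lemma cvg_inv_root4 (R : realType) (G : set_system nat) (FG : Filter G) (c : nat -> R) :
  c n @[n --> G] --> +oo -> Num.sqrt (Num.sqrt (c n))^-1 @[n --> G] --> (0 : R).
Proof.
move=> cy; apply/cvgr0Pnorm_lt => e e0.
have e4 : 0 < e ^- 4 by rewrite invr_gt0 exprn_gt0.
have e2 : 0 < e ^- 2 by rewrite invr_gt0 exprn_gt0.
move/cvgryPgt: cy => /(_ (e ^- 4)); apply: filterS => n cn.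
have c0 : 0 < c n by exact: lt_trans cn.
rewrite ger0_norm ?sqrtr_ge0// -ltr_sqr ?nnegrE ?sqrtr_ge0 ?(ltW e0)//.
rewrite sqr_sqrtr ?invr_ge0 ?sqrtr_ge0//.
rewrite -[ltRHS]invrK ltf_pV2 ?posrE ?sqrtr_gt0// -ltr_sqr ?nnegrE ?sqrtr_ge0 ?(ltW e2)//.
rewrite sqr_sqrtr ?(ltW c0)// (le_lt_trans _ cn)//.
by rewrite exprVn -exprM.
Qed.

(* A is the set of sample sizes n along which n tends to infinity: integrality
   of n h_n and 1 / h_n with h_n -> 0 and n h_n >= 2 (r + 1) C_{d,r+1} is
   impossible along, e.g., the primes. *)
Theorem corollary2p19 (R : realType) (d r : nat) (hr : (r < d)%N) :
  exists2 Cdr : R, 1 < Cdr &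
  forall (c1 c2 : R), 0 < c1 -> 0 < c2 ->
  forall (alpha betab betaS Lb LS C : R),
    0 < alpha < 1 -> betab <= 1 -> betaS <= betab -> 0 < betaS ->
    0 <= Lb -> 0 < LS -> 0 < C ->
  forall (disp : measure_display) (Omega : measurableType disp)
    (P : probability Omega R) (F : R -> set (set Omega))
    (m : nat) (W : R -> Omega -> 'cV[R]_m),
    filtration F -> brownian_motion P F W ->
  forall (A : set nat) (h kappa0 : nat -> R),
    infinite_set A ->
    (forall n, A n -> admissible_block n (h n)) ->
    (forall n, A n -> 2 * r.+1%:R * Cdr <= n%:R * h n) ->
    h n @[n --> within A \oo] --> (0 : R) ->
    ([/\ forall n, A n ->
           kappa0 n = crit_nogap c1 c2 alpha betab betaS Lb LS n (h n),
         same_order A h (rate_nogap betab betaS Lb LS)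
       & forall n, A n ->
           has_level P F W r n (h n) (kappa0 n) betab Lb alpha
             (@null_cov R d r betaS LS)]
     \/
     exists lam : nat -> R,
     [/\ forall n, A n -> 0 < lam n,
         forall n, A n ->
           kappa0 n = crit_gap c1 c2 alpha betaS Lb LS (lam n) n (h n),
         same_order A h (fun n => rate_gap betab betaS Lb LS (lam n) n)
       & forall n, A n ->
           has_level P F W r n (h n) (kappa0 n) betab Lb alpha
             (@null_cov_gap R d r betaS LS (lam n))]) ->
  forall (c hbar : nat -> R),
    c n @[n --> within A \oo] --> +oo ->
    (forall n, A n -> 0 < hbar n < 1) ->
    hbar n / h n @[n --> within A \oo] --> +oo ->
  exists2 c' : R, 0 < c' &
    @min_power R disp Omega P F m W d r n (h n) (kappa0 n) betab Lb (hbar n)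
      (c' * kappa_alt betab Lb n (h n) (c n)) C
    @[n --> within A \oo] --> 1%E.
Proof.
(* The value 2 makes each block contain at least 4 (r + 1) increments, as [groups_within]
   requires. *)
exists 2; first by lra.
move=> c1 c2 c10 c20 alpha betab betaS Lb LS C /andP[al0 al1] b1 bS bS0 L0 LS0 C0.
move=> disp T P F m W filF bmW A h kappa0 infA adm nh h0 cases c hbar cy hb01 hby.
have b0 : 0 <= betab by rewrite (le_trans _ bS)// ltW.
have [K [Kc [K0 hKc]]] : exists K Kc : R, 0 < K /\ forall n, A n -> (0 < n)%N -> h n < K^-1 ->
    kappa0 n <= Kc * kappa_alt betab Lb n (h n) 1.
  case: cases => [[kE [K K0 hK] _]|[lam [lam0 kE [K K0 hK] _]]].
    exists K; eexists; split => // n An n0 hn.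
    have [hn0 hn1 _ _] := adm n An; have [u1 u2] := hK n An.
    rewrite kE//; exact: (crit_nogap_le (K := K)).
  exists K; eexists; split => // n An n0 hn.
  have [hn0 hn1 _ _] := adm n An; have [u1 u2] := hK n An.
  rewrite kE//; apply: (crit_gap_le (K := K)) => //; exact: lam0.
(* Any constant multiple is absorbed by c_n tending to infinity. *)
exists 1 => //.
set D : R := 17 * r.+1%:R / Num.sqrt d%:R^-1 + 16 * (r.+1 * d)%:R ^+ 2 * (Lb + 1).
have D0 : 0 <= D.
  by rewrite addr_ge0// ?mulr_ge0 ?invr_ge0 ?sqrtr_ge0 ?addr_ge0 ?exprn_ge0.
apply: (@squeeze_cvge _ (within A \oo) _ _
  (fun n => (1 - 2 * (D * Num.sqrt (Num.sqrt (c n))^-1))%:E) _ (fun _ => 1%E)); last 2 first.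
- apply: cvg_EFin; first exact: nearW.
  have : 1 - 2 * (D * Num.sqrt (Num.sqrt (c n))^-1) @[n --> within A \oo] --> (1 - 2 * (D * 0) : R).
    apply: cvgB; first exact: cvg_cst.
    apply: cvgM; first exact: cvg_cst.
    apply: cvgM; first exact: cvg_cst.
    exact: cvg_inv_root4.
  by rewrite !mulr0 subr0.
- exact: cvg_cst.
near=> n.
have An : A n by near: n; exact: withinT.
have n0 : (0 < n)%N by near: n; apply: cvg_within; exact: nbhs_infty_gt.
have hK : h n < K^-1.
  by near: n; apply: (cvgr_lt 0) => //; rewrite invr_gt0.
(* Intervals of the alternative then span at least four block lengths, as [blocks_within]
   requires. *)
have hh4 : 4 <= hbar n / h n by near: n; move/cvgryPge: hby; exact.
have cn0 : 0 < c n by near: n; move/cvgryPgt: cy; exact.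
(* Squaring dispenses with a sign for [Kc]. *)
have cnK : (256 * r.+1%:R ^+ 2 * (d - r)%:R * Kc) ^+ 2 < c n.
  by near: n; move/cvgryPgt: cy; exact.
have admn := adm n An; have [hn0 hn1 _ _] := admn.
apply/andP; split; last by apply: ereal_inf_lbound; right.
apply: le_ereal_inf_tmp => _ [[Sigma [b [X [alt bdr ito ->]]]]|->]; last first.
  by rewrite lee_fin lerBlDr lerDl !mulr_ge0 ?sqrtr_ge0.
rewrite mul1r in alt.
apply: (alt_power_ge (Kc := Kc) hr filF bmW b0 L0 bdr ito n0 admn _ _ cn0 alt).
- by have := nh n An; lra.
- by rewrite -ler_pdivlMr.
- exact: hKc.
by rewrite (le_lt_trans (ler_norm _))// -sqrtr_sqr ltr_sqrt.
Unshelve. all: by end_near.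
Qed.
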